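(* Let $G$ be a compact metrizable group with normalized Haar measure $\mu$. Let $X_1, X_2, \dots$ be i.i.d. $G$-valued random variables with distribution $\nu$ (a Borel probability measure on $G$), and set $S_k = X_1 X_2 \cdots X_k$. Assume that $\nu$ is central. The following are equivalent. (i) $\nu$ is adapted and strictly aperiodic, and $(\nu^{*k})_{\mathrm{abs}} \neq 0$ for some $k \ge 1$. (ii) For any bounded, Borel measurable function $f: G \to \mathbb{R}$ such that $\int_G f \, \mathrm{d}\mu = 0$ and $f$ is not $\mu$-a.e. zero, we have \[ \frac{\sum_{k=1}^N f(S_k)}{\sqrt{C(f,\nu) N}} \overset{d}{\longrightarrow} \mathcal{N}(0,1) \quad (N \to \infty) \] with some constant $C(f,\nu) > 0$ depending only on $f$ and $\nu$, where $\overset{d}{\longrightarrow}\mathcal{N}(0,1)$ denotes convergence in distribution to the standard normal distribution.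
   Context: A Borel probability measure $\nu$ on $G$ is called adapted if its support (the smallest closed set of full $\nu$-measure) is not contained in any proper closed subgroup of $G$; it is called strictly aperiodic if its support is not contained in a coset of any proper closed normal subgroup of $G$; it is called central if $\nu(y^{-1}By) = \nu(B)$ for all Borel sets $B \subseteq G$ and all $y \in G$. $\nu^{*k}$ denotes the $k$-fold convolution of $\nu$ (the distribution of $S_k$). Its Lebesgue decomposition with respect to $\mu$ is $\nu^{*k} = (\nu^{*k})_{\mathrm{abs}} + (\nu^{*k})_{\mathrm{sing}}$, where $(\nu^{*k})_{\mathrm{abs}}$ is absolutely continuous and $(\nu^{*k})_{\mathrm{sing}}$ is singular with respect to $\mu$. $\mu$ is normalized so that $\mu(G)=1$. *)

(* Defs.v *)
From HB Require Import structures.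
From mathcomp Require Import all_boot all_order all_algebra finmap.
From mathcomp Require Import all_classical all_reals all_analysis.

Set Implicit Arguments.
Unset Strict Implicit.
Unset Printing Implicit Defensive.

Import Order.TTheory GRing.Theory Num.Theory.
Import numFieldNormedType.Exports.

Local Open Scope classical_set_scope.
Local Open Scope ring_scope.

(* Topological groups, written multiplicatively and not assumed commutative
   (the library only has the additive, commutative [topologicalZmodType]).
   [Pointed] is required by the measure theory; its point is arbitrary. *)
HB.structure Definition PreTopologicalGroup :=
  {G of Pointed G & Topological G & Group G}.

HB.mixin Record PreTopologicalGroup_isTopologicalGroup G
    of PreTopologicalGroup G := {
  mulg_continuous : continuous (fun x : G * G => (x.1 * x.2)%g) ;
  invg_continuous : continuous (fun x : G => (x^-1)%g)
}.

#[short(type="topologicalGroupType")]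
HB.structure Definition TopologicalGroup :=
  {G of PreTopologicalGroup_isTopologicalGroup G & PreTopologicalGroup G}.

Notation borel G := (g_sigma_algebraType (@open G)).

Definition metrizable (R : realType) (T : topologicalType) :=
  exists (M : metricType R) (h : T -> M) (h' : M -> T),
    [/\ cancel h h', cancel h' h, continuous h & continuous h'].

Definition closed_subgroup (G : topologicalGroupType) (H : set G) :=
  closed H /\ group_closed [in H].

Definition proper_closed_subgroup (G : topologicalGroupType) (H : set G) :=
  closed_subgroup H /\ H != [set: G].

Definition normal_set (G : groupType) (H : set G) :=
  forall x y, H x -> H (x ^ y)%g.

Definition lcoset_set (G : groupType) (x : G) (H : set G) : set G :=
  [set (x * h)%g | h in H].

Section borel_probabilities.
Context (R : realType) (G : topologicalGroupType).
Implicit Types (mu nu : probability (borel G) R).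
Local Open Scope ereal_scope.

(* On a compact group the left-invariant Borel probability measure is unique
   (and also right-invariant). *)
Definition normalized_haar mu :=
  forall (x : G) (A : set (borel G)), measurable A ->
    mu [set (x * y)%g | y in A] = mu A.

(* If G is second countable, this intersection has itself full measure, hence
   it is the smallest closed set of full measure. *)
Definition measure_support nu : set G :=
  \bigcap_(C in [set C : set G | closed C /\ nu C = 1]) C.

Definition adapted nu :=
  forall H : set G, proper_closed_subgroup H -> ~ (measure_support nu `<=` H).

Definition strictly_aperiodic nu :=
  forall H : set G, proper_closed_subgroup H -> normal_set H ->
    forall x : G, ~ (measure_support nu `<=` lcoset_set x H).

Definition central nu :=
  forall (y : G) (B : set (borel G)), measurable B ->
    nu [set (y^-1 * x * y)%g | x in B] = nu B.

(* (m1 * m2)(A) = int m2(x^-1 A) m1(dx) *)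
Definition convolution (m1 m2 : set (borel G) -> \bar R) (A : set (borel G)) :=
  \int[m1]_x m2 [set y | A (x * y)%g].

Fixpoint convolution_power nu (k : nat) : set (borel G) -> \bar R :=
  if k is k'.+1 then convolution nu (convolution_power nu k')
  else \d_(1%g : borel G).

End borel_probabilities.

Definition mutually_singular d (T : measurableType d) (R : realType)
    (m1 m2 : set T -> \bar R) :=
  exists2 N : set T, measurable N & m1 N = 0%E /\ m2 (~` N) = 0%E.

Definition lebesgue_decomposition d (T : measurableType d) (R : realType)
    (m mu : set T -> \bar R) (mabs msing : {measure set T -> \bar R}) :=
  [/\ forall A, measurable A -> m A = (mabs A + msing A)%E,
      mabs `<< mu & mutually_singular msing mu].

Definition independent_RVs d d' (Omega : measurableType d)
    (T : measurableType d') (R : realType) (P : probability Omega R)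
    (X : nat -> {RV P >-> T}) :=
  forall (J : {fset nat}) (B : nat -> set T),
    (forall i, i \in J -> measurable (B i)) ->
    P (\bigcap_(i in [set` J]) (X i @^-1` B i)) =
    (\prod_(i <- J) P (X i @^-1` B i))%E.

Definition iid d d' (Omega : measurableType d) (T : measurableType d')
    (R : realType) (P : probability Omega R) (X : nat -> {RV P >-> T})
    (nu : probability T R) :=
  independent_RVs X /\
  (forall i A, measurable A -> distribution P (X i) A = nu A).

(* The sequence is indexed from 0, so that S_k = X_0 X_1 ... X_(k-1). *)
Definition partial_product d (Omega : measurableType d)
    (G : topologicalGroupType) (R : realType) (P : probability Omega R)
    (X : nat -> {RV P >-> borel G}) (k : nat) (w : Omega) : G :=
  (\prod_(i < k) (X i w : G))%g.

(* Convergence of the distribution functions at every point of continuity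
   of the limit. *)
Definition cvg_in_distribution d (Omega : measurableType d) (R : realType)
    (P : probability Omega R) (Z : nat -> Omega -> R) (L : set R -> \bar R) :=
  forall t : R, {for t, continuous (fun s : R => L `]-oo, s]%classic)} ->
    P [set w | Z N w <= t] @[N --> \oo] --> L `]-oo, t]%classic.

(* Main.v *)
(* Let P be the averaging operator P f (x) = int f(xy) dnu(y).

   (i) => (ii). A nonzero absolutely continuous part of nu^k gives, after
   convolving nu^k with itself, a density bounded below on an open set U. By
   strict aperiodicity and centrality the quotients x y^-1 with x, y in the same
   power of the support of nu are dense in G, so by compactness a single power
   hits every translate of U with probability bounded below, and some nu^n
   dominates c mu with c > 0. Hence P^n contracts mean-zero functions
   uniformly, and f = g - P g has a bounded solution g. Then the sum of the
   f(S_k) is, up to a bounded term, a martingale with increments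
   g(S_(k+1)) - P g(S_k). Its conditional variances have mean C and themselves
   satisfy a Poisson equation, and Lindeberg's replacement argument against
   Gaussian smoothings of half-line indicators gives the limit.
   If C = 0, then, since P commutes with right translations by centrality, the
   integrated step variance also vanishes for every P^j g; it equals
   int (P^j g)^2 - int (P^(j+1) g)^2, so int g^2 = int (P^j g)^2 for all j,
   which tends to 0, and f = 0.

   (ii) => (i). If one of the conditions fails, then S_k lies almost surely in
   given cosets of a proper closed subgroup, or in a fixed null set for all
   k >= 1; either way some admissible f has f(S_k) almost surely deterministic,
   which is incompatible with a normal limit. *)
Require Import Defs.
From HB Require Import structures.
From mathcomp Require Import all_boot all_order all_algebra finmap.
From mathcomp Require Import all_classical all_reals all_analysis.
From mathcomp Require Import measurable_realfun ring lra.
Import Order.TTheory GRing.Theory Num.Theory.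
Import numFieldNormedType.Exports.
Set Implicit Arguments.
Unset Strict Implicit.
Unset Printing Implicit Defensive.
Local Open Scope classical_set_scope.
Local Open Scope ring_scope.

(** * Topology of compact metrizable groups *)

(** No conditional expectations are used: the chain enters only through the integrated one-step
    identity [mean_driven], applied to the pair formed by the walk and its martingale. The obstacle
    is that the conditional variance depends on the position of the walk. Comparing an increment
    with a Gaussian of constant variance C / (C N) leaves an error of order 1/N per step, too much
    for N steps. The second Poisson equation, with solution [w], repairs this: adding a small
    multiple of u_xx w to the test function turns the fluctuation into a telescoping term. C is the
    mean over mu of the conditional variance, so it is fixed before any probability space is chosen.
    Centrality acts twice: it makes the support invariant under conjugation, so that quotients of
    its powers form a normal subgroup, and it makes P commute with right translations. In the
    converse, a null subgroup H reduces to the case of a null set, since the union of the cosets x^k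
    H is null; on a null set f can be redefined at will. *)

Lemma compact_metrizable_second_countable (R : realType) (T : topologicalType) :
  compact [set: T] -> metrizable R T -> @second_countable T.
Proof.
move=> cT [M [h [h' [hK h'K ch ch']]]].
have [[x0]|T0] := pselect (exists x : T, True); last first.
  exists set0 => //; split => // x; by case: T0; exists x.
have cM : compact [set: M].
  rewrite (_ : [set: M] = h @` [set: T]); last first.
    by apply/seteqP; split => // y _; exists (h' y).
  by apply: continuous_compact => //; exact: continuous_subspaceT.
pose PM := isPointed.Build M (h x0).
pose M' : pseudoPMetricType R := HB.pack M PM.
have [B cB [oB bB]] := @compact_second_countable R M' cM.
exists ((fun U : set M => h @^-1` U) @` B).
  exact: sub_countable (card_image_le _ _) cB.
split=> [_ [U BU <-]|x V].
  by apply: open_comp => [? _|]; [exact: ch|exact: oB].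
rewrite nbhsE => -[W [oW Wx] WV].
have : nbhs (h x : M') (h' @^-1` W).
  apply: open_nbhs_nbhs; split; last by rewrite /= hK.
  by apply: open_comp => // ? _; exact: ch'.
move=> /(bB (h x)) [U [BU Ux] UW].
exists (h @^-1` U); first by split => //; exists U.
by move=> y /UW /=; rewrite hK => /WV.
Qed.

Lemma second_countable_seq (T : topologicalType) : @second_countable T ->
  exists e : nat -> set T, (forall n, open (e n)) /\
   (forall x V, nbhs x V -> exists2 n, e n x & e n `<=` V).
Proof.
move=> [B cB [oB bB]].
have /countable_injP [f injf] := cB.
(* By injectivity at most one [U] has [f U = n]; when none has, the union is empty, so every index
   gets an open set. *)
pose e n : set T := \bigcup_(U in [set U | B U /\ f U = n]) U.
exists e; split=> [n|x V /bB[U [BU Ux] UV]].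
  by apply: bigcup_open => U [BU _]; exact: oB.
exists (f U); first by exists U.
move=> y [U' [BU' fU']] U'y; apply: UV.
by rewrite -(injf U' U) ?inE.
Qed.

Section topological_group.
Context (G : topologicalGroupType).
Implicit Types (x y z : G) (U V : set G).

Lemma nbhs_mulg x y U : nbhs (x * y)%g U ->
  exists V W, [/\ open_nbhs x V, open_nbhs y W &
    forall v w, V v -> W w -> U (v * w)%g].
Proof.
move=> /(@mulg_continuous G (x, y)) [[A B] /= [nA nB] AB].
move: nA nB; rewrite !nbhsE => -[V oV VA] [W oW WB].
by exists V, W; split => // v w /VA Av /WB Bw; exact: (AB (v, w)).
Qed.

Lemma mulg_continuous2 (T : topologicalType) (f g : T -> G) :
  continuous f -> continuous g -> continuous (fun t => (f t * g t)%g).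
Proof.
move=> cf cg t.
have cp : {for t, continuous (fun t => (f t, g t))}.
  by apply: cvg_pair; [exact: cf|exact: cg].
exact: (continuous_comp cp (@mulg_continuous G (f t, g t))).
Qed.

Lemma mull_continuous x : continuous (fun y => (x * y)%g).
Proof. by apply: mulg_continuous2 => ? //; exact: cvg_cst. Qed.

Lemma mulr_continuous x : continuous (fun y => (y * x)%g).
Proof. by apply: mulg_continuous2 => ? //; exact: cvg_cst. Qed.

Lemma open_borel U : open U -> measurable (U : set (borel G)).
Proof. exact: sub_gen_smallest. Qed.

Lemma closed_borel U : closed U -> measurable (U : set (borel G)).
Proof.
by rewrite -[U]setCK => /closed_openC oU; apply: measurableC; apply: open_borel; rewrite setCK in oU.
Qed.

Lemma continuous_borel (f : G -> G) : continuous f ->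
  measurable_fun [set: borel G] (f : borel G -> borel G).
Proof.
move=> cf; apply: (@measurability _ _ _ (borel G) _ _ (@open G)) => // _ [U oU <-].
by rewrite setTI; apply: open_borel; apply: open_comp.
Qed.

Definition mulb (z : borel G * borel G) : borel G := ((z.1 : G) * (z.2 : G))%g.
Definition invb (x : borel G) : borel G := (x : G)^-1%g.

Lemma measurable_invb : measurable_fun setT invb.
Proof. by apply: continuous_borel; exact: invg_continuous. Qed.

(** Measurability here refers to the product of the Borel sigma-algebras, so openness of the
    preimage does not suffice: a countable base writes it as a countable union of open
    rectangles. *)
Lemma measurable_mulb : @second_countable G -> measurable_fun setT mulb.
Proof.
move=> /second_countable_seq[e [oe be]].
apply: (@measurability _ _ _ (borel G) _ _ (@open G)) => // _ [U oU <-].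
rewrite setTI (_ : mulb @^-1` U = \bigcup_n \bigcup_m
   (if pselect (forall v w, e n v -> e m w -> U (v * w)%g)
    then (e n : set (borel G)) `*` (e m : set (borel G)) else set0)).
  apply: bigcupT_measurable => n; apply: bigcupT_measurable => m.
  by case: pselect => ? /=; last by []; apply: measurableX; exact: open_borel.
apply/seteqP; split => [[x y]|[x y]] /=.
  move=> Uxy; have /nbhs_mulg[V [W [/open_nbhs_nbhs/be[n nx nV]
    /open_nbhs_nbhs/be[m my mW] VW]]] : nbhs (x * y : G)%g U.
    exact: open_nbhs_nbhs.
  exists n => //; exists m => //; case: pselect => [? /=|nh]; first by split.
  by case: nh => v w /nV Vv /mW Ww; exact: VW.
by move=> [n _ [m _]]; case: pselect => /= h; [move=> [/= nx my]; exact: h|].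
Qed.

End topological_group.

(** * Means of bounded measurable functions *)

Section bounded_measurable.
Context {R : realType}.

(** A class stable under algebra, composition, sections and partial integrals; against a probability
    all its members are integrable, so integrals can be handled as real numbers. *)
Definition bmf d (T : measurableType d) (h : T -> R) :=
  measurable_fun setT h /\ exists M, forall x, `|h x| <= M.

Section pointwise.
Context d (T : measurableType d).
Implicit Types h g : T -> R.

Lemma bmf_meas h : bmf h -> measurable_fun setT h. Proof. by case. Qed.

Lemma bmf_bound h : bmf h -> exists2 M, 0 < M & forall x, `|h x| <= M.
Proof.
move=> [_ [M hM]]; exists (`|M| + 1); first by rewrite ltr_pwDr.
by move=> x; rewrite (le_trans (hM x))// (le_trans (ler_norm M))// lerDl.
Qed.

Lemma bmf_cst (c : R) : bmf (fun _ : T => c).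
Proof. by split; [exact: measurable_cst|exists `|c|]. Qed.

Lemma bmfD h g : bmf h -> bmf g -> bmf (fun x => h x + g x).
Proof.
move=> [mh [M hM]] [mg [N gN]]; split; first exact: measurable_funD.
by exists (M + N) => x; rewrite (le_trans (ler_normD _ _))// lerD.
Qed.

Lemma bmfM h g : bmf h -> bmf g -> bmf (fun x => h x * g x).
Proof.
move=> [mh [M hM]] [mg [N gN]]; split; first exact: measurable_funM.
by exists (M * N) => x; rewrite normrM ler_pM.
Qed.

Lemma bmfZ c h : bmf h -> bmf (fun x => c * h x).
Proof. by apply: bmfM; exact: bmf_cst. Qed.

Lemma bmfN h : bmf h -> bmf (fun x => - h x).
Proof.
by move=> /(bmfZ (-1)); congr bmf; apply/funext => x; rewrite mulN1r.
Qed.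

Lemma bmfB h g : bmf h -> bmf g -> bmf (fun x => h x - g x).
Proof. by move=> bh bg; apply: bmfD => //; exact: bmfN. Qed.

Lemma bmfX n h : bmf h -> bmf (fun x => h x ^+ n).
Proof.
move=> bh; elim: n => [|n IH]; first exact: bmf_cst.
by move: (bmfM bh IH); congr bmf; apply/funext => x; rewrite exprS.
Qed.

Lemma bmf_norm h : bmf h -> bmf (fun x => `|h x|).
Proof.
move=> [mh [M hM]]; split; first exact: measurableT_comp.
by exists M => x; rewrite normr_id.
Qed.

Lemma bmf_sum n (h : nat -> T -> R) : (forall i, bmf (h i)) ->
  bmf (fun x => \sum_(i < n) h i x).
Proof.
move=> bh; elim: n => [|n IH].
  by move: (bmf_cst 0); congr bmf; apply/funext => x; rewrite big_ord0.
by move: (bmfD IH (bh n)); congr bmf; apply/funext => x; rewrite big_ord_recr.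
Qed.

Lemma bmf_indic (A : set T) : measurable A -> bmf (\1_A : T -> R).
Proof.
move=> mA; split; first exact/measurable_indicP.
by exists 1 => x; rewrite indicE; case: (_ \in _) => //=; rewrite ?normr1 ?normr0.
Qed.

End pointwise.

Lemma bmf_comp d d' (T : measurableType d) (T' : measurableType d')
    (h : T' -> R) (phi : T -> T') :
  bmf h -> measurable_fun setT phi -> bmf (fun x => h (phi x)).
Proof.
move=> [mh [M hM]] mphi; split; first exact: (measurableT_comp mh mphi).
by exists M.
Qed.

Lemma bmf_continuous_comp d (T : measurableType d) (k : R -> R) (h : T -> R) M :
  continuous k -> (forall x, `|k x| <= M) -> measurable_fun setT h ->
  bmf (fun x => k (h x)).
Proof.
move=> ck kM mh; split; last by exists M.
exact: (measurableT_comp (continuous_measurable_fun ck) mh).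
Qed.

Section mean.
Context d (T : measurableType d) (m : probability T R).
Implicit Types h g : T -> R.

Lemma bmf_integrable h : bmf h -> m.-integrable setT (EFin \o h).
Proof.
move=> /[dup] /bmf_bound[M M0 hM] [mh _].
apply: measurable_bounded_integrable => //.
  by rewrite -ge0_fin_numE// fin_num_measure.
exists M; split; first exact: num_real.
by move=> y My x _; apply: (le_trans (hM x)); exact: ltW.
Qed.

Lemma bmf_EFin h : bmf h ->
  (\int[m]_x h x)%:E = (\int[m]_x (h x)%:E)%E.
Proof.
by move=> bh; rewrite /Rintegral fineK//; apply: integrable_fin_num => //; exact: bmf_integrable.
Qed.

Lemma mean_cst c : \int[m]_x c = c.
Proof. by rewrite Rintegral_cst// [X in fine X](probability_setT m) mulr1. Qed.

Lemma mean_ext h g : h =1 g -> \int[m]_x h x = \int[m]_x g x.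
Proof. by move=> hg; congr (Rintegral _ _ _); apply/funext. Qed.

Lemma mean_constant h c : (forall x, h x = c) -> \int[m]_x h x = c.
Proof. by move=> hc; rewrite (mean_ext hc) mean_cst. Qed.

Lemma meanD h g : bmf h -> bmf g ->
  \int[m]_x (h x + g x) = \int[m]_x h x + \int[m]_x g x.
Proof. by move=> bh bg; rewrite RintegralD//; exact: bmf_integrable. Qed.

Lemma meanB h g : bmf h -> bmf g ->
  \int[m]_x (h x - g x) = \int[m]_x h x - \int[m]_x g x.
Proof. by move=> bh bg; rewrite RintegralB//; exact: bmf_integrable. Qed.

Lemma meanZ c h : bmf h -> \int[m]_x (c * h x) = c * \int[m]_x h x.
Proof. by move=> bh; rewrite RintegralZl//; exact: bmf_integrable. Qed.

Lemma mean_le h g : bmf h -> bmf g -> (forall x, h x <= g x) ->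
  \int[m]_x h x <= \int[m]_x g x.
Proof.
by move=> bh bg hg; apply: le_Rintegral => //; exact: bmf_integrable.
Qed.

Lemma mean_ge0 h : (forall x, 0 <= h x) -> 0 <= \int[m]_x h x.
Proof. by move=> h0; apply: Rintegral_ge0. Qed.

Lemma mean_norm h : bmf h -> `|\int[m]_x h x| <= \int[m]_x `|h x|.
Proof. by move=> bh; apply: le_normr_Rintegral => //; exact: bmf_integrable. Qed.

Lemma mean_bound h M : bmf h -> (forall x, `|h x| <= M) ->
  `|\int[m]_x h x| <= M.
Proof.
move=> bh hM; rewrite (le_trans (mean_norm bh))//.
rewrite -[leRHS](mean_cst M); apply: mean_le => //.
  exact: bmf_norm.
exact: bmf_cst.
Qed.

Lemma mean_indic (A : set T) : measurable A ->
  \int[m]_x \1_A x = fine (m A).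
Proof. by move=> mA; rewrite /Rintegral integral_indic// setIT. Qed.

Lemma mean_sqr_le h : bmf h ->
  (\int[m]_x h x) ^+ 2 <= \int[m]_x (h x ^+ 2).
Proof.
move=> bh; set e := \int[m]_x h x; rewrite -subr_ge0.
have -> : \int[m]_x (h x ^+ 2) - e ^+ 2 = \int[m]_x ((h x - e) ^+ 2).
  rewrite [RHS](@mean_ext _ (fun x => h x ^+ 2 + ((- 2 * e) * h x + e ^+ 2))).
    rewrite meanD; [|exact: bmfX|]; last first.
      by apply: bmfD; [exact: bmfZ|exact: bmf_cst].
    rewrite meanD; [|exact: bmfZ|exact: bmf_cst].
    by rewrite meanZ// mean_cst -/e; ring.
  by move=> x; ring.
by apply: mean_ge0 => x; exact: sqr_ge0.
Qed.

End mean.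

Lemma mean_transport d d' (T : measurableType d) (T' : measurableType d')
    (m : probability T R) (m' : probability T' R) (phi : T -> T') (h : T' -> R) :
  measurable_fun setT phi ->
  (forall A, measurable A -> m' A = m (phi @^-1` A)) ->
  bmf h -> \int[m]_x h (phi x) = \int[m']_y h y.
Proof.
move=> mphi mm' bh; rewrite /Rintegral; congr fine.
transitivity (\int[pushforward m phi]_y (h y)%:E)%E.
  rewrite integral_pushforward//.
    by apply/measurable_EFinP; exact: bmf_meas bh.
  exact: (bmf_integrable m (bmf_comp bh mphi)).
by apply: eq_measure_integral => A mA _ /=; rewrite mm'.
Qed.

Section fubini.
Context d1 d2 (T1 : measurableType d1) (T2 : measurableType d2).
Variable m2 : probability T2 R.

Lemma bmf_sectionr (h : T1 * T2 -> R) x : bmf h -> bmf (fun y => h (x, y)).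
Proof. by move=> bh; apply: (bmf_comp bh); exact: measurable_fun_pair. Qed.

Lemma bmf_sectionl (h : T1 * T2 -> R) y : bmf h -> bmf (fun x => h (x, y)).
Proof. by move=> bh; apply: (bmf_comp bh); exact: measurable_fun_pair. Qed.

Lemma bmf_mean (h : T1 * T2 -> R) : bmf h ->
  bmf (fun x => \int[m2]_y h (x, y)).
Proof.
move=> bh; have [M M0 hM] := bmf_bound bh; split; last first.
  by exists M => x; apply: mean_bound => //; exact: bmf_sectionr.
(* Any first factor would do: the section integral depends on [m2] only, and the Dirac mass merely
   allows Fubini's theorem to be quoted. *)
pose m1 : probability T1 R := \d_(point : T1).
apply/measurable_EFinP.
have := measurable_fubini_F (bmf_integrable (m1 \x m2)%E bh).
congr measurable_fun; apply/funext => x /=.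
by rewrite /fubini_F /= bmf_EFin//; exact: bmf_sectionr.
Qed.

Variable m1 : probability T1 R.

Lemma mean_prod (h : T1 * T2 -> R) : bmf h ->
  \int[(m1 \x m2)%E]_z h z = \int[m1]_x \int[m2]_y h (x, y).
Proof.
move=> bh; rewrite /Rintegral -integral12_prod_meas1; last exact: bmf_integrable.
congr fine; apply: eq_integral => x _; rewrite /fubini_F /=.
by rewrite [RHS]bmf_EFin//; exact: bmf_sectionr.
Qed.

End fubini.

Lemma mean_swap d1 d2 (T1 : measurableType d1) (T2 : measurableType d2)
    (m1 : probability T1 R) (m2 : probability T2 R) (h : T1 * T2 -> R) : bmf h ->
  \int[m1]_x \int[m2]_y h (x, y) = \int[m2]_y \int[m1]_x h (x, y).
Proof.
move=> bh; rewrite -mean_prod// /Rintegral -integral21_prod_meas1; last exact: bmf_integrable.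
congr fine; apply: eq_integral => x _; rewrite /fubini_G /=.
by rewrite [RHS]bmf_EFin//; exact: bmf_sectionl.
Qed.

End bounded_measurable.

(** * Haar measure and convolution powers *)

Section group_mean.
Context {R : realType} {G : topologicalGroupType}.
Hypothesis sc : @second_countable G.
Implicit Types (m : probability (borel G) R) (h : borel G -> R).
Local Notation "x ** y" := ((x : G) * (y : G))%g (at level 40).
Local Notation "x ^-" := ((x : G)^-1)%g (at level 2).

Lemma measurable_mull (x : G) :
  measurable_fun setT ((fun y => x ** y) : borel G -> borel G).
Proof. by apply: continuous_borel; exact: mull_continuous. Qed.

Lemma measurable_mulr (x : G) :
  measurable_fun setT ((fun y => y ** x) : borel G -> borel G).
Proof. by apply: continuous_borel; exact: mulr_continuous. Qed.

Lemma bmf_mull h (x : G) : bmf h -> bmf ((fun y => h (x ** y)) : borel G -> R).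
Proof. by move=> bh; apply: (bmf_comp bh (measurable_mull x)). Qed.

Lemma bmf_mulr h (x : G) : bmf h -> bmf ((fun y => h (y ** x)) : borel G -> R).
Proof. by move=> bh; apply: (bmf_comp bh (measurable_mulr x)). Qed.

Lemma bmf_inv h : bmf h -> bmf ((fun y => h (y ^-)) : borel G -> R).
Proof. by move=> bh; apply: (bmf_comp bh (@measurable_invb G)). Qed.

Lemma measurable_mul_fun d (T : measurableType d) (f g : T -> borel G) :
  measurable_fun setT f -> measurable_fun setT g ->
  measurable_fun setT ((fun t => f t ** g t) : T -> borel G).
Proof.
move=> mf mg.
exact: (measurableT_comp (measurable_mulb sc) (measurable_fun_pair mf mg)).
Qed.

Lemma measurable_inv_fun d (T : measurableType d) (f : T -> borel G) :
  measurable_fun setT f ->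
  measurable_fun setT ((fun t => (f t) ^-) : T -> borel G).
Proof. by move=> mf; exact: (measurableT_comp (@measurable_invb G) mf). Qed.

Section haar.
Variable mu : probability (borel G) R.
Hypothesis haar : normalized_haar mu.

Lemma haar_preimage (x : G) (A : set (borel G)) : measurable A ->
  mu [set y | A (x ** y)] = mu A.
Proof.
move=> mA; rewrite -(haar x^-1%g mA); congr (mu _).
apply/seteqP; split => y /=.
  by move=> Axy; exists (x ** y) => //; rewrite mulKg.
by move=> [z Az <-]; rewrite mulVKg.
Qed.

Lemma haar_mull h (x : G) : bmf h -> \int[mu]_y h (x ** y) = \int[mu]_y h y.
Proof.
apply: mean_transport; first exact: measurable_mull.
by move=> A mA; rewrite -(haar_preimage x mA).
Qed.

(** Integrate h(x^-1 y) in both orders. Left invariance in y gives the mean of h; left invariance in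
    x, by the factor y^-1, gives the mean of h(x^-1). Right invariance then follows by inverting,
    translating on the left and inverting back. *)
Lemma haar_inv h : bmf h -> \int[mu]_y h (y ^-) = \int[mu]_y h y.
Proof.
move=> bh; transitivity (\int[mu]_x \int[mu]_y h (x ^- ** y)); last first.
  apply: mean_constant => x.
  by rewrite haar_mull.
rewrite (mean_swap _ _ (h := fun z : (borel G * borel G)%type => h (z.1 ^- ** z.2))); last first.
  apply: (bmf_comp bh); apply: measurable_mul_fun => //.
  exact: measurable_inv_fun.
symmetry; apply: mean_constant => y /=.
rewrite -(haar_mull y^-1%g (bmf_inv bh)).
by apply: mean_ext => x; rewrite invgM invgK.
Qed.

Lemma haar_mulr h (x : G) : bmf h -> \int[mu]_y h (y ** x) = \int[mu]_y h y.
Proof.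
move=> bh; rewrite -haar_inv; last exact: bmf_mulr.
rewrite -(haar_inv bh) -(haar_mull x^-1%g (bmf_inv bh)).
by apply: mean_ext => y; rewrite invgM invgK.
Qed.

End haar.

Lemma central_conj nu h (y : G) : central nu -> bmf h ->
  \int[nu]_x h (y ^- ** x ** y) = \int[nu]_x h x.
Proof.
move=> cnu; apply: (mean_transport (phi := fun x : borel G => (y ^- ** x ** y) : borel G)).
  by apply: measurable_mul_fun => //; apply: measurable_mul_fun.
move=> A mA; rewrite -(cnu y^-1%g A mA); congr (nu _).
apply/seteqP; split => x /=.
  by move=> [z Az <-]; rewrite invgK !mulgA mulVg mul1g mulgVK.
by move=> Ax; exists (y ^- ** x ** y) => //; rewrite invgK !mulgA mulgV mul1g mulgK.
Qed.

(** Conjugation by y preserves [nu], and y (y^-1 x y) = x y. This is the form in which centrality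
    enters the variance argument. *)
Lemma central_comm nu h (y : G) : central nu -> bmf h ->
  \int[nu]_x h (y ** x) = \int[nu]_x h (x ** y).
Proof.
move=> cnu bh; rewrite -(central_conj (h := fun x => h (y ** x)) y cnu).
  by apply: mean_ext => x; rewrite !mulgA mulgV mul1g.
exact: bmf_mull.
Qed.

Definition mul_mfun : {mfun (borel G * borel G)%type >-> borel G} :=
  HB.pack (@mulb G) (isMeasurableFun.Build _ _ _ _ (@mulb G) (measurable_mulb sc)).

(** Agrees with [convolution] on measurable sets, but is a probability by construction, being an
    image of the product measure. *)
Definition convp (m1 m2 : probability (borel G) R) : probability (borel G) R :=
  distribution (m1 \x m2)%E mul_mfun.

Lemma convpE m1 m2 A : measurable A -> convp m1 m2 A = convolution m1 m2 A.
Proof.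
move=> mA; rewrite /convolution /convp /distribution /pushforward /=.
apply: eq_integral => x _; congr (m2 _).
by apply/seteqP; split => y /=; rewrite /xsection /= inE.
Qed.

Lemma mean_convp m1 m2 h : bmf h ->
  \int[convp m1 m2]_z h z = \int[m1]_x \int[m2]_y h (x ** y).
Proof.
move=> bh; rewrite -(mean_prod _ _ (h := fun z : (borel G * borel G)%type => h (mulb z))); last first.
  by apply: (bmf_comp bh); exact: measurable_mulb.
by symmetry; apply: mean_transport => //; exact: measurable_mulb.
Qed.

Fixpoint cpow (nu : probability (borel G) R) k : probability (borel G) R :=
  if k is k'.+1 then convp nu (cpow nu k') else \d_(1%g : borel G).

Lemma cpowE nu k A : measurable A -> cpow nu k A = convolution_power nu k A.
Proof.
elim: k A => // k IH A mA.
transitivity (convolution nu (cpow nu k) A); first exact: convpE.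
apply: eq_integral => x _; apply: IH.
by rewrite -[X in measurable X]setTI; exact: measurable_mull.
Qed.

(** For m = [nu] this is the averaging operator P. Convolution of measures becomes composition of
    operators, so that P^k is [opc] of the k-th convolution power. *)
Definition opc m h : borel G -> R := fun x => \int[m]_y h (x ** y).

Lemma bmf_opc m h : bmf h -> bmf (opc m h).
Proof.
move=> bh; apply: (bmf_mean m (h := fun z : (borel G * borel G)%type => h (mulb z))).
by apply: (bmf_comp bh); exact: measurable_mulb.
Qed.

Lemma opc_bound m h M : bmf h -> (forall x, `|h x| <= M) ->
  forall x, `|opc m h x| <= M.
Proof. by move=> bh hM x; apply: mean_bound => //; exact: bmf_mull. Qed.

Lemma opcD m h g : bmf h -> bmf g ->
  opc m (fun x => h x + g x) = fun x => opc m h x + opc m g x.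
Proof.
move=> bh bg; apply/funext => x.
by rewrite /opc meanD//; exact: bmf_mull.
Qed.

Lemma opcB m h g : bmf h -> bmf g ->
  opc m (fun x => h x - g x) = fun x => opc m h x - opc m g x.
Proof.
move=> bh bg; apply/funext => x.
by rewrite /opc meanB//; exact: bmf_mull.
Qed.

Lemma opc_cst m c : opc m (fun=> c) = fun=> c.
Proof. by apply/funext => x; rewrite /opc mean_cst. Qed.

Lemma opc_convp m1 m2 h : bmf h -> opc (convp m1 m2) h = opc m1 (opc m2 h).
Proof.
move=> bh; apply/funext => x; rewrite /opc mean_convp; last exact: bmf_mull.
by apply: mean_ext => y; apply: mean_ext => z; rewrite mulgA.
Qed.

Lemma bmf_iter_opc m h k : bmf h -> bmf (iter k (opc m) h).
Proof. by move=> bh; elim: k => //= k IH; exact: bmf_opc. Qed.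

Lemma opc_cpow nu k h : bmf h -> opc (cpow nu k) h = iter k (opc nu) h.
Proof.
move=> bh; elim: k => [|k IH]; last by rewrite /= opc_convp// IH.
apply/funext => x; rewrite /opc /= /Rintegral integral_dirac//.
  by rewrite diracT mul1e /= mulg1.
by apply/measurable_EFinP; apply: bmf_meas; exact: bmf_mull.
Qed.

Lemma mean_opc mu nu h : normalized_haar mu -> bmf h ->
  \int[mu]_x opc nu h x = \int[mu]_x h x.
Proof.
move=> haar bh; rewrite /opc (mean_swap _ _ (h := fun z : (borel G * borel G)%type => h (mulb z))).
  apply: mean_constant => y.
  by rewrite -(haar_mulr haar y bh).
by apply: (bmf_comp bh); exact: measurable_mulb.
Qed.

End group_mean.

(** * Chains driven by an i.i.d. sequence *)

Lemma eq_rectangles_eq_measure d1 d2 (T1 : measurableType d1) (T2 : measurableType d2)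
    (R : realType) (m1 m2 : {measure set (T1 * T2) -> \bar R}) :
  (m1 setT < +oo)%E ->
  (forall A B, measurable A -> measurable B -> m1 (A `*` B) = m2 (A `*` B)) ->
  forall D, measurable D -> m1 D = m2 D.
Proof.
move=> m1oo m12 D mD.
pose C : set (set (T1 * T2)) := [set A `*` B | A in measurable & B in measurable].
apply: (measure_unique C (fun=> setT)) => //.
- exact: measurable_prod_measurableType.
- move=> _ _ [A mA [B mB <-]] [A' mA' [B' mB' <-]]; rewrite -setXI.
  by exists (A `&` A'); [exact: measurableI|exists (B `&` B') => //; exact: measurableI].
- by move=> _; exists setT => //; exists setT => //; rewrite setXTT.
- by rewrite bigcup_const//; exists 0%N.
- by move=> _ [A mA [B mB <-]]; exact: m12.
Qed.

Section driven_process.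
Context {R : realType} d (Omega : measurableType d) (P : probability Omega R).
Context dT (T : measurableType dT) (Y : nat -> {RV P >-> T}) (nu : probability T R).
Context dS (S : measurableType dS) (Psi : S * T -> S) (v0 : S).
Hypothesis Y_iid : iid Y nu.
Hypothesis mPsi : measurable_fun setT Psi.

Fixpoint driven k (w : Omega) : S :=
  if k is k'.+1 then Psi (driven k' w, Y k' w) else v0.

Lemma measurable_driven k : measurable_fun setT (driven k).
Proof.
elim: k => [|k IH] /=; first exact: measurable_cst.
by apply: (measurableT_comp mPsi); exact: measurable_fun_pair.
Qed.

Let m_driven_pair k : measurable_fun setT (fun w => (driven k w, Y k w)).
Proof. by apply: measurable_fun_pair => //; exact: measurable_driven. Qed.

(** Independence of the present from all later inputs is proved by induction on k. The state k + 1
    is a function of (state k, [Y k]), and the induction hypothesis, applied to [J] with k added,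
    gives the independence of that pair from the inputs in [J] on rectangles. *)
Lemma driven_indep k (E : set S) (J : {fset nat}) (B : nat -> set T) :
  measurable E -> (forall i, i \in J -> measurable (B i)) ->
  (forall i, i \in J -> (k <= i)%N) ->
  P (driven k @^-1` E `&` \bigcap_(i in [set` J]) (Y i @^-1` B i)) =
  (P (driven k @^-1` E) * \prod_(i <- J) P (Y i @^-1` B i))%E.
Proof.
have [indY _] := Y_iid.
elim: k E J B => [|k IH] E J B mE mB kJ.
  rewrite -indY//; have [Ev|Ev] := pselect (E v0).
    rewrite (_ : driven 0 @^-1` E = setT); last by apply/seteqP; split.
    by rewrite setTI probability_setT mul1e.
  rewrite (_ : driven 0 @^-1` E = set0); last by apply/seteqP; split.
  by rewrite set0I measure0 mul0e.
pose AJ := \bigcap_(i in [set` J]) (Y i @^-1` B i).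
have mAJ : measurable AJ.
  apply: fin_bigcap_measurable => // i iJ.
  by rewrite -[X in measurable X]setTI; apply: measurable_funPT => //; exact: mB.
have P0 i : (0 <= P (Y i @^-1` B i))%E by exact: measure_ge0.
have prodE : (\prod_(i <- J) P (Y i @^-1` B i))%E = P AJ by rewrite indY.
have Pfin : P AJ \is a fin_num by exact: fin_num_measure.
pose c : {nonneg R} := NngNum (fine_ge0 (measure_ge0 P AJ)).
have cE : (c%:num%:E = P AJ)%E by rewrite /= fineK.
pose phi : {mfun Omega >-> (S * T)%type} :=
  HB.pack (fun w => (driven k w, Y k w)) (isMeasurableFun.Build _ _ _ _ _ (m_driven_pair k)).
pose m1_ : {measure set (S * T) -> \bar R} := pushforward (mrestr P mAJ) phi.
pose m2_ : {measure set (S * T) -> \bar R} := mscale c (pushforward P phi).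
pose m1 := m1_ (m_driven_pair k); pose m2 := m2_ (m_driven_pair k).
have m12 : forall D, measurable D -> m1 D = m2 D.
  apply: eq_rectangles_eq_measure.
    rewrite /m1 /= /pushforward /mrestr preimage_setT setTI.
    by rewrite -ge0_fin_numE.
  move=> A C mA mC.
  have kJ' : k \notin J by apply/negP => /kJ; rewrite ltnn.
  rewrite /m1 /m2 /= /pushforward /mrestr /mscale cE.
  rewrite -[phi @^-1` (A `*` C)]/(driven k @^-1` A `&` Y k @^-1` C).
  rewrite -[X in _ = (_ * X)%E]/(P (driven k @^-1` A `&` Y k @^-1` C)).
  pose B' i := if i == k then C else B i.
  have BB' i : i \in J -> B' i = B i.
    by rewrite /B'; case: eqP => // -> kJ''; rewrite kJ'' in kJ'.
  have -> : (driven k @^-1` A `&` Y k @^-1` C) `&` AJ =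
     driven k @^-1` A `&` \bigcap_(i in [set` (k |` J)%fset]) (Y i @^-1` B' i).
    rewrite -setIA; congr (_ `&` _); rewrite bigcap_fsetU1; congr (_ `&` _).
      by rewrite /B' eqxx.
    by apply: eq_bigcapr => i /= iJ; rewrite BB'.
  have -> : driven k @^-1` A `&` Y k @^-1` C =
     driven k @^-1` A `&` \bigcap_(i in [set` [fset k]%fset]) (Y i @^-1` B' i).
    rewrite set_fset1 bigcap_set1 /B' eqxx; reflexivity.
  have mB' i : i \in (k |` J)%fset -> measurable (B' i).
    rewrite !inE => /orP[/eqP ->|iJ]; first by rewrite /B' eqxx.
    by rewrite BB'//; exact: mB.
  have mB1 i : i \in [fset k]%fset -> measurable (B' i).
    by rewrite inE => /eqP ->; rewrite /B' eqxx.
  have kJ1 i : i \in (k |` J)%fset -> (k <= i)%N.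
    by rewrite !inE => /orP[/eqP -> //|/kJ /ltnW].
  have k1 i : i \in [fset k]%fset -> (k <= i)%N by rewrite inE => /eqP ->.
  rewrite (IH _ _ _ mA mB' kJ1) (IH _ _ _ mA mB1 k1).
  rewrite big_fsetU1//= big_seq_fset1 muleA [RHS]muleC; congr (_ * _)%E.
  by rewrite -prodE; apply: eq_big_seq => i iJ; rewrite BB'.
have mPE : measurable (Psi @^-1` E).
  by rewrite -[X in measurable X]setTI; exact: mPsi.
have := m12 _ mPE.
rewrite /m1 /m2 /= /pushforward /mrestr /mscale cE -prodE muleC.
exact.
Qed.

(** The Markov property in integrated form: since state k and input [Y k] are independent, their
    joint law is a product and Fubini's theorem applies. *)
Lemma mean_driven k (H : S -> R) : bmf H ->
  \int[P]_w H (driven k.+1 w) =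
  \int[P]_w \int[nu]_y H (Psi (driven k w, y)).
Proof.
move=> bH.
pose V : {mfun Omega >-> S} :=
  HB.pack (driven k) (isMeasurableFun.Build _ _ _ _ _ (@measurable_driven k)).
pose phi : {mfun Omega >-> (S * T)%type} :=
  HB.pack (fun w => (driven k w, Y k w)) (isMeasurableFun.Build _ _ _ _ _ (m_driven_pair k)).
pose law : probability S R := distribution P V.
have lawE A : measurable A -> (law \x nu)%E A = distribution P phi A.
  apply: product_measure_unique => E B mE mB.
  have := @driven_indep k E [fset k]%fset (fun=> B) mE.
  rewrite set_fset1 bigcap_set1 big_seq_fset1 => dE.
  transitivity (P (driven k @^-1` E `&` Y k @^-1` B)); first by [].
  rewrite dE => [|i _ //|i]; last by rewrite inE => /eqP ->.
  by congr (_ * _)%E; exact: (Y_iid.2 k).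
have bHP : bmf (fun z => H (Psi z)) by exact: (bmf_comp bH).
transitivity (\int[(law \x nu)%E]_z H (Psi z)).
  by rewrite (mean_transport (m' := (law \x nu)%E) (phi := phi) _ _ bHP).
rewrite mean_prod// (mean_transport (m' := law) (phi := driven k) (h := fun v => \int[nu]_y H (Psi (v, y))))//.
  exact: measurable_driven.
exact: (bmf_mean nu (h := fun z => H (Psi z))).
Qed.

End driven_process.

(** * The central limit theorem for chains with a Poisson equation *)

Section taylor.
Context {R : realType}.
Implicit Types (f : R -> R) (x y z : R).

Definition between x y z := (Num.min x y <= z <= Num.max x y).

Lemma between_dist x y z : between x y z -> `|z - x| <= `|y - x|.
Proof.
rewrite /between; case: (leP x y) => xy /andP[xz zy].
  by rewrite !ger0_norm ?subr_ge0// lerB.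
by rewrite !ler0_norm ?subr_le0// ?(ltW xy)// lerN2 lerB.
Qed.

Lemma between_trans x y z t : between x y z -> between x z t -> between x y t.
Proof.
rewrite /between; case: (leP x y) => xy; case: (leP x z) => xz /andP[h1 h2] /andP[h3 h4]; apply/andP; split; lra.
Qed.

Lemma lipschitz_between f df x y A :
  (forall z, between x y z -> is_derive z 1 f (df z)) ->
  (forall z, between x y z -> `|df z| <= A) -> `|f y - f x| <= A * `|y - x|.
Proof.
wlog xy : x y / x <= y => [wl dfz fA|].
  have [xy|/ltW yx] := leP x y; first exact: wl.
  rewrite distrC (distrC y); apply: wl => // z; rewrite /between minC maxC => ?.
    exact: dfz.
  exact: fA.
rewrite /between; move: xy; rewrite le_eqVlt => /predU1P[-> _ _|xy].
  by rewrite !subrr normr0 mulr0.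
rewrite (min_idPl (ltW xy)) (max_idPr (ltW xy)) => dfz fA.
have [z|z|z zxy ->] := @MVT _ f df x y xy.
- by rewrite in_itv/= => /andP[xz zy]; apply: dfz; rewrite !ltW.
- by apply: derivable_within_continuous => t; rewrite in_itv/= => /dfz [].
- rewrite normrM ler_wpM2r// fA//.
  by move: zxy; rewrite in_itv/= => /andP[xz zy]; rewrite !ltW.
Qed.

(** The auxiliary function [g] has derivative f1 z - f1 x, of size at most L |y - x| between x and
    y, so the mean value bound applies. [taylor_le2] repeats this one order higher, where the
    derivative of the auxiliary function is bounded by the present lemma. *)
Lemma taylor_le1 f f1 x y L :
  (forall z, between x y z -> is_derive z 1 f (f1 z)) ->
  (forall z, between x y z -> `|f1 z - f1 x| <= L * `|z - x|) -> 0 <= L ->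
  `|f y - f x - f1 x * (y - x)| <= L * `|y - x| ^+ 2.
Proof.
move=> df f1L L0; pose g z := f z - f1 x * (z - x).
have -> : f y - f x - f1 x * (y - x) = g y - g x by rewrite /g; ring.
rewrite expr2 mulrA; apply: (@lipschitz_between g (fun z => f1 z - f1 x)) => z xyz.
  have dfz := df z xyz; apply: is_derive_eq.
  by rewrite /GRing.scale /=; ring.
rewrite (le_trans (f1L z xyz))// ler_wpM2l//; exact: between_dist.
Qed.

Lemma taylor_le2 f f1 f2 x y K :
  (forall z, between x y z -> is_derive z 1 f (f1 z)) ->
  (forall z, between x y z -> is_derive z 1 f1 (f2 z)) ->
  (forall z, between x y z -> `|f2 z - f2 x| <= K * `|z - x|) -> 0 <= K ->
  `|f y - f x - f1 x * (y - x) - f2 x / 2 * (y - x) ^+ 2| <= K * `|y - x| ^+ 3.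
Proof.
move=> df df1 f2K K0.
pose g z := f z - f1 x * (z - x) - f2 x / 2 * (z - x) ^+ 2.
have -> : f y - f x - f1 x * (y - x) - f2 x / 2 * (y - x) ^+ 2 = g y - g x.
  by rewrite /g; ring.
rewrite exprSr mulrA.
apply: (@lipschitz_between g (fun z => f1 z - f1 x - f2 x * (z - x))) => z xyz.
  have dfz := df z xyz; apply: is_derive_eq.
  by rewrite /GRing.scale /=; field.
apply: (@le_trans _ _ (K * `|z - x| ^+ 2)).
  apply: taylor_le1 => // t /(between_trans xyz); first exact: df1.
  exact: f2K.
rewrite ler_wpM2l// lerXn2r ?nnegrE//; exact: between_dist.
Qed.

End taylor.

Section gaussian.
Context {R : realType}.
Implicit Types (x y z : R).

Definition gpdf z : R := normal_pdf 0 1 z.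

Lemma gpdfE z : gpdf z = normal_peak 1 * expR (- (z ^+ 2) / 2).
Proof.
by rewrite /gpdf normal_pdfE ?oner_neq0// /normal_fun subr0 expr1n.
Qed.

Lemma gpdf_gt0 z : 0 < gpdf z.
Proof. by rewrite gpdfE mulr_gt0 ?expR_gt0// normal_peak_gt0// oner_neq0. Qed.

Lemma is_derive_gpdf z : is_derive z 1 gpdf (- z * gpdf z).
Proof.
have -> : gpdf = fun z => normal_peak 1 * expR (- (z ^+ 2) / 2).
  by apply/funext => ?; rewrite gpdfE.
apply: is_derive_eq.
by rewrite /GRing.scale /=; field.
Qed.

(** The weight comes from exp(z^2 / 2) = exp(z^2 / 4)^2 >= (1 + z^2 / 4)^2, so a function growing no
    faster than it stays bounded against the Gaussian density. *)
Lemma gpdf_bound (h z A : R) : 0 <= A -> `|h| <= A * (1 + z ^+ 2 / 4) ^+ 2 ->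
  `|h * gpdf z| <= A * normal_peak 1.
Proof.
move=> A0 hA; rewrite normrM (gtr0_norm (gpdf_gt0 z)) gpdfE mulrCA.
rewrite [leRHS]mulrC ler_wpM2l ?normal_peak_ge0//.
have z0 : 0 <= z ^+ 2 by exact: sqr_ge0.
have eE : expR (- (z ^+ 2) / 2) = (expR (z ^+ 2 / 4) ^+ 2)^-1.
  by rewrite -expRM_natl -expRN; congr expR; field.
rewrite eE ler_pdivrMr ?exprn_gt0 ?expR_gt0//.
rewrite (le_trans hA)// ler_wpM2l// lerXn2r ?nnegrE ?expR_ge0//; last exact: expR_ge1Dx.
by rewrite addr_ge0// divr_ge0.
Qed.

Definition Phi z : R := \int[lebesgue_measure]_(x in `]-oo, z]) gpdf x.

Lemma integrable_gpdf (A : set R) : measurable A ->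
  lebesgue_measure.-integrable A (EFin \o gpdf).
Proof.
move=> mA; apply: (integrableS _ _ _ (integrable_normal_pdf 0 1)) => //.
Qed.

Lemma PhiE z : (Phi z)%:E = normal_prob 0 1 `]-oo, z].
Proof.
rewrite /Phi /Rintegral fineK//; apply: integrable_fin_num => //.
exact: integrable_gpdf.
Qed.

Lemma is_derive_Phi z : is_derive z 1 Phi (gpdf z).
Proof.
have zz : z < z + 1 by rewrite ltrDl.
have [|||d dE] := @continuous_FTC1 R gpdf -oo%O z (z + 1) zz.
- exact: integrable_gpdf.
- by rewrite ltNyr.
- exact: (@continuous_normal_pdf R 0 1 (oner_neq0 _) z).
by apply: DeriveDef; [exact: d|rewrite -derive1E].
Qed.

Lemma Phi_ge0 z : 0 <= Phi z.
Proof. by apply: Rintegral_ge0 => x _; exact: normal_pdf_ge0. Qed.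

Lemma Phi_le1 z : Phi z <= 1.
Proof. by rewrite -lee_fin PhiE; exact: (@probability_le1 _ _ _ (normal_prob 0 1)). Qed.

Lemma Phi_lt x y : x < y -> Phi x < Phi y.
Proof.
move=> xy; rewrite -subr_gt0.
have [z _|z|z _ ->] := @MVT _ Phi gpdf x y xy.
- exact: is_derive_Phi.
- by apply: derivable_within_continuous => t _; have [] := is_derive_Phi t.
- by rewrite mulr_gt0 ?gpdf_gt0// subr_gt0.
Qed.

Lemma Phi_le x y : x <= y -> Phi x <= Phi y.
Proof. by rewrite le_eqVlt => /predU1P[->//|/Phi_lt/ltW]. Qed.

Lemma Phi_gt0 z : 0 < Phi z.
Proof. by rewrite (le_lt_trans (Phi_ge0 (z - 1)))// Phi_lt// gtrBl. Qed.

Lemma Phi_lt1 z : Phi z < 1.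
Proof. by rewrite (lt_le_trans _ (Phi_le1 (z + 1)))// Phi_lt// ltrDl. Qed.

Lemma Phi_continuous : continuous Phi.
Proof.
move=> z; apply: differentiable_continuous; apply/derivable1_diffP.
by have [] := is_derive_Phi z.
Qed.

Lemma Phi_cvgy : Phi z @[z --> +oo] --> (1 : R).
Proof.
pose idTR : measurableTypeR R -> R := idfun.
pose I : {mfun measurableTypeR R >-> R} :=
  HB.pack idTR (@isMeasurableFun.Build _ _ _ _ idTR (@measurable_id _ _ setT)).
have := @cvg_cdfy1 _ _ _ (normal_prob 0 1) I.
rewrite (_ : cdf _ = fun z => (Phi z)%:E); last first.
  by apply/funext => z; rewrite PhiE.
by move/fine_cvgP => [].
Qed.
End gaussian.

Lemma Phi_cvgNy (R : realType) : @Phi R z @[z --> -oo] --> (0 : R).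
Proof.
pose idTR : measurableTypeR R -> R := idfun.
pose I : {mfun measurableTypeR R >-> R} :=
  HB.pack idTR (@isMeasurableFun.Build _ _ _ _ idTR (@measurable_id _ _ setT)).
have := @cvg_cdfNy0 _ _ _ (normal_prob 0 1) I.
rewrite (_ : cdf _ = fun z => (Phi z)%:E); last first.
  by apply/funext => z; rewrite PhiE.
by move/fine_cvgP => [].
Qed.

Lemma is_derive1_compE {R : realType} (f g : R -> R) (x a b c : R) :
  is_derive x 1 g b -> is_derive (g x) 1 f a -> a * b = c ->
  is_derive x 1 (fun y => f (g y)) c.
Proof. by move=> dg df <-; exact: is_derive1_comp. Qed.

Definition heat_scale {R : realType} (sigma s : R) : R :=
  (Num.sqrt (sigma ^+ 2 + s))^-1.

(** One constant for all derivatives of the heat solution that occur. Each is a power r^j with j <=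
    4 times a polynomial times the density: 16 comes from the polynomials ([cubic_bounds]), and (1 +
    1/sigma)^4 dominates r^j because r <= 1/sigma. *)
Definition heat_const {R : realType} (sigma : R) : R :=
  16 * normal_peak 1 * (1 + sigma^-1) ^+ 4.

Section heat.
Context {R : realType}.
Variables (sigma t : R).
Hypothesis sigma_gt0 : 0 < sigma.
Implicit Types (x y z s : R).

Local Notation r := (heat_scale sigma).
Local Notation K := (heat_const sigma).

(* u(s, x) = P(x + sqrt(sigma^2 + s) Z <= t) with Z standard normal; it solves
   the heat equation u_s = u_xx / 2, and [heat1], [heat2] are u_x, u_xx. *)
Definition heat s x := Phi ((t - x) * r s).
Definition heat1 s x := - r s * gpdf ((t - x) * r s).
Definition heat2 s x := - ((t - x) * r s ^+ 3 * gpdf ((t - x) * r s)).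

Let s2_gt0 s : 0 <= s -> 0 < sigma ^+ 2 + s.
Proof. by move=> s0; rewrite ltr_wpDr// exprn_gt0. Qed.

Let r_gt0 s : 0 <= s -> 0 < r s.
Proof. by move=> s0; rewrite invr_gt0 sqrtr_gt0 s2_gt0. Qed.

Let r_le s : 0 <= s -> r s <= sigma^-1.
Proof.
move=> s0; rewrite lef_pV2 ?posrE ?sqrtr_gt0 ?s2_gt0//.
have sE : Num.sqrt (sigma ^+ 2) = sigma by rewrite sqrtr_sqr gtr0_norm.
by rewrite -[leLHS]sE ler_wsqrtr// lerDl.
Qed.

Let is_derive_r s : 0 <= s -> is_derive s 1 r (- (r s ^+ 3) / 2).
Proof.
move=> s0; have s2 := s2_gt0 s0.
have sn0 : Num.sqrt (sigma ^+ 2 + s) != 0 by rewrite gt_eqF// sqrtr_gt0.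
have d1 : is_derive s 1 (fun s => sigma ^+ 2 + s) 1.
  by apply: is_derive_eq; rewrite add0r mul1r.
have d2 := is_derive1_comp (is_derive1_sqrt s2) d1.
apply: (is_derive_eq (@is_deriveV _ (Num.sqrt \o +%R (sigma ^+ 2)) s _ 1 sn0 d2)).
by rewrite /heat_scale /GRing.scale /=; field.
Qed.

Let gpdf_scaled (a x : R) : is_derive x 1 (fun x => gpdf ((t - x) * a))
  ((t - x) * a ^+ 2 * gpdf ((t - x) * a)).
Proof.
have d1 : is_derive x 1 (fun x => (t - x) * a) (- a).
  by apply: is_derive_eq; rewrite /GRing.scale /=; ring.
apply: (is_derive1_compE d1 (is_derive_gpdf ((t - x) * a))).
by ring.
Qed.

Let is_derive_heat s x : is_derive x 1 (heat s) (heat1 s x).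
Proof.
have d1 : is_derive x 1 (fun x => (t - x) * r s) (- r s).
  by apply: is_derive_eq; rewrite /GRing.scale /=; ring.
apply: (is_derive1_compE d1 (is_derive_Phi ((t - x) * r s))).
by rewrite /heat1; ring.
Qed.

Let is_derive_heat1 s x : is_derive x 1 (heat1 s) (heat2 s x).
Proof.
have d1 := gpdf_scaled (r s) x.
by apply: is_derive_eq; rewrite /heat2 /GRing.scale /=; ring.
Qed.

Let heat3 s x := - (r s ^+ 3 *
  ((((t - x) * r s) ^+ 2 - 1) * gpdf ((t - x) * r s))).

Let is_derive_heat2 s x : is_derive x 1 (heat2 s) (heat3 s x).
Proof.
have d1 := gpdf_scaled (r s) x.
by apply: is_derive_eq; rewrite /heat3 /GRing.scale /=; ring.
Qed.

Let gpdf_time s x : 0 <= s -> is_derive s 1 (fun s => gpdf ((t - x) * r s))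
  ((t - x) ^+ 2 * r s ^+ 4 / 2 * gpdf ((t - x) * r s)).
Proof.
move=> s0; have dr := is_derive_r s0.
have d1 : is_derive s 1 (fun s => (t - x) * r s) ((t - x) * (- (r s ^+ 3) / 2)).
  by apply: is_derive_eq; rewrite /GRing.scale /=; ring.
apply: (is_derive1_compE d1 (is_derive_gpdf ((t - x) * r s))).
by field.
Qed.

Let heat_time_derive s x : 0 <= s ->
  is_derive s 1 (fun s => heat s x) (heat2 s x / 2).
Proof.
move=> s0; have dr := is_derive_r s0.
have d1 : is_derive s 1 (fun s => (t - x) * r s) ((t - x) * (- (r s ^+ 3) / 2)).
  by apply: is_derive_eq; rewrite /GRing.scale /=; ring.
apply: (is_derive1_compE d1 (is_derive_Phi ((t - x) * r s))).
by rewrite /heat2; field.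
Qed.

Let heat2t s x := - (r s ^+ 4 / 2 *
  ((((t - x) * r s) ^+ 3 - 3 * ((t - x) * r s)) * gpdf ((t - x) * r s))).

Let heat2_time_derive s x : 0 <= s ->
  is_derive s 1 (fun s => heat2 s x) (heat2t s x).
Proof.
move=> s0; have dr := is_derive_r s0; have dg := gpdf_time x s0.
apply: is_derive_eq.
by rewrite /heat2t /GRing.scale /=; field.
Qed.

Lemma heat_const_gt0 : 0 < K.
Proof.
have s0 : 0 < 1 + sigma^-1 by rewrite addr_gt0// invr_gt0.
by rewrite !mulr_gt0 ?exprn_gt0// normal_peak_gt0// oner_neq0.
Qed.

Let scaled_bound s j (h z : R) : 0 <= s -> (j <= 4)%N ->
  `|h| <= 16 * (1 + z ^+ 2 / 4) ^+ 2 -> `|r s ^+ j * (h * gpdf z)| <= K.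
Proof.
move=> s0 j4 hz; rewrite normrM mulrC /heat_const ler_pM//.
  exact: gpdf_bound.
have si : 0 <= sigma^-1 by rewrite invr_ge0 ltW.
rewrite ger0_norm ?exprn_ge0 ?(ltW (r_gt0 s0))//.
apply: (@le_trans _ _ ((1 + sigma^-1) ^+ j)).
  rewrite lerXn2r ?nnegrE ?(ltW (r_gt0 s0)) ?addr_ge0//.
  by rewrite (le_trans (r_le s0))// lerDr.
by rewrite ler_weXn2l// lerDl.
Qed.

(** These are the Hermite polynomials of degree at most 3, the factors in the derivatives of the
    density. With w = 1 + z^2 / 4 one has |z| <= w, from the squares of z/2 + 1 and z/2 - 1, and z^2
    = 4 w - 4; everything reduces to polynomials in w >= 1. *)
Let cubic_bounds z : let A := 16 * (1 + z ^+ 2 / 4) ^+ 2 in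
  [/\ `|(1 : R)| <= A, `|z| <= A, `|z ^+ 2 - 1| <= A & `|z ^+ 3 - 3 * z| <= A].
Proof.
move=> /=; set w := 1 + z ^+ 2 / 4.
have A1 : 1 <= w by rewrite lerDl divr_ge0// sqr_ge0.
have nz : `|z| <= w.
  rewrite /w.
  have := sqr_ge0 (z / 2 + 1); have := sqr_ge0 (z / 2 - 1).
  by rewrite ler_norml => h1 h2; apply/andP; split; nra.
have z2 : z ^+ 2 = 4 * w - 4 by rewrite /w; field.
have w2 : w <= w ^+ 2 by nra.
split.
- by rewrite normr1; nra.
- by rewrite (le_trans nz)//; nra.
- by rewrite z2 ler_norml; apply/andP; split; nra.
- have -> : z ^+ 3 - 3 * z = z * (4 * w - 7) by rewrite exprS z2; ring.
  rewrite normrM.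
  have -> : 16 * w ^+ 2 = w * (16 * w) by ring.
  by rewrite ler_pM// ler_norml; apply/andP; split; nra.
Qed.

Lemma heat1_bound s x : 0 <= s -> `|heat1 s x| <= K.
Proof.
move=> s0; rewrite /heat1 mulNr normrN -[gpdf _]mul1r -[r s in X in X <= _]expr1.
by apply: scaled_bound => //; have [] := cubic_bounds ((t - x) * r s).
Qed.

Lemma heat2_bound s x : 0 <= s -> `|heat2 s x| <= K.
Proof.
move=> s0; rewrite /heat2 normrN.
have -> : (t - x) * r s ^+ 3 * gpdf ((t - x) * r s) =
  r s ^+ 2 * (((t - x) * r s) * gpdf ((t - x) * r s)) by ring.
by apply: scaled_bound => //; have [] := cubic_bounds ((t - x) * r s).
Qed.

Let heat3_bound s x : 0 <= s -> `|heat3 s x| <= K.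
Proof.
move=> s0; rewrite /heat3 normrN.
by apply: scaled_bound => //; have [] := cubic_bounds ((t - x) * r s).
Qed.

Let heat2t_bound s x : 0 <= s -> `|heat2t s x| <= K.
Proof.
move=> s0; rewrite /heat2t normrN mulrAC -[_ / 2]/(_ * _) normrM.
rewrite -[leRHS]mulr1 ler_pM//.
  by apply: scaled_bound => //; have [] := cubic_bounds ((t - x) * r s).
by rewrite ger0_norm// invf_le1// ler1n.
Qed.

Lemma heat_lipschitz s x y : 0 <= s -> `|heat s y - heat s x| <= K * `|y - x|.
Proof.
move=> s0; apply: (@lipschitz_between _ (heat s) (heat1 s)) => z _.
  exact: is_derive_heat.
exact: heat1_bound.
Qed.

Lemma heat2_lipschitz s s' x y : 0 <= s -> 0 <= s' ->
  `|heat2 s' y - heat2 s x| <= K * (`|y - x| + `|s' - s|).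
Proof.
move=> s0 s'0.
have -> : heat2 s' y - heat2 s x =
  (heat2 s' y - heat2 s' x) + (heat2 s' x - heat2 s x) by ring.
rewrite (le_trans (ler_normD _ _))// mulrDr lerD//.
  apply: (@lipschitz_between _ (heat2 s') (heat3 s')) => z _.
    exact: is_derive_heat2.
  exact: heat3_bound.
have z0 z : between s s' z -> 0 <= z.
  by move=> /andP[+ _]; apply: le_trans; rewrite le_min s0.
apply: (@lipschitz_between _ (heat2 ^~ x) (heat2t ^~ x)) => z /z0 ?.
  exact: heat2_time_derive.
exact: heat2t_bound.
Qed.

Lemma heat_taylor s x y : 0 <= s ->
  `|heat s y - heat s x - heat1 s x * (y - x) - heat2 s x / 2 * (y - x) ^+ 2|
  <= K * `|y - x| ^+ 3.
Proof.
move=> s0; apply: (@taylor_le2 _ (heat s) (heat1 s) (heat2 s)) => [z _|z _|z _|].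
- exact: is_derive_heat.
- exact: is_derive_heat1.
- by rewrite (le_trans (heat2_lipschitz _ _ s0 s0))// subrr normr0 addr0.
- exact/ltW/heat_const_gt0.
Qed.

Lemma heat_time s s' x : 0 <= s -> 0 <= s' ->
  `|heat s' x - heat s x - heat2 s x / 2 * (s' - s)| <= K * `|s' - s| ^+ 2.
Proof.
move=> s0 s'0.
have z0 z : between s s' z -> 0 <= z.
  by move=> /andP[+ _]; apply: le_trans; rewrite le_min s0.
apply: (@taylor_le1 _ (heat ^~ x) (fun s => heat2 s x / 2)) => [z /z0 ?|z /z0 zp|].
- exact: heat_time_derive.
- rewrite -mulrBl normrM -[leRHS]mulr1 ler_pM//.
    by rewrite (le_trans (heat2_lipschitz _ _ s0 zp))// subrr normr0 add0r.
  by rewrite ger0_norm// invf_le1// ler1n.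
- exact/ltW/heat_const_gt0.
Qed.

Lemma heat_continuous s : continuous (heat s).
Proof.
move=> x; apply: differentiable_continuous; apply/derivable1_diffP.
by have [] := is_derive_heat s x.
Qed.

Lemma heat2_continuous s : continuous (heat2 s).
Proof.
move=> x; apply: differentiable_continuous; apply/derivable1_diffP.
by have [] := is_derive_heat2 s x.
Qed.

End heat.

(** * Lindeberg's replacement with a corrector *)

Section lindeberg.
Context {R : realType} dT (T : measurableType dT) (nu : probability T R).
Context dE (E : measurableType dE) (act : E * T -> E).
Hypothesis mact : measurable_fun setT act.
Variables (g w : E -> R) (C D W : R).
Hypotheses (bg : bmf g) (bw : bmf w) (C_gt0 : 0 < C).

Definition act_mean (h : E -> R) (x : E) := \int[nu]_y h (act (x, y)).

Definition martingale_diff (x : E) (y : T) := g (act (x, y)) - act_mean g x.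

Local Notation d := martingale_diff.

Hypotheses (dD : forall x y, `|d x y| <= D) (wW : forall x, `|w x| <= W).
Hypothesis poisson_w : forall x,
  \int[nu]_y (d x y ^+ 2) - C = w x - act_mean w x.

Let bmf_act (h : E -> R) x : bmf h -> bmf (fun y => h (act (x, y))).
Proof.
move=> bh; apply: (bmf_comp bh).
by apply: (measurableT_comp mact); exact: measurable_fun_pair.
Qed.

Let bmf_diff x : bmf (d x).
Proof. by apply: bmfB; [exact: bmf_act|exact: bmf_cst]. Qed.

Lemma mean_martingale_diff x : \int[nu]_y d x y = 0.
Proof.
rewrite /d meanB; [|exact: bmf_act|exact: bmf_cst].
by rewrite mean_cst subrr.
Qed.

Section step.
Variables (sigma t : R).
Hypothesis sigma_gt0 : 0 < sigma.
Local Notation K := (heat_const sigma).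
Local Notation u := (heat sigma t).
Local Notation u1 := (heat1 sigma t).
Local Notation u2 := (heat2 sigma t).

(* The corrector [w] absorbs the fluctuation of the conditional variance around
   its mean [C], so that one step of the chain, together with the decrease of
   [s] by [h = a^2 C], changes the expectation of [corrected_heat] by o(h). *)
Definition corrected_heat (a h s : R) (z : E * R) :=
  u s (a * z.2) + h / (2 * C) * u2 s (a * z.2) * w z.1.

Local Notation F := corrected_heat.

Lemma bmf_corrected_heat a h s : 0 <= s -> bmf (F a h s).
Proof.
move=> s0; have mz : measurable_fun setT (fun z : E * R => a * z.2).
  by apply: measurable_funM => //; exact: measurable_cst.
apply: bmfD; last apply: bmfM; last first.
- by apply: (bmf_comp bw).
- apply: bmfZ; apply: bmf_continuous_comp mz; first exact: heat2_continuous.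
  by move=> x; exact: heat2_bound.
- apply: (bmf_continuous_comp (M := 1)) mz; first exact: heat_continuous.
  by move=> x; rewrite ger0_norm ?Phi_ge0 ?Phi_le1.
Qed.

(** The three summands bound the spatial Taylor remainder, the time remainder, and the variation of
    u_xx in front of the corrector. With [a] of order h^(1/2) the total is O(h^(3/2)), hence
    O(N^(-1/2)) after N = 1/h steps. *)
Definition step_error (a h : R) :=
  K * (`|a| ^+ 3 * D ^+ 3) + K * h ^+ 2 +
  h / (2 * C) * (K * (`|a| * D) * W + K * h * W).

Lemma lindeberg_step a h s x m : 0 <= s -> 0 <= h -> a ^+ 2 * C = h ->
  `|\int[nu]_y F a h s (act (x, y), m + d x y) - F a h (s + h) (x, m)|
  <= step_error a h.
Proof.
move=> s0 h0 aC.
have K0 := heat_const_gt0 sigma_gt0.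
pose q := u2 s (a * m).
(* The main part of the increment of [F], with q = u_xx. Its mean vanishes: [d] has mean zero,
   [poisson_w] gives d^2 the mean C + w x - P w x, and a^2 C = h makes the C-terms and the w-terms
   cancel separately. *)
pose L y := a * u1 s (a * m) * d x y + a ^+ 2 * q / 2 * d x y ^+ 2 +
  (- (h * q / 2) + h / (2 * C) * q * (w (act (x, y)) - w x)).
have bL1 : bmf (fun y => a * u1 s (a * m) * d x y) by apply: bmfZ.
have bL2 : bmf (fun y => a ^+ 2 * q / 2 * d x y ^+ 2) by apply: bmfZ; exact: bmfX.
have bL4 : bmf (fun y => w (act (x, y)) - w x).
  by apply: bmfB; [exact: bmf_act|exact: bmf_cst].
have bL3 : bmf (fun y => - (h * q / 2) + h / (2 * C) * q * (w (act (x, y)) - w x)).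
  by apply: bmfD; [exact: bmf_cst|exact: bmfZ].
have bL : bmf L by apply: bmfD => //; exact: bmfD.
have bF : bmf (fun y => F a h s (act (x, y), m + d x y)).
  apply: (bmf_comp (bmf_corrected_heat a h s0)); apply: measurable_fun_pair.
    by apply: (measurableT_comp mact); exact: measurable_fun_pair.
  by apply: bmf_meas; apply: bmfD => //; exact: bmf_cst.
have intL : \int[nu]_y L y = 0.
  rewrite meanD//; last exact: bmfD.
  rewrite meanD// meanD//; [|exact: bmf_cst|exact: bmfZ].
  rewrite !meanZ//; last exact: bmfX.
  rewrite mean_martingale_diff mean_cst meanB//; [|exact: bmf_act|exact: bmf_cst].
  have -> : \int[nu]_y d x y ^+ 2 = w x - act_mean w x + C.
    by rewrite -poisson_w subrK.
  rewrite mean_cst -/(act_mean w x) -aC.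
  by field; rewrite gt_eqF.
have -> : \int[nu]_y F a h s (act (x, y), m + d x y) - F a h (s + h) (x, m) =
  \int[nu]_y (F a h s (act (x, y), m + d x y) - F a h (s + h) (x, m) - L y).
  rewrite meanB//; last by apply: bmfB => //; exact: bmf_cst.
  rewrite meanB//; last exact: bmf_cst.
  by rewrite intL mean_cst subr0.
apply: mean_bound => [|y].
  by apply: bmfB => //; apply: bmfB => //; exact: bmf_cst.
rewrite /F /L /= -/q; set e := d x y; set w' := w (act (x, y)).
have D0 : 0 <= D by rewrite (le_trans _ (dD x y)).
(* What remains after subtracting [L], grouped so that the parts are bounded by [heat_taylor],
   [heat_time] and [heat2_lipschitz]. The heat equation is what lets the same q serve in space and
   in time. *)
have eq1 : u s (a * (m + e)) + h / (2 * C) * u2 s (a * (m + e)) * w' -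
   (u (s + h) (a * m) + h / (2 * C) * u2 (s + h) (a * m) * w x) -
   (a * u1 s (a * m) * e + a ^+ 2 * q / 2 * e ^+ 2 +
    (- (h * q / 2) + h / (2 * C) * q * (w' - w x))) =
   (u s (a * (m + e)) - u s (a * m) - u1 s (a * m) * (a * (m + e) - a * m) -
     q / 2 * (a * (m + e) - a * m) ^+ 2) -
   (u (s + h) (a * m) - u s (a * m) - q / 2 * (s + h - s)) +
   h / (2 * C) * ((u2 s (a * (m + e)) - q) * w' - (u2 (s + h) (a * m) - q) * w x).
  by field; rewrite gt_eqF.
rewrite eq1 /step_error.
have ae : a * (m + e) - a * m = a * e by ring.
have aeD : `|a * e| <= `|a| * D by rewrite normrM ler_wpM2l //; exact: dD.
rewrite (le_trans (ler_normD _ _))// lerD//.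
  rewrite (le_trans (ler_normB _ _))// lerD//.
    rewrite (le_trans (heat_taylor _ sigma_gt0 _ _ s0))// ler_wpM2l ?(ltW K0)//.
    by rewrite ae -exprMn lerXn2r ?nnegrE ?mulr_ge0.
  have sh : 0 <= s + h by exact: addr_ge0.
  rewrite (le_trans (heat_time _ sigma_gt0 _ s0 sh))// ler_wpM2l ?(ltW K0)//.
  by rewrite (addrC s) addrK ger0_norm.
have hC : 0 <= h / (2 * C) by rewrite divr_ge0// mulr_ge0// ltW.
rewrite normrM (ger0_norm hC) ler_wpM2l//.
rewrite (le_trans (ler_normB _ _))// lerD// normrM ler_pM//.
  rewrite (le_trans (heat2_lipschitz _ sigma_gt0 _ _ s0 s0))// ler_wpM2l ?(ltW K0)//.
  by rewrite subrr normr0 addr0 ae.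
  exact: wW.
have sh : 0 <= s + h by exact: addr_ge0.
rewrite (le_trans (heat2_lipschitz _ sigma_gt0 _ _ s0 sh))// ler_wpM2l ?(ltW K0)//.
by rewrite subrr normr0 add0r (addrC s) addrK ger0_norm.
Qed.

Section process.
Context dO (Omega : measurableType dO) (P : probability Omega R).
Context (Y : nat -> {RV P >-> T}) (x0 : E).
Hypothesis Y_iid : iid Y nu.

(** The state carries the position together with the accumulated martingale, which makes the pair a
    process driven by the inputs alone. *)
Definition martingale_step (z : (E * R) * T) : E * R :=
  (act (z.1.1, z.2), z.1.2 + d z.1.1 z.2).

Lemma measurable_martingale_step : measurable_fun setT martingale_step.
Proof.
have m1 : measurable_fun setT (fun z : (E * R) * T => z.1.1).
  by apply: (measurableT_comp measurable_fst).
have m2 : measurable_fun setT (fun z : (E * R) * T => z.1.2).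
  by apply: (measurableT_comp measurable_snd).
have ma : measurable_fun setT (fun z : (E * R) * T => act (z.1.1, z.2)).
  by apply: (measurableT_comp mact); exact: measurable_fun_pair.
apply: measurable_fun_pair => //; apply: measurable_funD => //.
apply: measurable_funB.
  exact: (measurableT_comp (bmf_meas bg) ma).
have bP : bmf (act_mean g).
  apply: (bmf_mean nu (h := fun z => g (act z))).
  exact: (bmf_comp bg mact).
exact: (measurableT_comp (bmf_meas bP) m1).
Qed.

Definition martingale_process := driven Y martingale_step (x0, 0).

Local Notation V := martingale_process.

(** After k steps a Gaussian variance 1 - k/N is still outstanding; each step trades a variance 1/N
    for one martingale increment, at the cost of one [step_error]. *)
Lemma martingale_corrected_heat a N k : (0 < N)%N -> a ^+ 2 * C = N%:R^-1 ->
  (k <= N)%N ->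
  `|\int[P]_w corrected_heat a N%:R^-1 (1 - k%:R / N%:R) (V k w)
    - corrected_heat a N%:R^-1 1 (x0, 0)| <= k%:R * step_error a N%:R^-1.
Proof.
move=> N0 aC; have Nn0 : N%:R != 0 :> R by rewrite pnatr_eq0 -lt0n.
set F := corrected_heat a N%:R^-1; elim: k => [_|k IH kN].
  by rewrite mul0r subr0 mul0r (@mean_constant _ _ _ _ _ (F 1 (x0, 0)))// subrr normr0.
have s0 : 0 <= 1 - k.+1%:R / N%:R :> R.
  by rewrite subr_ge0 ler_pdivrMr ?ltr0n// mul1r ler_nat.
have sE : 1 - k.+1%:R / N%:R + N%:R^-1 = 1 - k%:R / N%:R :> R.
  by rewrite -natr1; field.
have s1 : 0 <= 1 - k%:R / N%:R :> R by rewrite -sE addr_ge0.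
have bF1 := bmf_corrected_heat a N%:R^-1 s0.
have bF2 := bmf_corrected_heat a N%:R^-1 s1.
have mV j : measurable_fun setT (V j).
  by apply: measurable_driven; exact: measurable_martingale_step.
rewrite (mean_driven _ Y_iid measurable_martingale_step)//.
have -> : k.+1%:R * step_error a N%:R^-1 =
  step_error a N%:R^-1 + k%:R * step_error a N%:R^-1 by rewrite -natr1; ring.
rewrite -[X in `|X|](subrKA (\int[P]_w F (1 - k%:R / N%:R) (V k w))).
rewrite (le_trans (ler_normD _ _))// lerD//; last exact: IH (ltnW kN).
have bQ : bmf (fun z => \int[nu]_y F (1 - k.+1%:R / N%:R) (martingale_step (z, y))).
  apply: (bmf_mean nu (h := fun z => F (1 - k.+1%:R / N%:R) (martingale_step z))).
  exact: (bmf_comp bF1 measurable_martingale_step).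
rewrite -meanB; [|exact: (bmf_comp bQ)|exact: (bmf_comp bF2)].
apply: mean_bound => [|w'].
  by apply: bmfB; [exact: (bmf_comp bQ)|exact: (bmf_comp bF2)].
rewrite -/(V k w') /F -sE; case: (V k w') => x m.
by apply: lindeberg_step => //; rewrite invr_ge0.
Qed.

Lemma martingale_heat_cvg :
  \int[P]_w u 0 ((V N.+1 w).2 / Num.sqrt (C * N.+1%:R)) @[N --> \oo] --> u 1 0.
Proof.
have K0 := heat_const_gt0 sigma_gt0.
(* Chosen so that k (a + h) dominates the N step errors, using N a^3 = a / C and N h = 1, plus the
   values of the corrector at the two ends, which give the term W / C. *)
pose k := K * (D ^+ 3 / C + 1 + (D * W + W) / (2 * C) + W / C).
pose a N : R := (Num.sqrt (C * N.+1%:R))^-1.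
pose h N : R := N.+1%:R^-1.
have h0 N : 0 < h N by rewrite invr_gt0.
have CN N : 0 < C * N.+1%:R by rewrite mulr_gt0.
have a0 N : 0 < a N by rewrite invr_gt0 sqrtr_gt0.
have D0 : 0 <= D by rewrite (le_trans _ (dD x0 point)).
have W0 : 0 <= W by rewrite (le_trans _ (wW x0)).
have aC N : a N ^+ 2 * C = h N.
  rewrite /a /h exprVn sqr_sqrtr ?ltW// invfM mulrAC mulVf ?mul1r// gt_eqF//.
have bound N : `|u 1 0 - \int[P]_w u 0 ((V N.+1 w).2 / Num.sqrt (C * N.+1%:R))|
    <= k * (a N + h N).
  have := @martingale_corrected_heat (a N) N.+1 N.+1 isT (aC N) (leqnn _).
  rewrite divff ?pnatr_eq0// subrr -/(h N) => dF.
  have mV : measurable_fun setT (V N.+1).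
    by apply: measurable_driven; exact: measurable_martingale_step.
  have ma : measurable_fun setT (fun w => a N * (V N.+1 w).2).
    by apply: measurable_funM => //; exact: (measurableT_comp measurable_snd mV).
  have mx : measurable_fun setT (fun w => (V N.+1 w).1).
    exact: (measurableT_comp measurable_fst mV).
  pose c := h N / (2 * C).
  have c0 : 0 <= c by rewrite divr_ge0 ?(ltW (h0 N))// mulr_ge0// ltW.
  have bu : bmf (fun w => u 0 (a N * (V N.+1 w).2)).
    apply: (bmf_continuous_comp (M := 1)) ma; first exact: heat_continuous.
    by move=> x; rewrite ger0_norm ?Phi_ge0 ?Phi_le1.
  have bu2 : bmf (fun w' => c * u2 0 (a N * (V N.+1 w').2) * w (V N.+1 w').1).
    apply: bmfM; last exact: (bmf_comp bw mx).
    apply: bmfZ; apply: bmf_continuous_comp ma; first exact: heat2_continuous.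
    by move=> x; exact: heat2_bound.
  have cKW x y : `|c * u2 0 x * w y| <= c * (K * W).
    rewrite -mulrA normrM (ger0_norm c0) ler_wpM2l// normrM ler_pM//.
    exact: heat2_bound.
  have cKW1 x y : `|c * u2 1 x * w y| <= c * (K * W).
    rewrite -mulrA normrM (ger0_norm c0) ler_wpM2l// normrM ler_pM//.
    exact: heat2_bound.
  have -> : u 1 0 - \int[P]_o u 0 ((V N.+1 o).2 / Num.sqrt (C * N.+1%:R)) =
    \int[P]_o (c * u2 0 (a N * (V N.+1 o).2) * w (V N.+1 o).1)
    - c * u2 1 0 * w x0
    - (\int[P]_o corrected_heat (a N) (h N) 0 (V N.+1 o)
       - corrected_heat (a N) (h N) 1 (x0, 0)).
    rewrite [X in _ = _ - (X - _)](meanD _ bu bu2) /corrected_heat /= mulr0.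
    have -> : \int[P]_o u 0 ((V N.+1 o).2 / Num.sqrt (C * N.+1%:R)) =
       \int[P]_o u 0 (a N * (V N.+1 o).2).
      by apply: mean_ext => o; rewrite mulrC.
    by rewrite -/c; ring.
  rewrite (le_trans (ler_normB _ _))//.
  have hN : h N * N.+1%:R = 1 by rewrite /h mulVf// pnatr_eq0.
  have aN3 : N.+1%:R * a N ^+ 3 = a N / C.
    have -> : N.+1%:R * a N ^+ 3 = a N / C * (a N ^+ 2 * C * N.+1%:R).
      by field; rewrite gt_eqF.
    by rewrite aC hN mulr1.
  have -> : k * (a N + h N) = (c * (K * W) + c * (K * W)) +
    N.+1%:R * step_error (a N) (h N) + K * (D ^+ 3 / C * h N + a N
      + D * W / (2 * C) * h N + W / (2 * C) * a N + W / C * a N).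
    rewrite /step_error /k /c (ger0_norm (ltW (a0 N))).
    have -> : N.+1%:R * (K * (a N ^+ 3 * D ^+ 3) + K * h N ^+ 2 +
      h N / (2 * C) * (K * (a N * D) * W + K * h N * W)) =
      K * D ^+ 3 * (N.+1%:R * a N ^+ 3) + (h N * N.+1%:R) * (K * h N +
       (K * (a N * D) * W + K * h N * W) / (2 * C)) by field; rewrite gt_eqF.
    by rewrite aN3 hN; field; rewrite gt_eqF.
  rewrite -[leLHS]addr0 lerD//; last first.
    have C2 : 0 <= 2 * C by rewrite mulr_ge0// ltW.
    have [aN hN0 KN] : [/\ 0 <= a N, 0 <= h N & 0 <= K] by split; exact: ltW.
    have [C1 C2'] : 0 <= C^-1 /\ 0 <= (2 * C)^-1 by rewrite !invr_ge0 C2 ltW.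
    by rewrite mulr_ge0// !addr_ge0// !mulr_ge0// ?exprn_ge0.
  rewrite lerD// (le_trans (ler_normB _ _))// lerD//.
  apply: mean_bound => // o; exact: cKW.
have ah0 : k * (a N + h N) @[N --> \oo] --> k * (Num.sqrt (0 / C) + 0).
  apply: cvgMr; apply: cvgD; last exact: cvg_harmonic.
  have -> : a = fun N => Num.sqrt (h N / C).
    apply/funext => N.
    have -> : h N / C = a N ^+ 2 by rewrite -aC mulfK// gt_eqF.
    by rewrite sqrtr_sqr gtr0_norm.
  apply: (@cvg_comp _ _ _ (fun N => h N / C) Num.sqrt); last exact: sqrt_continuous.
  by apply: cvgMl; exact: cvg_harmonic.
rewrite mul0r sqrtr0 addr0 mulr0 in ah0.
apply/cvgrPdist_le => e e0; have /cvgrPdist_le/(_ e e0) := ah0.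
apply: filterS => N; rewrite sub0r normrN => ahe.
by rewrite (le_trans (bound N))// (le_trans (ler_norm _)).
Qed.

End process.
End step.
End lindeberg.

(** * From Gaussian smoothings back to distribution functions *)

Section unsmoothing.
Context {R : realType} d (Omega : measurableType d) (P : probability Omega R).
Variable (Z : nat -> Omega -> R).
Hypothesis mZ : forall N, measurable_fun setT (Z N).
Hypothesis Zheat : forall sigma t, 0 < sigma ->
  \int[P]_o heat sigma t 0 (Z N o) @[N --> \oo] --> heat sigma t 1 0.

Lemma heat0E sigma t x : 0 < sigma -> heat sigma t 0 x = Phi ((t - x) / sigma) :> R.
Proof. by move=> s0; rewrite /heat /heat_scale addr0 sqrtr_sqr gtr0_norm. Qed.

Let bheat sigma t N : bmf (fun o => heat sigma t 0 (Z N o)).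
Proof.
apply: (bmf_continuous_comp (M := 1)) (mZ N); first exact: heat_continuous.
by move=> x; rewrite ger0_norm ?Phi_ge0 ?Phi_le1.
Qed.

Let mZt N t : measurable [set o | Z N o <= t].
Proof.
rewrite (_ : [set o | _] = Z N @^-1` `]-oo, t]); last first.
  by apply/seteqP; split => o /=; rewrite in_itv.
by rewrite -[X in measurable X]setTI; apply: mZ.
Qed.

(** A pointwise comparison: if Z <= t then (t + n sigma - Z) / sigma >= n, so the smoothed indicator
    is at least Phi n. [Zcdf_lower] is the mirror image: for Z > t the indicator smoothed at t - n
    sigma is at most Phi (- n). *)
Let Zcdf_upper sigma n t N : 0 < sigma ->
  fine (P [set o | Z N o <= t]) <=
  \int[P]_o heat sigma (t + n * sigma) 0 (Z N o) + (1 - Phi n).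
Proof.
move=> s0; rewrite -mean_indic; last exact: mZt.
rewrite -[1 - Phi n](mean_cst P _) -meanD; [|exact: bheat|exact: bmf_cst].
apply: mean_le; [exact/bmf_indic/mZt|by apply: bmfD; [exact: bheat|exact: bmf_cst]|].
move=> o; rewrite indicE heat0E//; have [Zt|Zt] := leP (Z N o) t; last first.
  rewrite memNset /=; last by apply/negP; rewrite -ltNge.
  by rewrite addr_ge0 ?Phi_ge0// subr_ge0 Phi_le1.
rewrite mem_set//= -lerBlDr opprB addrCA subrr addr0 Phi_le// ler_pdivlMr//.
by rewrite lerBrDr addrC lerD2r.
Qed.

Let Zcdf_lower sigma n t N : 0 < sigma ->
  \int[P]_o heat sigma (t - n * sigma) 0 (Z N o) - Phi (- n) <=
  fine (P [set o | Z N o <= t]).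
Proof.
move=> s0; rewrite -mean_indic; last exact: mZt.
rewrite -[Phi (- n)](mean_cst P _) -meanB; [|exact: bheat|exact: bmf_cst].
apply: mean_le; [by apply: bmfB; [exact: bheat|exact: bmf_cst]|exact/bmf_indic/mZt|].
move=> o; rewrite indicE heat0E//; have [Zt|Zt] := leP (Z N o) t.
  by rewrite mem_set//= lerBlDr (le_trans (Phi_le1 _))// lerDl Phi_ge0.
rewrite memNset /=; last by apply/negP; rewrite -ltNge.
rewrite subr_le0 Phi_le// ler_pdivrMr// mulNr; lra.
Qed.

Let heat1_cvg n t : heat sigma (t + n * sigma) 1 0 @[sigma --> 0^'+] --> @Phi R t.
Proof.
rewrite /heat /heat_scale.
have : continuous (fun sigma : R => (t + n * sigma - 0) *
  (Num.sqrt (sigma ^+ 2 + 1))^-1).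
  move=> x; apply: cvgM.
    apply: cvgB; last exact: cvg_cst.
    by apply: cvgD; [exact: cvg_cst|apply: cvgM; [exact: cvg_cst|exact: cvg_id]].
  apply: cvgV; first by rewrite gt_eqF// sqrtr_gt0 ltr_wpDl// sqr_ge0.
  apply: (@cvg_comp _ _ _ (fun s : R => s ^+ 2 + 1) Num.sqrt); last exact: sqrt_continuous.
  by apply: cvgD; [exact: exprn_continuous|exact: cvg_cst].
move=> /(_ 0) c0.
apply: cvg_at_right_filter.
have {2}-> : t = (t + n * 0 - 0) * (Num.sqrt (0 ^+ 2 + 1))^-1.
  by rewrite mulr0 addr0 subr0 expr0n/= add0r sqrtr1 invr1 mulr1.
exact: continuous_comp c0 (@Phi_continuous R _).
Qed.

Lemma heat_cdf_cvg t :
  P [set o | Z N o <= t] @[N --> \oo] --> normal_prob 0 1 `]-oo, t]%classic.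
Proof.
rewrite -PhiE.
have -> : (fun N => P [set o | Z N o <= t]) =
    (fun N => (fine (P [set o | Z N o <= t]))%:E).
  by apply/funext => N; rewrite fineK// fin_num_measure.
apply: cvg_EFin; first by near=> N; done.
apply/cvgrPdist_le => e e0.
have e4 : 0 < e / 3 by rewrite divr_gt0.
(* The order of choices matters: [n] makes the Gaussian tails small, then [sigma] makes the shift n
   sigma and the added variance harmless, and only then does N grow. *)
have [n [n1 n0]] : exists n, 1 - Phi n <= e / 3 /\ Phi (- n) <= e / 3 :> R.
  near (pinfty_nbhs R) => x; near (ninfty_nbhs R) => y.
  have Px : `|1 - Phi x| <= e / 3.
    by near: x; have /cvgrPdist_le := @Phi_cvgy R; exact.
  have Py : `|0 - Phi y| <= e / 3.
    by near: y; have /cvgrPdist_le := @Phi_cvgNy R; exact.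
  exists (Num.max x (- y)); split.
    rewrite (le_trans _ Px)// (le_trans _ (ler_norm _))// lerB// Phi_le//.
    by rewrite le_max lexx.
  rewrite (le_trans _ Py)// sub0r normrN (le_trans _ (ler_norm _))// Phi_le//.
  by rewrite lerNl le_max lexx orbT.
have [sigma [s0 sU sL]] : exists sigma, [/\ 0 < sigma,
    `|Phi t - heat sigma (t + n * sigma) 1 0| <= e / 3 &
    `|Phi t - heat sigma (t + (- n) * sigma) 1 0| <= e / 3].
  near (0 : R)^'+ => sigma; exists sigma; split => //.
  - near: sigma; have /cvgrPdist_le := @heat1_cvg n t; exact.
  - near: sigma; have /cvgrPdist_le := @heat1_cvg (- n) t; exact.
have /cvgrPdist_le/(_ _ e4) hU := @Zheat sigma (t + n * sigma) s0.
have /cvgrPdist_le/(_ _ e4) hL := @Zheat sigma (t + (- n) * sigma) s0.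
move: hU hL; apply: filterS2 => N.
have := @Zcdf_upper sigma n t N s0; have := @Zcdf_lower sigma n t N s0.
rewrite -mulNr; move: sU sL; rewrite !ler_norml.
set a1 := heat _ _ _ _; set a2 := heat _ _ _ _.
set i1 := \int[P]_o _; set i2 := \int[P]_o _.
move=> /andP[? ?] /andP[? ?] ? ? /andP[? ?] /andP[? ?].
by rewrite /=; apply/andP; split; lra.
Unshelve. all: by end_near. Qed.

End unsmoothing.

(** * Powers of the support *)

Section closure_group.
Context (G : topologicalGroupType).
Implicit Types (x y z : G) (A U V : set G).

Lemma closure_divg A : (forall x y, A x -> A y -> A (x / y)%g) ->
  forall x y, closure A x -> closure A y -> closure A (x / y)%g.
Proof.
move=> AA x y cx cy B /nbhs_mulg [V [W [/open_nbhs_nbhs nV /open_nbhs_nbhs nW VW]]].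
have [v [Av Vv]] := cx V nV.
have [w [Aw Ww]] := cy _ (@invg_continuous G y W nW).
by exists (v / w)%g; split; [exact: AA|exact: VW].
Qed.

Lemma conj_continuous y : continuous (fun x : G => (x ^ y)%g).
Proof.
have -> : (fun x : G => (x ^ y)%g) = (fun x => y^-1 * (x * y))%g by [].
by apply: mulg_continuous2; [move=> x; exact: cvg_cst|exact: mulr_continuous].
Qed.

Lemma closure_conjg A y : (forall x, A x -> A (x ^ y)%g) ->
  forall x, closure A x -> closure A (x ^ y)%g.
Proof.
move=> AA x cx B nB; have [v [Av Bv]] := cx _ (@conj_continuous y x B nB).
by exists (v ^ y)%g; split => //; exact: AA.
Qed.

Fixpoint set_pow A n : set G :=
  if n is n'.+1 then [set (x * y)%g | x in A & y in set_pow A n'] else [set 1%g].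

Lemma set_powD A n m x y :
  set_pow A n x -> set_pow A m y -> set_pow A (n + m) (x * y)%g.
Proof.
elim: n x => [x -> |n IH x [a Aa [b Ab <-]] Ay]; first by rewrite mul1g.
by rewrite -mulgA; exists a => //; exists (b * y)%g => //; exact: IH.
Qed.

Lemma set_pow_conj A n : (forall x y, A x -> A (x ^ y)%g) ->
  forall x y, set_pow A n x -> set_pow A n (x ^ y)%g.
Proof.
move=> Ac; elim: n => [x y ->|n IH _ y [a Aa [b Ab <-]]]; first by rewrite conj1g.
rewrite conjMg; exists (a ^ y)%g; first exact: Ac.
by exists (b ^ y)%g => //; exact: IH.
Qed.

Section normal_powers.
Variable S : set G.
Hypothesis S_conj : forall x y, S x -> S (x ^ y)%g.

(** For a nonempty conjugation-invariant S, the closure of this set is the smallest closed normal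
    subgroup having a coset that contains S. *)
Definition pow_quotients : set G :=
  [set z | exists n x y, [/\ set_pow S n x, set_pow S n y & z = (x / y)%g]].

Lemma pow_quotients_div x y :
  pow_quotients x -> pow_quotients y -> pow_quotients (x / y)%g.
Proof.
move=> [n [a [b [Sa Sb ->]]]] [m [c [e [Sc Se ->]]]].
exists (n + m)%N, (a * e ^ b)%g, (c * b)%g; split.
(* The witnesses come from a b^-1 e c^-1 = (a (b^-1 e b)) (c b)^-1: conjugation carries e past b^-1
   and keeps it in the same power of S. *)
- by apply: set_powD => //; exact: set_pow_conj.
- by rewrite addnC; exact: set_powD.
- by rewrite conjgE !(invgM, invgK) !mulgA mulgK.
Qed.

Lemma pow_quotients_conj x y : pow_quotients x -> pow_quotients (x ^ y)%g.
Proof.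
move=> [n [a [b [Sa Sb ->]]]]; exists n, (a ^ y)%g, (b ^ y)%g.
by split; [exact: set_pow_conj|exact: set_pow_conj|rewrite conjMg conjVg].
Qed.

(* The sets S^n y^-1 with y in S^n are directed by inclusion: both S^n y^-1
   and S^m z^-1 are contained in S^(n+m) (y z)^-1. *)
Lemma pow_quotients_directed n m y z :
  set_pow S n y -> set_pow S m z ->
  (forall x, set_pow S n x ->
    exists2 x', set_pow S (n + m) x' & (x / y = x' / (y * z))%g) /\
  (forall x, set_pow S m x ->
    exists2 x', set_pow S (n + m) x' & (x / z = x' / (y * z))%g).
Proof.
move=> Sy Sz; split => x Sx.
  exists (x * z)%g; first exact: set_powD.
  by rewrite invgM mulgA mulgK.
exists (x * y ^ z)%g.
  by rewrite addnC; apply: set_powD => //; exact: set_pow_conj.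
by rewrite conjgE !invgM !mulgA !(mulgK, mulgVK).
Qed.

(** By density, every w has a quotient z = x / y so close to w u0^-1 that z^-1 w lies in U. The open
    sets [Om p] therefore cover G, finitely many suffice, and directedness merges these into one. *)
Lemma dense_pow_quotients_cover U :
  compact [set: G] -> closure pow_quotients = [set: G] -> open U -> U !=set0 ->
  exists n, forall w, exists2 x, set_pow S n x & U (x^-1 * w)%g.
Proof.
move=> cG dG oU [u0 Uu0].
pose Om (p : nat * G) := [set w | exists2 x, set_pow S p.1 x & U ((x / p.2)^-1 * w)%g].
pose I := [set p : nat * G | set_pow S p.1 p.2].
have Om_open p : open (Om p).
  rewrite (_ : Om p = \bigcup_(x in set_pow S p.1) ((fun w => (x / p.2)^-1 * w)%g @^-1` U)).
    by apply: bigcup_open => x _; apply: open_comp => // ? _; exact: mull_continuous.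
  by apply/seteqP; split => w /= [x]; exists x.
have Om_cover w : exists2 p, I p & Om p w.
  have : closure pow_quotients (w * u0^-1)%g by rewrite dG.
  have nW : nbhs (w * u0^-1)%g [set z | U (z^-1 * w)%g].
    have cf : continuous (fun z => z^-1 * w)%g.
      by apply: mulg_continuous2; [exact: invg_continuous|move=> ?; exact: cvg_cst].
    apply: (cf (w * u0^-1)%g); apply: open_nbhs_nbhs; split => //.
    by rewrite invgM invgK mulgVK.
  move=> /(_ _ nW) [_ [[n [x [y [Sx Sy ->]]]] Uz]].
  by exists (n, y) => //; exists x.
have [D DI DG] : finite_subset_cover I Om [set: G].
  move: cG; rewrite compact_cover; apply=> // w _.
  by have [p Ip Op] := Om_cover w; exists p.
have directed (s : seq (nat * G)) : (forall q, q \in s -> I q) ->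
    exists2 p, I p & forall q, q \in s -> Om q `<=` Om p.
  elim: s => [_|q s IH sI]; first by exists (0%N, 1%g).
  have [|p Ip sp] := IH; first by move=> q' q's; apply: sI; rewrite inE q's orbT.
  have Iq : I q by apply: sI; rewrite inE eqxx.
  have [qq qp] := pow_quotients_directed Iq Ip.
  exists (q.1 + p.1, q.2 * p.2)%g; first exact: set_powD.
  move=> q'; rewrite inE => /orP[/eqP -> w [x Sx Ux]|q's w].
    by have [x' Sx' xE] := qq x Sx; exists x'; rewrite //= -xE.
  move=> /(sp q' q's)[x Sx Ux].
  by have [x' Sx' xE] := qp x Sx; exists x'; rewrite //= -xE.
have [p Ip pD] := directed (enum_fset D) (fun q qD => set_mem (DI q qD)).
(* With p.2 = y, using the cover at y^-1 w removes the fixed factor y, since (x y^-1)^-1 y^-1 w = (y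
   x y^-1)^-1 w and conjugation preserves S^n. *)
exists p.1 => w.
have [q qD /(pD q qD)[x Sx Ux]] := DG (p.2^-1 * w)%g Logic.I.
exists (x ^ p.2^-1)%g; first exact: set_pow_conj.
by move: Ux; rewrite conjgE !(invgM, invgK) !mulgA.
Qed.

End normal_powers.
End closure_group.

Section support.
Context {R : realType} {G : topologicalGroupType}.
Variable nu : probability (borel G) R.

Lemma measure_supportP x :
  measure_support nu x <-> forall V : set G, open V -> V x -> (0 < nu V)%E.
Proof.
split=> [Sx V oV Vx|Vpos C [cC C1]].
  rewrite lt0e measure_ge0 andbT; apply/eqP => V0.
  have := Sx (~` V); apply => //; split; first exact: open_closedC.
  by rewrite probability_setC ?V0 ?sube0//; exact: open_borel.
apply: contrapT => nCx; have := Vpos (~` C) (closed_openC cC) nCx.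
by rewrite probability_setC ?C1 ?subee ?ltxx//; exact: closed_borel.
Qed.

Lemma support_conj x y : central nu ->
  measure_support nu x -> measure_support nu (x ^ y)%g.
Proof.
move=> cnu /measure_supportP Sx; apply/measure_supportP => V oV Vxy.
have := Sx _ (open_comp (in1W (@conj_continuous G y)) oV).
move=> /(_ Vxy); rewrite -(cnu y^-1%g V) //; last exact: open_borel.
congr (_ < nu _)%E; apply/seteqP; split => z /=; rewrite invgK conjgE.
  by move=> Vz; exists (y^-1 * (z * y))%g => //; rewrite !mulgA mulgV mul1g mulgK.
by move=> [v Vv <-]; rewrite !mulgA mulVg mul1g mulgVK.
Qed.

(** The closure H is a closed normal subgroup containing every x s^-1 with x, s in the support, so
    the support lies in s H; were H proper, strict aperiodicity would fail. An empty support would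
    lie in any coset. *)
Lemma aperiodic_pow_quotients_dense :
  central nu -> strictly_aperiodic nu ->
  closure (pow_quotients (measure_support nu)) = [set: G].
Proof.
move=> cnu anu; set S := measure_support nu; set H := closure _.
have Sc x y : S x -> S (x ^ y)%g by exact: support_conj.
have H1 : H 1%g.
  by apply: subset_closure; exists 0%N, 1%g, 1%g; split => //; rewrite divg1.
have Hn : normal_set H.
  by move=> x y; apply: closure_conjg => z; exact: pow_quotients_conj.
apply: contrapT => /eqP HT.
have Hsub : proper_closed_subgroup H.
  split=> //; split; first exact: closed_closure.
  split; first by rewrite inE.
  move=> x y; rewrite !inE; apply: closure_divg => u v.
  exact: pow_quotients_div.
have [[s Ss]|S0] := pselect (exists s, S s); last first.
  by apply: (anu H Hsub Hn 1%g) => x Sx; case: S0; exists x.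
apply: (anu H Hsub Hn s) => x Sx; exists (s^-1 * x)%g; last by rewrite mulVKg.
rewrite (_ : s^-1 * x = (x / s) ^ s)%g; last by rewrite conjgE mulgVK.
apply: Hn; apply: subset_closure; exists 1%N, x, s.
by split => //; [exists x|exists s] => //; exists 1%g => //; rewrite mulg1.
Qed.

End support.

Lemma measure_nonincreasing_small d (T : measurableType d) (R : realType)
    (mu : probability T R) (B : (set T)^nat) (eps : R) :
  (forall n, measurable (B n)) -> (forall n, B n.+1 `<=` B n) ->
  \bigcap_n B n = set0 -> 0 < eps -> exists n, (mu (B n) <= eps%:E)%E.
Proof.
move=> mB ndB B0 e0.
have cB : mu (B n) @[n --> \oo] --> (0 : \bar R).
  rewrite -(measure0 mu) -B0; apply: nonincreasing_cvg_mu => //.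
  - by rewrite -ge0_fin_numE// fin_num_measure.
  - by rewrite B0.
  - by apply/nonincreasing_seqP => n; apply/subsetPset.
have /fine_cvgP[_ /cvgrPdist_le/(_ eps e0)] := cB.
move=> [n _ /(_ n (leqnn n))]; rewrite /= sub0r normrN => nle; exists n.
rewrite -(fineK (fin_num_measure mu _ (mB n))) lee_fin.
exact: le_trans (ler_norm _) nle.
Qed.

Section translation.
Context {R : realType} {G : topologicalGroupType}.
Hypothesis sc : @second_countable G.
Variable mu : probability (borel G) R.
Hypothesis haar : normalized_haar mu.
Implicit Types (x y : G) (A E U V : set (borel G)).

Definition ltransl (x : G) (E : set (borel G)) : set (borel G) :=
  [set y | E ((x : G)^-1 * (y : G))%g].

(** A one-sided difference suffices: E and its translate have equal measure, so both differences do
    too. This equality also gives stability under complements. *)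
Definition translation_continuous E :=
  forall eps : R, 0 < eps ->
    exists2 V : set G, nbhs (1%g : G) V & forall x, V x ->
      (mu (E `\` ltransl x E) <= eps%:E)%E.

Lemma measurable_ltransl x E : measurable E -> measurable (ltransl x E).
Proof.
move=> mE; rewrite -[X in measurable X]setTI.
exact: (@measurable_mull G x^-1%g measurableT E mE).
Qed.

Lemma haar_ltransl x E : measurable E -> mu (ltransl x E) = mu E.
Proof. exact: haar_preimage. Qed.

(** U is the union of the basic open sets that all small translations keep inside U. Finitely many
    of them exhaust U up to eps, and one neighbourhood of 1 works for these. *)
Lemma translation_continuous_open U : open (U : set G) -> translation_continuous U.
Proof.
move=> oU eps e0; have [e [oe be]] := second_countable_seq sc.
pose I n := exists2 W : set G, nbhs (1%g : G) W &
   forall x y, W x -> e n y -> U (x^-1 * y)%g.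
pose D n : set (borel G) := if pselect (I n) then e n else set0.
pose F n : set (borel G) := \bigcup_(i < n) D i.
have mD n : measurable (D n).
  by rewrite /D; case: pselect => //= _; exact: open_borel.
have mF n : measurable (F n) by exact: bigcup_measurable.
have DU : \bigcup_n D n = U.
  apply/seteqP; split => [y [n _]|y Uy].
    rewrite /D; case: pselect => //= -[W nW WU] ey.
    by have := WU 1%g y (nbhs_singleton nW) ey; rewrite invg1 mul1g.
  have : nbhs (1^-1 * y : G)%g U.
    by rewrite invg1 mul1g; apply: open_nbhs_nbhs.
  move=> /nbhs_mulg[V [W [/open_nbhs_nbhs nV /open_nbhs_nbhs/be[n ny nW] VW]]].
  have In : I n.
    exists [set x | V (x^-1)%g]; first exact: (@invg_continuous G).
    by move=> x z Vx /nW Wz; exact: VW.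
  by exists n => //; rewrite /D; case: pselect.
have FV n : exists2 V : set G, nbhs (1%g : G) V & forall x y, V x -> F n y -> U (x^-1 * y)%g.
  elim: n => [|n [V nV VF]].
    by exists setT; [exact: filterT|by move=> x y _ [i]].
  have [[W nW WU]|nI] := pselect (I n).
    exists (V `&` W); first exact: filterI.
    move=> x y [Vx Wx] [i /=]; rewrite ltnS leq_eqVlt => /orP[/eqP ->|ilt Diy].
      by rewrite /D; case: pselect => //= _ eny; exact: WU.
    by apply: VF Vx _; exists i.
  exists V => // x y Vx [i /=]; rewrite ltnS leq_eqVlt => /orP[/eqP ->|ilt Diy].
    by rewrite /D; case: pselect.
  by apply: VF Vx _; exists i.
have mU : measurable U by exact: open_borel.
have [n nle] : exists n, (mu (U `\` F n) <= eps%:E)%E.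
  apply: measure_nonincreasing_small => //.
  - by move=> n; exact: measurableD.
  - move=> n y [Uy nF]; split => // -[i /= ilt Diy]; apply: nF.
    by exists i => //=; exact: ltnW.
  - apply/seteqP; split => // y yB; have [Uy _] := yB 0%N Logic.I.
    move: Uy; rewrite -DU => -[n _ Dny].
    by have [_] := yB n.+1 Logic.I; apply; exists n => /=.
have [V nV VF] := FV n; exists V => // x Vx.
apply: le_trans nle; apply: le_measure; rewrite ?inE.
- by apply: measurableD => //; exact: measurable_ltransl.
- exact: measurableD.
by move=> y [Uy nUy]; split => // Fy; apply: nUy; exact: VF Vx Fy.
Qed.

Lemma translation_continuousC E : measurable E ->
  translation_continuous E -> translation_continuous (~` E).
Proof.
move=> mE cE eps /cE[V nV VE]; exists V => // x /VE; apply: le_trans.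
have mx := measurable_ltransl x mE.
have -> : ~` E `\` ltransl x (~` E) = ltransl x E `\` E.
  by apply/seteqP; split => y /= [h1 h2]; split => //; exact: contrapT.
have fE : mu (E `&` ltransl x E) \is a fin_num.
  by apply: fin_num_measure; exact: measurableI.
rewrite measureD// ?[X in (X - _)%E](haar_ltransl x mE); last first.
  by rewrite -ge0_fin_numE// fin_num_measure.
rewrite setIC measureD//.
by rewrite -ge0_fin_numE// fin_num_measure.
Qed.

Lemma translation_continuousU A E : measurable A -> measurable E ->
  translation_continuous A -> translation_continuous E ->
  translation_continuous (A `|` E).
Proof.
move=> mA mE cA cE eps e0; have e2 : 0 < eps / 2 by rewrite divr_gt0.
have [V nV VA] := cA _ e2; have [W nW WE] := cE _ e2.
exists (V `&` W); first exact: filterI.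
move=> x [/VA hA /WE hE].
have mx := measurable_ltransl x mA; have mxE := measurable_ltransl x mE.
apply: (@le_trans _ _ (mu ((A `\` ltransl x A) `|` (E `\` ltransl x E)))).
  apply: le_measure; rewrite ?inE.
  - apply: measurableD; first exact: measurableU.
    by apply: measurable_ltransl; exact: measurableU.
  - by apply: measurableU; exact: measurableD.
  move=> y [[Ay|Ey] nAE]; [left|right]; split => // h; apply: nAE; [left|right]; exact: h.
rewrite (le_trans (measureU2 _ _ _))//; [exact: measurableD..|].
by rewrite [eps]splitr EFinD leeD.
Qed.

(** The sets with this property form a Dynkin system containing the open sets, which are stable
    under intersection. *)
Lemma translation_continuous_measurable E : measurable E -> translation_continuous E.
Proof.
pose K := [set E : set (borel G) | measurable E /\ translation_continuous E].
have oK : @open G `<=` K.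
  by move=> U oU; split; [exact: open_borel|exact: translation_continuous_open].
have dK : dynkin K.
  split=> [|A [mA cA]|F tF KF].
  - by apply: oK; exact: openT.
  - by split; [exact: measurableC|exact: translation_continuousC].
  have mF n : measurable (F n) by have [] := KF n.
  split; first exact: bigcup_measurable.
  move=> eps e0; have e2 : 0 < eps / 2 by rewrite divr_gt0.
  (* The tails decrease to the empty set because the [F i] are disjoint, so one of them has measure
     at most eps / 2; the finite union before it is handled by additivity. *)
  pose B n := \bigcup_(i in [set i | (n <= i)%N]) F i.
  have mB n : measurable (B n) by exact: bigcup_measurable.
  have [n nB] : exists n, (mu (B n) <= (eps / 2)%:E)%E.
    apply: measure_nonincreasing_small => //.
    - by move=> n y [i /= ni Fiy]; exists i => //=; exact: ltnW.
    - apply/seteqP; split => // y yB; have [i _ Fiy] := yB 0%N Logic.I.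
      have [j /= ij Fjy] := yB i.+1 Logic.I.
      have ij' : i = j by apply: (tF i j) => //; exists y.
      by rewrite ij' ltnn in ij.
  pose S n := \big[setU/set0]_(i < n) F i.
  have cS : measurable (S n) /\ translation_continuous (S n).
    rewrite /S; elim: (n) => [|m [mS cS]].
      rewrite big_ord0; split => // e' e'0; exists setT; first exact: filterT.
      by move=> x _; rewrite set0D measure0 lee_fin ltW.
    rewrite big_ord_recr /=; split; first exact: measurableU.
    by apply: translation_continuousU => //; have [] := KF m.
  have [mS /(_ _ e2)[V nV VS]] := cS; exists V => // x /VS hx.
  have mx := measurable_ltransl x mS.
  apply: (@le_trans _ _ (mu ((S n `\` ltransl x (S n)) `|` B n))).
    apply: le_measure; rewrite ?inE.
    - apply: measurableD; first exact: bigcup_measurable.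
      by apply: measurable_ltransl; exact: bigcup_measurable.
    - by apply: measurableU => //; exact: measurableD.
    move=> y [[i _ Fiy] nU]; have [ni|ilt] := leqP n i; first by right; exists i.
    left; split; first by rewrite /S -bigcup_mkord; exists i.
    by move=> h; apply: nU; move: h; rewrite /ltransl /S /= -bigcup_mkord => -[j _ Fj]; exists j.
  rewrite (le_trans (measureU2 _ _ _))//; [exact: measurableD|].
  by rewrite [eps]splitr EFinD leeD.
move=> mE; suff : K E by case.
have : <<d @open G >> E.
  by rewrite setI_closed_g_dynkin_g_sigma_algebra//; exact: openI.
by apply: smallest_sub.
Qed.

End translation.

(** * Doeblin's condition *)

Lemma mean_minorization d (T : measurableType d) (R : realType)
    (mu m : probability T R) (A : set T) (c : R) (F : T -> R) :
  measurable A -> 0 <= c ->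
  (forall B, measurable B -> (c%:E * mu (B `&` A) <= m B)%E) ->
  bmf F -> (forall x, 0 <= F x) ->
  c * \int[mu]_x (\1_A x * F x) <= \int[m]_x F x.
Proof.
move=> mA c0 cm bF F0; pose c' : {nonneg R} := NngNum c0.
pose m1 : {measure set T -> \bar R} := mscale c' (mrestr mu mA).
have m1E B : m1 B = (c%:E * mu (B `&` A))%E by [].
have mF : measurable_fun setT (EFin \o F) by apply/measurable_EFinP; exact: bmf_meas.
have F0' x : (0 <= (F x)%:E)%E by rewrite lee_fin.
have b1F : bmf (fun x => \1_A x * F x) by apply: bmfM => //; exact: bmf_indic.
rewrite -lee_fin EFinM !bmf_EFin//.
have -> : (\int[mu]_x (\1_A x * F x)%:E = \int[mu]_(x in A) (F x)%:E)%E.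
  rewrite [RHS]integral_mkcond; apply: eq_integral => x _.
  by rewrite patchE indicE; case: (x \in A); rewrite ?mul1r ?mul0r.
apply: (@le_trans _ _ (\int[m]_(x in A) (F x)%:E)%E); last first.
  by apply: ge0_subset_integral.
rewrite -[X in (X * _)%E]/(c'%:num%:E) -ge0_integral_mscale//; last first.
  exact: measurable_funTS.
rewrite (@eq_measure_integral _ _ _ _ m1); last first.
  by move=> B mB BA; rewrite m1E setIidl.
apply: ge0_le_measure_integral => // B mB; rewrite m1E; exact: cm.
Qed.

Lemma measure_bigcup_eq0 d (T : measurableType d) (R : realType)
    (mu : {measure set T -> \bar R}) (A : (set T)^nat) :
  (forall n, measurable (A n)) -> (forall n, mu (A n) = 0%E) ->
  mu (\bigcup_n A n) = 0%E.
Proof.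
move=> mA A0; apply/negligibleP; first exact: bigcup_measurable.
by apply: negligible_bigcup => n; apply/negligibleP; [exact: mA|exact: A0].
Qed.

(** A Radon-Nikodym density of a nonzero measure is positive on a set of positive mu-measure, hence
    at least 1/(n + 1) on one for some n. *)
Lemma dominated_minorization d (T : measurableType d) (R : realType)
    (mu : probability T R) (m : {measure set T -> \bar R}) :
  (m setT < +oo)%E -> m `<< mu -> m setT <> 0%E ->
  exists c A, [/\ 0 < c, measurable A, (0 < mu A)%E &
    forall B, measurable B -> (c%:E * mu (B `&` A) <= m B)%E].
Proof.
move=> moo mmu m0.
pose m' : {finite_measure set T -> \bar R} := mfrestr measurableT moo.
have m'E B : m' B = m B by rewrite /m' /= /mfrestr /mrestr setIT.
have m'mu : m' `<< mu.
  by move=> B nB C mC CB; rewrite m'E; exact: (mmu B).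
have [f [f0 ffin /integrableP[mf _] fE]] := @radon_nikodym_sigma_finite _ _ _ mu m' m'mu.
pose A n := [set x | (n.+1%:R^-1%:E <= f x)%E].
have mA n : measurable (A n).
  by rewrite -[X in measurable X]setTI; exact: emeasurable_fun_c_infty.
have [n An] : exists n, (0 < mu (A n))%E.
  apply: contrapT => /forallNP A0.
  have mUA : measurable (\bigcup_n A n) by exact: bigcup_measurable.
  have mA0 : mu (\bigcup_n A n) = 0%E.
    apply: measure_bigcup_eq0 => // n; apply/eqP.
    by rewrite eq_le measure_ge0 andbT leNgt; exact/negP/A0.
  apply: m0; rewrite -(setvU (\bigcup_n A n)) measureU//; last exact: setICl.
    have mU0 : m (\bigcup_n A n) = 0%E.
      by apply: (mmu (\bigcup_n A n)) => //; apply/(measure0_null_setP mu).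
    rewrite [X in (_ + X)%E]mU0 adde0; transitivity (\int[mu]_(x in ~` (\bigcup_n A n)) f x)%E.
      by rewrite -fE ?m'E//; exact: measurableC.
    apply: integral0_eq => x /= nUx; apply/eqP; rewrite eq_le f0 andbT leNgt.
    apply/negP => fx; apply: nUx.
    have : 0 < fine (f x) by rewrite fine_gt0// fx ltey_eq ffin.
    move=> /ltr_add_invr[n]; rewrite add0r => nf.
    by exists n => //; rewrite /A /= -(fineK (ffin x)) lee_fin; exact: ltW.
  exact: measurableC.
exists n.+1%:R^-1, (A n); split => // B mB.
have mBA : measurable (B `&` A n) by exact: measurableI.
apply: (@le_trans _ _ (m (B `&` A n))); last by apply: le_measure; rewrite ?inE.
have -> : m (B `&` A n) = (\int[mu]_(x in B `&` A n) f x)%E by rewrite -fE ?m'E.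
rewrite -integral_cst//; apply: ge0_le_integral => //.
- by move=> x _; rewrite lee_fin invr_ge0.
- exact: measurable_funTS.
- by move=> x [].
Qed.

Section doeblin.
Context {R : realType} {G : topologicalGroupType}.
Hypothesis sc : @second_countable G.
Variable mu : probability (borel G) R.
Hypothesis haar : normalized_haar mu.
Local Notation "x ** y" := ((x : G) * (y : G))%g (at level 40).
Local Notation "x ^-" := ((x : G)^-1)%g (at level 2).
Implicit Types (A : set (borel G)) (F : borel G -> R).

(* The convolution of the indicator of [A] with itself: translations being
   continuous in mean, it is bounded below on a nonempty open set. *)
Definition overlap A (w : borel G) : R := \int[mu]_x (\1_A x * \1_A (x ^- ** w)).

Let mdiv : measurable_fun setT
  ((fun z => z.2 ^- ** z.1) : (borel G * borel G)%type -> borel G).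
Proof. by apply: measurable_mul_fun => //; exact: measurable_inv_fun. Qed.

Let boverlap2 A : measurable A ->
  bmf (fun z : (borel G * borel G)%type => \1_A z.2 * \1_A (z.2 ^- ** z.1) : R).
Proof.
move=> mA; apply: bmfM; last exact: (bmf_comp (bmf_indic mA) mdiv).
by apply: (bmf_comp (bmf_indic mA)).
Qed.

Let boverlap A : measurable A -> bmf (overlap A).
Proof. by move=> mA; exact: (bmf_mean mu (boverlap2 mA)). Qed.

Lemma mean_overlap A : measurable A -> \int[mu]_w overlap A w = fine (mu A) ^+ 2.
Proof.
move=> mA; rewrite /overlap (mean_swap _ _ (boverlap2 mA)) /=.
transitivity (\int[mu]_y (fine (mu A) * \1_A y)).
  apply: mean_ext => y; rewrite meanZ; last exact: (bmf_mull _ (bmf_indic mA)).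
  by rewrite (haar_mull haar _ (bmf_indic mA)) mean_indic// mulrC.
by rewrite meanZ; [rewrite mean_indic|exact: bmf_indic].
Qed.

(** The overlap has mean mu(A)^2 > 0, so it is positive at some w0, where it equals mu(B) for [B]
    the set of x in A with x^-1 w0 in A. At w = z w0 every point of B meeting z B contributes, and
    for z near 1 this intersection keeps half of the mass. *)
Lemma overlap_bound_below A : measurable A -> (0 < mu A)%E ->
  exists U c, [/\ open U, U !=set0, 0 < c & forall w, U w -> c <= overlap A w].
Proof.
move=> mA A0.
have fA : 0 < fine (mu A) by rewrite fine_gt0// A0 ltey_eq fin_num_measure.
have [w0 w00] : exists w0, 0 < overlap A w0.
  apply: contrapT => /forallNP h.
  have : \int[mu]_w overlap A w <= \int[mu]_(w in setT) 0.
    apply: mean_le; [exact: boverlap|exact: bmf_cst|].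
    by move=> w; rewrite leNgt; exact/negP/h.
  by rewrite mean_overlap// mean_cst leNgt exprn_gt0.
pose B : set (borel G) := A `&` [set x | A (x ^- ** w0)].
have mB : measurable B.
  apply: measurableI => //; rewrite -[X in measurable X]setTI.
  by apply: (measurable_mul_fun sc (measurable_inv_fun (@measurable_id _ _ _)) (measurable_cst (w0 : borel G))).
have indB x : \1_B x = \1_A x * \1_A (x ^- ** w0) :> R.
  rewrite /B indicI /=; congr (_ * _).
have Bov : overlap A w0 = fine (mu B).
  by rewrite -mean_indic//; apply: mean_ext => x; rewrite indB.
rewrite Bov in w00; set b := fine (mu B) in w00.
have b2 : 0 < b / 2 by rewrite divr_gt0.
have [V nV VB] := translation_continuous_measurable sc haar mB b2.
exists [set w | V° (w * (w0 : G)^-1)%g], (b / 2); split => //.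
- by apply: open_comp => [w _|]; [exact: mulr_continuous|exact: open_interior].
- by exists w0; rewrite /= mulgV.
move=> w /interior_subset Vw; set z := (w * _)%g in Vw.
have mz := @measurable_ltransl _ z B mB.
have mBz : measurable (B `&` ltransl z B) by exact: measurableI.
apply: (@le_trans _ _ (fine (mu (B `&` ltransl z B)))).
  have mBD : measurable (B `\` ltransl z B) by exact: measurableD.
  have bE : b = fine (mu (B `\` ltransl z B)) + fine (mu (B `&` ltransl z B)).
    rewrite -fineD ?fin_num_measure//; congr fine.
    exact: measureDI.
  have : fine (mu (B `\` ltransl z B)) <= b / 2.
    by rewrite -lee_fin fineK ?fin_num_measure//; exact: VB.
  by lra.
rewrite -mean_indic//; apply: mean_le.
- exact: bmf_indic.
- exact: (bmf_sectionr (w : borel G) (boverlap2 mA)).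
move=> x; have [[[Ax _] [_ Axw]]|nBx] := pselect ((B `&` ltransl z B) x).
  have -> : \1_A x = 1 :> R by rewrite indicE mem_set.
  rewrite mul1r.
  have -> : x ^- ** w = ((z^-1 * (x : G))^-1 * (w0 : G))%g.
    by rewrite invgM invgK -mulgA mulgVK.
  have Axw' : A ((z^-1 * (x : G))^-1 * (w0 : G))%g := Axw.
  rewrite [leRHS]indicE (mem_set Axw') indicE; by case: (_ \in _).
by rewrite indicE memNset// mulr_ge0.
Qed.

Variable nu : probability (borel G) R.
Local Notation P := (opc nu).

Lemma iter_opc_ge0 F k : (forall x, 0 <= F x) -> forall x, 0 <= iter k P F x.
Proof. by move=> F0; elim: k => //= k IH x; apply: mean_ge0. Qed.

Lemma opc_le m (F F' : borel G -> R) x : bmf F -> bmf F' ->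
  (forall y, F y <= F' y) -> opc m F x <= opc m F' x.
Proof.
by move=> bF bF' FF'; apply: mean_le; [exact: bmf_mull..|move=> y; exact: FF'].
Qed.

Definition local_mean A F (x : borel G) : R := \int[mu]_y (\1_A y * F (x ** y)).

Let blocal_mean A F : measurable A -> bmf F -> bmf (local_mean A F).
Proof.
move=> mA bF; apply: (bmf_mean mu (h := fun z : (borel G * borel G)%type => \1_A z.2 * F (z.1 ** z.2))).
apply: bmfM; first exact: (bmf_comp (bmf_indic mA)).
by apply: (bmf_comp bF); exact: measurable_mul_fun.
Qed.

Let local_mean_le A F F' x : measurable A -> bmf F -> bmf F' ->
  (forall y, F y <= F' y) -> local_mean A F x <= local_mean A F' x.
Proof.
move=> mA bF bF' FF'; apply: mean_le => [||y].
- by apply: bmfM; [exact: bmf_indic|exact: bmf_mull].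
- by apply: bmfM; [exact: bmf_indic|exact: bmf_mull].
- by rewrite ler_wpM2l.
Qed.

Lemma local_mean2 A F x : measurable A -> bmf F ->
  local_mean A (local_mean A F) x = \int[mu]_w (overlap A w * F (x ** w)).
Proof.
move=> mA bF.
have mxy : measurable_fun setT
   ((fun z => x ** z.1) : (borel G * borel G)%type -> borel G).
  by apply: measurable_mul_fun => //; exact: measurable_cst.
transitivity (\int[mu]_y \int[mu]_w (\1_A y * \1_A (y ^- ** w) * F (x ** w))).
  apply: mean_ext => y; rewrite /local_mean.
  have b1 : bmf (fun w : borel G => \1_A (y ^- ** w) * F (x ** w)).
    apply: bmfM; last exact: bmf_mull.
    exact: (bmf_mull (y ^-) (bmf_indic mA)).
  have -> : \int[mu]_w (\1_A y * \1_A (y ^- ** w) * F (x ** w)) =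
    \1_A y * \int[mu]_w (\1_A (y ^- ** w) * F (x ** w)).
    by rewrite -meanZ//; apply: mean_ext => w; rewrite mulrA.
  congr (_ * _); rewrite -(haar_mull haar y b1); apply: mean_ext => w.
  by rewrite mulKg mulgA.
rewrite (mean_swap _ _ (h := fun z : (borel G * borel G)%type =>
   \1_A z.1 * \1_A (z.1 ^- ** z.2) * F (x ** z.2))) /=.
  apply: mean_ext => w; rewrite mulrC /overlap -meanZ.
    by apply: mean_ext => y; rewrite mulrC.
  exact: (bmf_sectionr (w : borel G) (boverlap2 mA)).
apply: bmfM.
  apply: (bmf_comp (boverlap2 mA) (phi := fun z : (borel G * borel G)%type => (z.2, z.1))).
  exact: measurable_fun_pair.
by apply: (bmf_comp bF); apply: measurable_mul_fun => //; exact: measurable_cst.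
Qed.

(** P^k dominates c times averaging over A. Doing this twice averages against c^2 times the overlap
    of A, which is bounded below on an open set, whereas A itself may have empty interior. *)
Lemma spread_local_minorization k A c :
  measurable A -> (0 < mu A)%E -> 0 < c ->
  (forall B, measurable B -> (c%:E * mu (B `&` A) <= cpow sc nu k B)%E) ->
  exists U c', [/\ open U, U !=set0, 0 < c' &
    forall F, bmf F -> (forall x, 0 <= F x) ->
      forall x, c' * local_mean U F x <= iter (k + k) P F x].
Proof.
move=> mA A0 c0 cA.
have [U [e [oU U0 e0 Ue]]] := overlap_bound_below mA A0.
have cF F : bmf F -> (forall x, 0 <= F x) ->
    forall x, c * local_mean A F x <= iter k P F x.
  move=> bF F0 x; rewrite -(opc_cpow sc)// /opc.
  apply: mean_minorization => //; [exact: ltW|exact: bmf_mull].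
exists U, (c ^+ 2 * e); split => //; first by rewrite mulr_gt0// exprn_gt0.
move=> F bF F0 x; have mU : measurable (U : set (borel G)) by exact: open_borel.
have bPF := bmf_iter_opc sc nu k bF.
rewrite iterD; apply: (le_trans _ (cF _ bPF (iter_opc_ge0 k F0) x)).
have bAF := blocal_mean mA bF.
apply: (@le_trans _ _ (c * local_mean A (fun y => c * local_mean A F y) x)); last first.
  rewrite ler_wpM2l ?(ltW c0)//; apply: local_mean_le => //; first exact: bmfZ.
  by move=> y; exact: cF.
have -> : local_mean A (fun y => c * local_mean A F y) x = c * local_mean A (local_mean A F) x.
  rewrite -(meanZ mu c (bmfM (bmf_indic mA) (bmf_mull x bAF))).
  by apply: mean_ext => y; rewrite mulrCA.
rewrite mulrA -expr2 -mulrA ler_wpM2l ?exprn_ge0 ?(ltW c0)// local_mean2//.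
have bUF : bmf (fun y : borel G => \1_(U : set (borel G)) y * F (x ** y)).
  by apply: bmfM; [exact: bmf_indic|exact: bmf_mull].
rewrite /local_mean -meanZ//; apply: mean_le; first exact: bmfZ.
  by apply: bmfM; [exact: boverlap|exact: bmf_mull].
move=> w; rewrite mulrA ler_wpM2r// indicE.
have [Uw|nUw] := pselect (U w).
  by rewrite (mem_set Uw) mulr1; exact: Ue.
by rewrite memNset// mulr0; apply: mean_ge0 => y; rewrite mulr_ge0.
Qed.

End doeblin.

Section doeblin_minorization.
Context {R : realType} {G : topologicalGroupType}.
Hypothesis sc : @second_countable G.
Hypothesis cG : compact [set: G].
Variables mu nu : probability (borel G) R.
Hypothesis haar : normalized_haar mu.
Local Notation "x ** y" := ((x : G) * (y : G))%g (at level 40).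
Local Notation "x ^-" := ((x : G)^-1)%g (at level 2).
Local Notation S := (measure_support nu).
Local Notation P := (opc nu).

Lemma cpow_support_gt0 n x (V : set G) :
  set_pow S n x -> open V -> V x -> (0 < cpow sc nu n V)%E.
Proof.
elim: n x V => [x V ->|n IH _ V [s Ss [t St <-]]] oV Vx.
  by rewrite /= diracE mem_set.
have /nbhs_mulg[V1 [V2 [[oV1 V1s] [oV2 V2t] V12]]] : nbhs (s * t)%g V.
  exact: open_nbhs_nbhs.
have mV1 := open_borel oV1; have mV2 := open_borel oV2.
apply: (@lt_le_trans _ _ (nu V1 * cpow sc nu n V2)%E).
  apply: mule_gt0; last exact: IH oV2 V2t.
  by have /measure_supportP := Ss; exact.
rewrite -product_measure1E//=.
rewrite -[leRHS]/((nu \x cpow sc nu n)%E (@mulb G @^-1` V)).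
apply: le_measure; rewrite ?inE; first exact: measurableX.
  rewrite -[X in measurable X]setTI; apply: (measurable_mulb sc) => //.
  exact: open_borel.
by move=> [v w] /= [? ?]; exact: V12.
Qed.

Definition hitting n (U : set G) (w : borel G) : R :=
  \int[cpow sc nu n]_z \1_(U : set (borel G)) (z ^- ** w).

Lemma bmf_hitting_section (U : set G) (w : G) : open U ->
  bmf (fun z : borel G => \1_(U : set (borel G)) (z ^- ** w) : R).
Proof.
move=> oU; apply: (bmf_comp (bmf_indic (open_borel oU))).
by apply: (measurable_mul_fun sc (measurable_inv_fun (@measurable_id _ _ _)) (measurable_cst (w : borel G))).
Qed.

(** Near each w one neighbourhood of a suitable x in S^n sends all nearby w' into U, and it has
    positive nu^n-measure. Compactness makes the resulting local lower bound uniform. *)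
Lemma hitting_uniform n (U : set G) : open U ->
  (forall w, exists2 x, set_pow S n x & U (x^-1 * w)%g) ->
  exists2 e, 0 < e & forall w, e <= hitting n U w.
Proof.
move=> oU SU; pose m := cpow sc nu n.
have loc w : [set: G] w -> \forall w' \near w & e \near (0 : R)^'+, e <= hitting n U w'.
  move=> _; have [x Sx Ux] := SU w.
  have /nbhs_mulg[V [W [[oV Vx] [oW Ww] VW]]] : nbhs (x^-1 * w)%g U.
    exact: open_nbhs_nbhs.
  pose V' : set G := [set z | V (z^-1)%g].
  have oV' : open V' by apply: open_comp => // z _; exact: invg_continuous.
  have mV' := open_borel oV'.
  have V'0 : (0 < m V')%E by exact: cpow_support_gt0 Sx oV' Vx.
  have f0 : 0 < fine (m V') by rewrite fine_gt0// V'0 ltey_eq fin_num_measure.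
  exists (W, [set e | e <= fine (m V')]) => /=.
    split; first exact: open_nbhs_nbhs.
    by apply: nbhs_right_le.
  move=> [w' e] /= [Ww' em]; apply: le_trans em _.
  rewrite -mean_indic//; apply: mean_le; [exact: bmf_indic|exact: bmf_hitting_section|].
  move=> z; rewrite !indicE ler_nat.
  have [Vz|nVz] := pselect (V' z); last by rewrite memNset.
  by rewrite (mem_set (_ : U (z^- ** w')))//; [case: (_ \in _)|exact: VW].
have /compact_near_coveringP/(_ _ (0 : R)^'+ (fun e w => e <= hitting n U w)) := cG.
move=> /(_ _ loc) cov; near (0 : R)^'+ => e; exists e => //.
by move=> w; have := near cov e; apply.
Unshelve. all: by end_near. Qed.

Hypotheses (nu_central : central nu) (nu_aperiodic : strictly_aperiodic nu).
Variables (k : nat) (mabs msing : {measure set (borel G) -> \bar R}).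
Hypothesis dec : lebesgue_decomposition (convolution_power nu k) mu mabs msing.
Hypothesis mabs_neq0 : exists2 A : set (borel G), measurable A & mabs A <> 0%E.

(** P^(2k) dominates an average over the open set U. Applying P^n first spreads U over translates z
    U with z distributed as nu^n; after the substitution w = z u the weight of w is [hitting n U w],
    which is bounded below. *)
Lemma doeblin : exists n c, 0 < c /\
  forall F : borel G -> R, bmf F -> (forall x, 0 <= F x) ->
  forall x, c * \int[mu]_y F y <= iter n P F x.
Proof.
have [decE mabs_mu _] := dec.
have mabs_le A : measurable A -> (mabs A <= cpow sc nu k A)%E.
  by move=> mA; rewrite cpowE// decE// leeDl.
have mabsoo : (mabs setT < +oo)%E.
  apply: le_lt_trans (mabs_le _ measurableT) _.
  by rewrite -ge0_fin_numE// fin_num_measure.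
have mabsT : mabs setT <> 0%E.
  move=> mT0; have [A mA] := mabs_neq0; apply; apply/eqP.
  rewrite eq_le measure_ge0 andbT -mT0.
  by apply: le_measure; rewrite ?inE.
have [c [A [c0 mA A0 cA]]] := dominated_minorization mabsoo mabs_mu mabsT.
have cA' B : measurable B -> (c%:E * mu (B `&` A) <= cpow sc nu k B)%E.
  by move=> mB; apply: le_trans (cA B mB) _; exact: mabs_le.
have [U [c' [oU U0 c'0 Uc']]] := spread_local_minorization haar mA A0 c0 cA'.
have Sc x y : S x -> S (x ^ y)%g by exact: support_conj.
have dense := aperiodic_pow_quotients_dense nu_central nu_aperiodic.
have [n nU] := dense_pow_quotients_cover Sc cG dense oU U0.
have [e e0 eh] := hitting_uniform oU nU.
exists (n + (k + k))%N, (c' * e); split=> [|F bF F0 x]; first exact: mulr_gt0.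
have mU := open_borel oU.
have bPF := bmf_iter_opc sc nu (k + k) bF.
rewrite iterD -(opc_cpow sc)//.
have bUF z : bmf (fun w : borel G => \1_(U : set (borel G)) w * F (z ** w)).
  by apply: bmfM; [exact: bmf_indic|exact: bmf_mull].
have bL : bmf (local_mean mu U F).
  apply: (bmf_mean mu (h := fun z : (borel G * borel G)%type =>
     \1_(U : set (borel G)) z.2 * F (z.1 ** z.2))).
  apply: bmfM; first exact: (bmf_comp (bmf_indic mU)).
  by apply: (bmf_comp bF); exact: measurable_mul_fun.
apply: (@le_trans _ _ (opc (cpow sc nu n) (fun y => c' * local_mean mu U F y) x)); last first.
  by apply: opc_le => //; [exact: bmfZ|move=> y; exact: Uc'].
rewrite /opc meanZ; last exact: bmf_mull.
rewrite -mulrA ler_wpM2l ?(ltW c'0)//.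
have bFx : bmf (fun w : borel G => F (x ** w)) by exact: bmf_mull.
have -> : \int[cpow sc nu n]_y local_mean mu U F (x ** y) =
  \int[cpow sc nu n]_z \int[mu]_w (\1_(U : set (borel G)) (z ^- ** w) * F (x ** w)).
  apply: mean_ext => z; rewrite /local_mean.
  have b1 : bmf (fun w : borel G => \1_(U : set (borel G)) (z ^- ** w) * F (x ** w)).
    by apply: bmfM; [exact: (bmf_mull (z ^-) (bmf_indic mU))|exact: bmf_mull].
  rewrite -(haar_mull haar z b1); apply: mean_ext => w.
  by rewrite mulKg mulgA.
rewrite (mean_swap _ _ (h := fun z : (borel G * borel G)%type =>
   \1_(U : set (borel G)) (z.1 ^- ** z.2) * F (x ** z.2))) /=; last first.
  apply: bmfM.
    apply: (bmf_comp (bmf_indic mU)); apply: measurable_mul_fun => //.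
    exact: measurable_inv_fun.
  by apply: (bmf_comp bF); apply: measurable_mul_fun => //; exact: measurable_cst.
rewrite -(haar_mull haar x bF) -meanZ//.
have hitE (w : borel G) : \int[cpow sc nu n]_z (\1_(U : set (borel G)) (z ^- ** w) * F (x ** w)) =
   F (x ** w) * hitting n U w.
  rewrite -meanZ; last exact: bmf_hitting_section.
  by apply: mean_ext => z; rewrite mulrC.
have bhit : bmf (hitting n U).
  apply: (bmf_mean (cpow sc nu n) (h := fun z : (borel G * borel G)%type =>
     \1_(U : set (borel G)) (z.2 ^- ** z.1))).
  apply: (bmf_comp (bmf_indic mU)); apply: measurable_mul_fun => //.
  exact: measurable_inv_fun.
rewrite [leRHS](mean_ext mu hitE).
apply: mean_le; [exact: bmfZ|exact: bmfM|].
by move=> w; rewrite mulrC ler_wpM2l.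
Qed.

End doeblin_minorization.

(** * Poisson's equation *)

Lemma geometric_bound_cvg (R : realType) (a : nat -> R) (M rho : R) :
  0 <= rho < 1 -> (forall i, `|a i| <= M * rho ^+ i) ->
  exists2 l, (\sum_(i < N) a i) @[N --> \oo] --> l &
    forall N, `|l - \sum_(i < N) a i| <= M / (1 - rho) * rho ^+ N.
Proof.
move=> /andP[rho0 rho1] aM.
have M0 : 0 <= M by have := aM 0%N; rewrite expr0 mulr1; exact: le_trans.
have r1 : 0 < 1 - rho by rewrite subr_gt0.
have cs : cvgn (series a).
  apply: normed_cvg; apply: (@series_le_cvg _ _ (geometric M rho)).
  - by move=> n /=.
  - by move=> n /=; rewrite mulr_ge0// exprn_ge0.
  - by move=> n /=; exact: aM.
  - by apply: is_cvg_geometric_series; rewrite ger0_norm.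
have sE N : series a N = \sum_(i < N) a i by rewrite /series /= big_mkord.
have cl : (\sum_(i < N) a i) @[N --> \oo] --> limn (series a).
  by rewrite (_ : (fun N => _) = series a)//; apply/funext => N; rewrite sE.
exists (limn (series a)) => // N.
have step j : `|\sum_(i < j + N) a i - \sum_(i < N) a i| <=
    M / (1 - rho) * rho ^+ N * (1 - rho ^+ j).
  elim: j => [|j IH]; first by rewrite add0n subrr normr0 expr0 subrr mulr0.
  rewrite addSn big_ord_recr /= addrAC.
  rewrite (le_trans (ler_normD _ _))//.
  have -> : M / (1 - rho) * rho ^+ N * (1 - rho ^+ j.+1) =
    M / (1 - rho) * rho ^+ N * (1 - rho ^+ j) + M * rho ^+ (j + N).
    by rewrite exprS exprD; field; rewrite gt_eqF.
  by rewrite lerD.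
have cN : (\sum_(i < j + N) a i) @[j --> \oo] --> limn (series a).
  by have := cl; rewrite -(cvg_shiftn N).
have cn : `|\sum_(i < j + N) a i - \sum_(i < N) a i| @[j --> \oo] -->
    `|limn (series a) - \sum_(i < N) a i|.
  by apply: cvg_norm; apply: cvgB => //; exact: cvg_cst.
rewrite -(cvg_lim _ cn)//; apply: limr_le; first by apply/cvg_ex; eexists; exact: cn.
apply: nearW => j; rewrite (le_trans (step j))// -[leRHS]mulr1 ler_wpM2l//.
  by rewrite mulr_ge0 ?exprn_ge0// divr_ge0// ltW.
by rewrite gerBl exprn_ge0.
Qed.

Section poisson.
Context {R : realType} {G : topologicalGroupType}.
Hypothesis sc : @second_countable G.
Variables mu : probability (borel G) R.
Hypothesis haar : normalized_haar mu.
Implicit Types (f g h : borel G -> R) (m nu : probability (borel G) R).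

Lemma iter_opc_sum nu N (h : nat -> borel G -> R) : (forall i, bmf (h i)) ->
  opc nu (fun x => \sum_(i < N) h i x) = fun x => \sum_(i < N) opc nu (h i) x.
Proof.
move=> bh; elim: N => [|N IH].
  rewrite (_ : (fun x => _) = fun=> 0); last by apply/funext => x; rewrite big_ord0.
  by rewrite opc_cst; apply/funext => x; rewrite big_ord0.
rewrite (_ : (fun x => _) = fun x => \sum_(i < N) h i x + h N x); last first.
  by apply/funext => x; rewrite big_ord_recr.
by rewrite opcD ?IH//; [apply/funext => x; rewrite big_ord_recr|exact: bmf_sum].
Qed.

Lemma mean_iter_opc nu n h : bmf h ->
  \int[mu]_x iter n (opc nu) h x = \int[mu]_x h x.
Proof.
move=> bh; elim: n => //= n IH.
by rewrite mean_opc//; exact: bmf_iter_opc.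
Qed.

Definition mean_contraction m (rho : R) := forall f M, bmf f ->
  \int[mu]_x f x = 0 -> (forall x, `|f x| <= M) ->
  forall x, `|opc m f x| <= M * rho.

Lemma iter_contraction m rho f M n : mean_contraction m rho -> bmf f ->
  \int[mu]_x f x = 0 -> (forall x, `|f x| <= M) ->
  forall x, `|iter n (opc m) f x| <= M * rho ^+ n.
Proof.
move=> cm bf f0 fM; elim: n => [x|n IH x]; first by rewrite expr0 mulr1.
rewrite exprSr mulrA; apply: cm => //; first exact: bmf_iter_opc.
by rewrite mean_iter_opc.
Qed.

(** h is the Neumann series of iterates of f. Its truncation error is uniform in x, so both the mean
    of h and the defect f - (h - P h), with P the operator of [m], are at most a multiple of rho^N
    for every N, hence zero. *)
Lemma poisson_contraction m rho f : 0 <= rho < 1 -> mean_contraction m rho ->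
  bmf f -> \int[mu]_x f x = 0 ->
  exists h, [/\ bmf h, \int[mu]_x h x = 0 & forall x, f x = h x - opc m h x].
Proof.
move=> rho01 cm bf f0; have [M M0 fM] := bmf_bound bf.
have [rho0 rho1] := andP rho01.
have bi i : bmf (iter i (opc m) f) by exact: bmf_iter_opc.
have lim_ x := geometric_bound_cvg rho01 (fun i => iter_contraction i cm bf f0 fM x).
pose h x := sval (cid2 (lim_ x)).
have hcvg x : (\sum_(i < N) iter i (opc m) f x) @[N --> \oo] --> h x.
  by rewrite /h; case: cid2.
have hbound N x : `|h x - \sum_(i < N) iter i (opc m) f x| <= M / (1 - rho) * rho ^+ N.
  by rewrite /h; case: cid2.
set K := M / (1 - rho) in hbound.
pose s N x := \sum_(i < N) iter i (opc m) f x.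
have bs N : bmf (s N) by exact: bmf_sum.
have bh : bmf h.
  split; last by exists K => x; have := hbound 0%N x; rewrite big_ord0 subr0 expr0 mulr1.
  apply: (@measurable_fun_cvg _ _ _ _ s) => [N|x _]; first exact: bmf_meas (bs N).
  exact: hcvg.
have small (y : R) : (forall N, `|y| <= 2 * K * rho ^+ N) -> y = 0.
  move=> yK; apply/eqP; rewrite -normr_le0.
  have c0 : 2 * K * rho ^+ N @[N --> \oo] --> 2 * K * 0.
    by apply: cvgMr; apply: cvg_expr; rewrite ger0_norm.
  rewrite mulr0 in c0; rewrite -(cvg_lim _ c0)//.
  by apply: limr_ge; [apply/cvg_ex; eexists; exact: c0|exact: nearW].
have K0 : 0 <= K by rewrite divr_ge0 ?subr_ge0// ltW.
have Kle N : K * rho ^+ N <= 2 * K * rho ^+ N.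
  by rewrite -mulrA mulr_natl mulr2n lerDl mulr_ge0// exprn_ge0.
exists h; split => //.
  apply: small => N.
  have s0 : \int[mu]_x s N x = 0.
    elim: N => [|N IH].
      by apply: mean_constant => x; rewrite /s big_ord0.
    rewrite (@mean_ext _ _ _ _ _ (fun x => s N x + iter N (opc m) f x)).
      by rewrite meanD// IH mean_iter_opc// f0 addr0.
    by move=> x; rewrite /s big_ord_recr.
  rewrite -[X in `|X|]subr0 -s0 -meanB// (le_trans _ (Kle N))//.
  by apply: mean_bound; [exact: bmfB|exact: hbound].
move=> x; apply/eqP; rewrite -subr_eq0; apply/eqP; apply: small => N.
have sS : opc m (s N) x = s N.+1 x - f x.
  rewrite /s iter_opc_sum// big_ord_recl /= addrC addKr.
  by apply: eq_bigr => i _.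
have -> : f x - (h x - opc m h x) =
   opc m (fun y => h y - s N y) x - (h x - s N.+1 x).
  by rewrite opcB// sS; ring.
rewrite (le_trans (ler_normB _ _))// -mulrA mulr_natl mulr2n lerD//.
  by apply: opc_bound; [exact: bmfB|exact: hbound].
rewrite (le_trans (hbound _ _))// ler_wpM2l// ler_wiXn2l// ltW//.
Qed.

(** Apply the minorization to the nonnegative functions M + f and M - f, both of mean M: subtracting
    c M leaves the bound (1 - c) M. The constant function 1 shows c <= 1. *)
Lemma doeblin_contraction nu n c : 0 < c ->
  (forall F, bmf F -> (forall x, 0 <= F x) ->
   forall x, c * \int[mu]_y F y <= iter n (opc nu) F x) ->
  0 <= 1 - c < 1 /\ mean_contraction (cpow sc nu n) (1 - c).
Proof.
move=> c0 D.
have D' F : bmf F -> (forall x, 0 <= F x) ->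
   forall x, c * \int[mu]_y F y <= opc (cpow sc nu n) F x.
  by move=> bF F0 x; rewrite opc_cpow//; exact: D.
split.
  rewrite gtrBl c0 andbT subr_ge0.
  have := @D' (fun=> 1) (bmf_cst _ _) (fun=> ler01) point.
  by rewrite mean_cst mulr1 opc_cst.
move=> f M bf f0 fM x; rewrite ler_norml; apply/andP; split.
  have := D' (fun x => M + f x) (bmfD (bmf_cst _ M) bf).
  rewrite meanD ?opcD//; [|exact: bmf_cst..]; rewrite f0 mean_cst opc_cst => /(_ _ x) h.
  have : c * (M + 0) <= M + opc (cpow sc nu n) f x.
    by apply: h => y; have := fM y; rewrite ler_norml => /andP[? _]; lra.
  by lra.
have := D' (fun x => M - f x) (bmfB (bmf_cst _ M) bf).
rewrite meanB ?opcB//; [|exact: bmf_cst..]; rewrite f0 mean_cst opc_cst => /(_ _ x) h.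
have : c * (M - 0) <= M - opc (cpow sc nu n) f x.
  by apply: h => y; have := fM y; rewrite ler_norml => /andP[_ ?]; lra.
by lra.
Qed.

End poisson.

(** * Positivity of the variance *)

Section variance.
Context {R : realType} {G : topologicalGroupType}.
Hypothesis sc : @second_countable G.
Variables mu nu : probability (borel G) R.
Hypotheses (haar : normalized_haar mu) (nu_central : central nu).
Local Notation "x ** y" := ((x : G) * (y : G))%g (at level 40).
Local Notation P := (opc nu).
Implicit Types (f g h : borel G -> R).

Definition step_variance g : borel G -> R :=
  fun x => \int[nu]_y ((g (x ** y) - P g x) ^+ 2).

Lemma step_varianceE g : bmf g ->
  step_variance g = fun x => P (fun y => g y ^+ 2) x - P g x ^+ 2.
Proof.
move=> bg; apply/funext => x; rewrite /step_variance /opc.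
set e := \int[nu]_y g (x ** y).
have bgx : bmf (fun y : borel G => g (x ** y)) by exact: bmf_mull.
transitivity (\int[nu]_y (g (x ** y) ^+ 2 + ((- 2 * e) * g (x ** y) + e ^+ 2))).
  by apply: mean_ext => y; ring.
rewrite meanD; [|exact: bmfX|by apply: bmfD; [exact: bmfZ|exact: bmf_cst]].
rewrite meanD; [|exact: bmfZ|exact: bmf_cst].
by rewrite meanZ// mean_cst -/e; ring.
Qed.

Lemma bmf_step_variance g : bmf g -> bmf (step_variance g).
Proof.
move=> bg; rewrite step_varianceE//; apply: bmfB.
  by apply: bmf_opc => //; exact: bmfX.
by apply: bmfX; exact: bmf_opc.
Qed.

Lemma mean_step_variance g : bmf g -> \int[mu]_x step_variance g x =
  \int[mu]_x (g x ^+ 2) - \int[mu]_x (P g x ^+ 2).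
Proof.
move=> bg; rewrite step_varianceE// meanB; last 2 first.
- by apply: bmf_opc => //; exact: bmfX.
- by apply: bmfX; exact: bmf_opc.
by rewrite mean_opc//; exact: bmfX.
Qed.

(* By centrality P commutes with right translations, so that the martingale
   difference of P g at (x, y) is the mean over z of that of g at (x z, y). *)
Lemma step_variance_opc g x : bmf g ->
  step_variance (P g) x <= P (step_variance g) x.
Proof.
move=> bg; have bPg := bmf_opc sc nu bg.
pose d (z y : borel G) : R := g (x ** z ** y) - P g (x ** z).
have bd : bmf (fun p : (borel G * borel G)%type => d p.2 p.1).
  have m2 : measurable_fun setT
      ((fun p => x ** p.2) : (borel G * borel G)%type -> borel G).
    by apply: measurable_mul_fun => //; exact: measurable_cst.
  apply: bmfB; last exact: (bmf_comp bPg m2).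
  by apply: (bmf_comp bg); apply: measurable_mul_fun.
have dE y : P g (x ** y) - P (P g) x = \int[nu]_z d z y.
  rewrite meanB; [|exact: (bmf_mull x (bmf_mulr y bg))|exact: (bmf_mull x bPg)].
  congr (_ - _); rewrite /opc.
  transitivity (\int[nu]_z g (x ** (y ** z))).
    by apply: mean_ext => z; rewrite mulgA.
  rewrite [LHS](central_comm sc y nu_central (bmf_mull x bg)).
  by apply: mean_ext => z; rewrite mulgA.
have bd2 : bmf (fun p : (borel G * borel G)%type => d p.2 p.1 ^+ 2) by exact: bmfX.
rewrite /step_variance [leRHS]/opc.
rewrite -(mean_swap nu nu bd2); apply: mean_le.
- apply: bmfX; apply: bmfB; last exact: bmf_cst.
  exact: bmf_mull.
- exact: (bmf_mean nu bd2).
move=> y; rewrite dE; apply: mean_sqr_le.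
exact: (bmf_sectionr y bd).
Qed.

Lemma mean_step_variance_ge0 g : 0 <= \int[mu]_x step_variance g x.
Proof. by apply: mean_ge0 => x; apply: mean_ge0 => y; exact: sqr_ge0. Qed.

Lemma step_variance_eq0 g n (rho : R) : 0 <= rho < 1 ->
  mean_contraction mu (cpow sc nu n) rho ->
  bmf g -> \int[mu]_x g x = 0 -> \int[mu]_x step_variance g x = 0 ->
  \int[mu]_x (g x ^+ 2) = 0.
Proof.
move=> /andP[rho0 rho1] cm bg g0 Dg.
have bP k : bmf (iter k P g) by exact: bmf_iter_opc.
have D0 k : \int[mu]_x step_variance (iter k P g) x = 0.
  elim: k => [|k IH]; first exact: Dg.
  apply/eqP; rewrite eq_le mean_step_variance_ge0 andbT -IH.
  rewrite -[leRHS](mean_opc sc nu haar (bmf_step_variance (bP k))).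
  apply: mean_le => [||x].
  - by apply: bmf_step_variance; exact: (bP k.+1).
  - by apply: bmf_opc => //; apply: bmf_step_variance; exact: bP.
  - by rewrite iterS; apply: step_variance_opc; exact: bP.
have NP k : \int[mu]_x (iter k P g x ^+ 2) = \int[mu]_x (g x ^+ 2).
  elim: k => [|k <-]; first by [].
  apply/eqP; rewrite eq_sym -subr_eq0; apply/eqP.
  by rewrite -(D0 k) mean_step_variance; [|exact: bP].
have [M M0 gM] := bmf_bound bg.
have bound k : \int[mu]_x (g x ^+ 2) <= M ^+ 2 * (rho ^+ 2) ^+ k.
  (* The contraction is known for P^n only, so the norm is evaluated along multiples of n. *)
  rewrite -(NP (k * n)%N).
  have kb x : iter (k * n) P g x ^+ 2 <= M ^+ 2 * (rho ^+ 2) ^+ k.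
    have -> : iter (k * n) P g = iter k (opc (cpow sc nu n)) g.
      elim: k => // k IH; rewrite mulSn iterD IH /= opc_cpow//.
      exact: bmf_iter_opc.
    have Xb := iter_contraction sc haar k cm bg g0 gM x.
    rewrite exprAC -exprMn -[leLHS](ger0_norm (sqr_ge0 _)) normrX.
    by rewrite lerXn2r ?nnegrE// mulr_ge0 ?exprn_ge0// ltW.
  rewrite -[leRHS](mean_cst mu); apply: mean_le => //; [exact: bmfX|exact: bmf_cst].
have c0 : M ^+ 2 * (rho ^+ 2) ^+ k @[k --> \oo] --> M ^+ 2 * 0.
  apply: cvgMr; apply: cvg_expr; rewrite ger0_norm ?sqr_ge0//.
  by rewrite expr_lt1.
rewrite mulr0 in c0; apply/eqP; rewrite eq_le; apply/andP; split.
  rewrite -(cvg_lim _ c0)//.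
  by apply: limr_ge; [apply/cvg_ex; eexists; exact: c0|exact: nearW].
by apply: mean_ge0 => x; exact: sqr_ge0.
Qed.

Lemma mean_sqr_eq0_ae f : bmf f -> \int[mu]_x (f x ^+ 2) = 0 ->
  {ae mu, forall x, f x = 0}.
Proof.
move=> bf f0; have bf2 := bmfX 2 bf.
have mf2 : measurable_fun setT (fun x => (f x ^+ 2)%:E).
  by apply/measurable_EFinP; exact: bmf_meas bf2.
have : ae_eq mu setT (fun x => (f x ^+ 2)%:E) (cst 0%E).
  apply/ae_eq_integral_abs => //.
  transitivity (\int[mu]_x (f x ^+ 2)%:E)%E.
    by apply: eq_integral => x _; rewrite gee0_abs// lee_fin sqr_ge0.
  by rewrite -bmf_EFin// f0.
apply: filterS => x /(_ Logic.I) /= [] /eqP.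
by rewrite sqrf_eq0 => /eqP.
Qed.

Lemma step_variance_gt0 g n (rho : R) : 0 <= rho < 1 ->
  mean_contraction mu (cpow sc nu n) rho ->
  bmf g -> \int[mu]_x g x = 0 -> ~ {ae mu, forall x, g x - P g x = 0} ->
  0 < \int[mu]_x step_variance g x.
Proof.
move=> rho01 cm bg g0 nae; have bP := bmf_opc sc nu bg.
rewrite lt_neqAle mean_step_variance_ge0 andbT eq_sym; apply/eqP => D0.
apply: nae; apply: mean_sqr_eq0_ae; first exact: bmfB.
have N0 := step_variance_eq0 rho01 cm bg g0 D0.
have NP0 : \int[mu]_x (P g x ^+ 2) = 0.
  by move: D0; rewrite mean_step_variance// N0 sub0r => /eqP; rewrite oppr_eq0 => /eqP.
apply/eqP; rewrite eq_le; apply/andP; split; last first.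
  by apply: mean_ge0 => x; exact: sqr_ge0.
apply: (@le_trans _ _ (\int[mu]_x (2 * (g x ^+ 2) + 2 * (P g x ^+ 2)))).
  apply: mean_le => [||x]; [by apply: bmfX; exact: bmfB| |].
    by apply: bmfD; apply: bmfZ; exact: bmfX.
  by have := sqr_ge0 (g x + P g x); lra.
rewrite meanD; [|by apply: bmfZ; exact: bmfX..].
by rewrite !meanZ; [rewrite N0 NP0 !mulr0 addr0|exact: bmfX..].
Qed.

End variance.

(** * The two implications *)

Section clt.
Context {R : realType} {G : topologicalGroupType}.
Hypothesis sc : @second_countable G.
Variables mu nu : probability (borel G) R.
Hypotheses (haar : normalized_haar mu) (nu_central : central nu).
Local Notation "x ** y" := ((x : G) * (y : G))%g (at level 40).
Local Notation P := (opc nu).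
Implicit Types (f g h : borel G -> R).

(** Only P^n contracts, so solve f = h - P^n h and put g = h + P h + ... + P^(n-1) h; then g - P g
    telescopes to h - P^n h. *)
Lemma poisson_equation n (rho : R) f : 0 <= rho < 1 ->
  mean_contraction mu (cpow sc nu n) rho ->
  bmf f -> \int[mu]_x f x = 0 ->
  exists g, [/\ bmf g, \int[mu]_x g x = 0 & forall x, f x = g x - P g x].
Proof.
move=> rho01 cm bf f0.
have [h [bh h0 fh]] := poisson_contraction sc haar rho01 cm bf f0.
have bi i : bmf (iter i P h) by exact: bmf_iter_opc.
exists (fun x => \sum_(i < n) iter i P h x); split; first exact: bmf_sum.
  elim: n {cm fh} => [|n IH]; first by apply: mean_constant => x; rewrite big_ord0.
  transitivity (\int[mu]_x (\sum_(i < n) iter i P h x + iter n P h x)).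
    by apply: mean_ext => x; rewrite big_ord_recr.
  by rewrite meanD; [rewrite IH mean_iter_opc// h0 addr0|exact: bmf_sum|].
move=> x; rewrite iter_opc_sum// fh opc_cpow// -sumrB.
have -> : \sum_(i < n) (iter i P h x - P (iter i P h) x) =
  \sum_(i < n) (iter i P h x - iter i.+1 P h x) by [].
elim: n {cm fh} => [|n IH]; first by rewrite big_ord0 /= subrr.
by rewrite big_ord_recr /= -IH addrA subrK.
Qed.

Section process.
Variables (f g : borel G -> R) (C : R).
Hypotheses (bf : bmf f) (bg : bmf g) (fE : forall x, f x = g x - P g x).
Context d (Omega : measurableType d) (Pr : probability Omega R).
Variable Y : nat -> {RV Pr >-> borel G}.

(** The increment g(S_(k+1)) - P g(S_k) equals f(S_(k+1)) plus the increment of P g along the walk;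
    the latter sums to a bounded boundary term. *)
Lemma martingale_processE k o :
  martingale_process nu (@mulb G) g Y (1%g : borel G) k o =
  (partial_product Y k o : borel G,
   \sum_(1 <= i < k.+1) f (partial_product Y i o)
     + P g (partial_product Y k o) - P g 1%g).
Proof.
elim: k => [|k IH].
  by rewrite big_geq// add0r /partial_product big_ord0 subrr.
have SE : partial_product Y k.+1 o = (partial_product Y k o * (Y k o : G))%g.
  by rewrite /partial_product big_ord_recr.
have -> : martingale_process nu (@mulb G) g Y (1%g : borel G) k.+1 o =
  martingale_step nu (@mulb G) g (martingale_process nu (@mulb G) g Y (1%g : borel G) k o, Y k o) by [].
rewrite IH /martingale_step /= /mulb /= -SE; congr (_, _).
rewrite [in RHS]big_nat_recr//= fE /martingale_diff.
rewrite -[act_mean _ _ _ _]/(P g (partial_product Y k o)) /mulb /= -SE.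
by ring.
Qed.

End process.

Lemma measurable_partial_product d (Omega : measurableType d)
    (Pr : probability Omega R) (Y : nat -> {RV Pr >-> borel G}) k :
  measurable_fun setT (partial_product Y k : Omega -> borel G).
Proof.
elim: k => [|k IH].
  rewrite (_ : (partial_product Y 0 : Omega -> borel G) = cst (1%g : borel G)).
    exact: measurable_cst.
  by apply/funext => o; rewrite /partial_product big_ord0.
rewrite (_ : (partial_product Y k.+1 : Omega -> borel G) =
  (fun o => partial_product Y k o ** Y k o)); first exact: measurable_mul_fun.
by apply/funext => o; rewrite /partial_product big_ord_recr.
Qed.

Lemma clt n (rho : R) f : 0 <= rho < 1 ->
  mean_contraction mu (cpow sc nu n) rho ->
  bmf f -> \int[mu]_x f x = 0 -> ~ {ae mu, forall x, f x = 0} ->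
  exists2 C : R, 0 < C &
    forall d (Omega : measurableType d) (Pr : probability Omega R)
      (Y : nat -> {RV Pr >-> borel G}), iid Y nu ->
    cvg_in_distribution Pr
      (fun N w => (\sum_(1 <= k < N.+1) f (partial_product Y k w))
                      / Num.sqrt (C * N%:R))
          (normal_prob 0 1).
Proof.
move=> rho01 cm bf f0 fae.
have [g [bg g0 fE]] := poisson_equation rho01 cm bf f0.
pose C := \int[mu]_x step_variance nu g x.
have C0 : 0 < C.
  apply: (step_variance_gt0 haar nu_central rho01 cm bg g0) => h; apply: fae.
  by apply: filterS h => x; rewrite fE.
have bv := bmf_step_variance sc nu bg.
have bvC : bmf (fun x => step_variance nu g x - C) by apply: bmfB => //; exact: bmf_cst.
(* The conditional variance minus its mean C is again bounded with mean zero, so the same equation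
   yields the corrector. *)
have [|w [bw _ wE]] := poisson_equation rho01 cm bvC.
  by rewrite meanB//; [rewrite mean_cst subrr|exact: bmf_cst].
have [W W0 wW] := bmf_bound bw.
have bP := bmf_opc sc nu bg.
have [D1 D10 gD] := bmf_bound bg; have [D2 D20 PgD] := bmf_bound bP.
exists C => // d Omega Pr Y Y_iid t _.
pose T N o := \sum_(1 <= k < N.+1) f (partial_product Y k o).
have mT N : measurable_fun setT (T N).
  apply: measurable_sum => k.
  exact: (measurableT_comp (bmf_meas bf) (measurable_partial_product Y k)).
have mZ N : measurable_fun setT (fun o => T N o / Num.sqrt (C * N%:R)).
  by apply: measurable_funM => //; exact: measurable_cst.
apply: (heat_cdf_cvg mZ) => sigma {}t s0.
have dD (x y : borel G) : `|martingale_diff nu (@mulb G) g x y| <= D1 + D2.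
  by rewrite (le_trans (ler_normB _ _))// lerD//; exact: PgD.
have heatM := @martingale_heat_cvg _ _ _ nu _ _ (@mulb G) (measurable_mulb sc)
  g w C (D1 + D2) W bg bw C0 dD wW wE sigma t s0 _ _ Pr Y (1%g : borel G) Y_iid.
rewrite -(cvg_shiftS (fun N => \int[Pr]_o heat sigma t 0 (T N o / Num.sqrt (C * N%:R)))).
have CN0 N : 0 < (Num.sqrt (C * N.+1%:R))^-1 by rewrite invr_gt0 sqrtr_gt0 mulr_gt0.
have K0 := heat_const_gt0 s0.
have mV N : measurable_fun setT (martingale_process nu (@mulb G) g Y (1%g : borel G) N).
  apply: measurable_driven.
  exact: (measurable_martingale_step nu (measurable_mulb sc) bg).
have bheat (Z : Omega -> R) : measurable_fun setT Z -> bmf (fun o => heat sigma t 0 (Z o)).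
  move=> mZ'; apply: (bmf_continuous_comp (M := 1)) mZ'; first exact: heat_continuous.
  by move=> x; rewrite ger0_norm ?Phi_ge0 ?Phi_le1.
(* The heat function is Lipschitz and the sum differs from the martingale by at most 2 D2, which
   disappears after division by the square root of C N. *)
have close N : `|\int[Pr]_o heat sigma t 0
      ((martingale_process nu (@mulb G) g Y (1%g : borel G) N.+1 o).2
        / Num.sqrt (C * N.+1%:R)) -
    \int[Pr]_o heat sigma t 0 (T N.+1 o / Num.sqrt (C * N.+1%:R))| <=
    heat_const sigma * (D2 + D2) * (Num.sqrt (C * N.+1%:R))^-1.
  have bV : bmf (fun o => heat sigma t 0
      ((martingale_process nu (@mulb G) g Y (1%g : borel G) N.+1 o).2
        / Num.sqrt (C * N.+1%:R))).
    apply: bheat; apply: measurable_funM; last exact: measurable_cst.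
    exact: (measurableT_comp measurable_snd (mV N.+1)).
  have bT : bmf (fun o => heat sigma t 0 (T N.+1 o / Num.sqrt (C * N.+1%:R))).
    exact: bheat (mZ N.+1).
  rewrite -meanB//; apply: mean_bound => [|o]; first exact: bmfB.
  rewrite (le_trans (heat_lipschitz _ s0 _ _ (lexx 0)))// -mulrA ler_wpM2l ?(ltW K0)//.
  rewrite (martingale_processE fE) /= -mulrBl normrM (gtr0_norm (CN0 N)).
  rewrite ler_wpM2r ?(ltW (CN0 N))// -/(T N.+1 o).
  have -> : T N.+1 o + P g (partial_product Y N.+1 o) - P g 1%g - T N.+1 o =
    P g (partial_product Y N.+1 o) - P g 1%g by ring.
  by rewrite (le_trans (ler_normB _ _))// lerD//; exact: PgD.
have small : heat_const sigma * (D2 + D2) * (Num.sqrt (C * N.+1%:R))^-1 @[N --> \oo] -->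
    heat_const sigma * (D2 + D2) * Num.sqrt (C^-1 * 0).
  apply: cvgMr.
  rewrite (_ : (fun N => _) = fun N => Num.sqrt (C^-1 * N.+1%:R^-1)); last first.
    apply/funext => N; rewrite -invfM mulrC sqrtrV//.
    by rewrite mulr_ge0// ltW.
  apply: (@cvg_comp _ _ _ (fun N => C^-1 * N.+1%:R^-1) Num.sqrt); last exact: sqrt_continuous.
  by apply: cvgMr; exact: cvg_harmonic.
rewrite mulr0 sqrtr0 mulr0 in small.
apply/cvgrPdist_le => e e0; have e2 : 0 < e / 2 by rewrite divr_gt0.
have /cvgrPdist_le/(_ _ e2) := heatM; have /cvgrPdist_le/(_ _ e2) := small.
apply: filterS2 => N; rewrite sub0r normrN => sN hN.
rewrite [e]splitr; apply: le_trans (ler_distD _ _ _) (lerD hN _).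
by rewrite (le_trans (close N))// (le_trans (ler_norm _)).
Qed.

End clt.

(** * The converse: admissible functions with deterministic sums *)

Lemma normal_cdf_continuous (R : realType) (t : R) :
  {for t, continuous (fun s : R => normal_prob 0 1 `]-oo, s]%classic : \bar R)}.
Proof.
rewrite (_ : (fun s => _) = fun s => (Phi s)%:E); last first.
  by apply/funext => s; rewrite PhiE.
by apply: cvg_EFin; [exact: nearW|exact: Phi_continuous].
Qed.

(** At t = 0 the distribution function of a deterministic variable is 0 or 1, while Phi 0 lies
    strictly in between. *)
Lemma cvg_in_distribution_normal_deterministic d (Omega : measurableType d)
    (R : realType) (P : probability Omega R) (Z : nat -> Omega -> R) (z : nat -> R)
    (E : set Omega) :
  measurable E -> P (~` E) = 0%E -> (forall N, measurable_fun setT (Z N)) ->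
  (forall N o, E o -> Z N o = z N) ->
  ~ cvg_in_distribution P Z (normal_prob 0 1).
Proof.
have c0 := @normal_cdf_continuous R 0.
move=> mE E0 mZ Zz /(_ 0 c0); rewrite -PhiE.
have P01 N : P [set o | Z N o <= 0] = ((z N <= 0)%R%:R : R)%:E.
  have mZ0 : measurable [set o | Z N o <= 0].
    rewrite (_ : [set o | _] = Z N @^-1` `]-oo, 0]); last first.
      by apply/seteqP; split => o /=; rewrite in_itv.
    by rewrite -[X in measurable X]setTI; apply: mZ.
  have [z0|z0] := boolP (z N <= 0).
    have PE : P E = 1%E by rewrite -[E]setCK probability_setC ?E0 ?sube0//; exact: measurableC.
    apply/eqP; rewrite eq_le probability_le1//= -PE.
    by apply: le_measure; rewrite ?inE// => o Eo /=; rewrite Zz.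
  transitivity (0 : \bar R)%E; last by [].
  apply/eqP; rewrite eq_le measure_ge0 andbT -E0.
  apply: le_measure; rewrite ?inE//; first exact: measurableC.
  by move=> o /= Zo Eo; rewrite Zz// (negbTE z0) in Zo.
rewrite (_ : (fun N => _) = fun N => ((z N <= 0)%R%:R : R)%:E); last first.
  by apply/funext => N; rewrite P01.
move=> /fine_cvgP[_] /cvgrPdist_lt cz.
have p0 := @Phi_gt0 R 0; have p1 := @Phi_lt1 R 0.
have m0 : 0 < Num.min (Phi 0) (1 - Phi 0) :> R by rewrite lt_min p0 subr_gt0.
have [N _ /(_ N (leqnn _))] := cz _ m0.
rewrite /= lt_min => /andP[]; case: (z N <= 0).
  by rewrite distrC gtr0_norm ?subr_gt0// ltxx.
by rewrite subr0 gtr0_norm// ltxx.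
Qed.

(* Off a null set of maximal [m]-measure, [m] is absolutely continuous. *)
Lemma maximal_null_set d (T : measurableType d) (R : realType)
    (m mu : probability T R) :
  exists2 A, measurable A & mu A = 0%E /\
    (forall B, measurable B -> mu B = 0%E -> m (B `\` A) = 0%E).
Proof.
pose S := [set fine (m B) | B in [set B | measurable B /\ mu B = 0%E]].
have fm B : measurable B -> m B = (fine (m B))%:E.
  by move=> mB; rewrite fineK// fin_num_measure.
have S0 : S !=set0 by exists (fine (m set0)), set0.
have Sub : has_ubound S.
  exists 1 => _ [B [mB _] <-]; rewrite -lee_fin -fm//; exact: probability_le1.
have hS : has_sup S by [].
(* The supremum of the masses of null sets is attained: the union of null sets that nearly reach it
   is still null. *)
have /choice[B hB] n : exists B, [/\ measurable B, mu B = 0%E &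
    sup S - n.+1%:R^-1 < fine (m B)].
  have n0 : 0 < n.+1%:R^-1 :> R by [].
  have [_ [B [mB B0] <-] sB] := sup_adherent n0 hS.
  by exists B.
have mB n : measurable (B n) by have [] := hB n.
have mA : measurable (\bigcup_n B n) by exact: bigcup_measurable.
have A0 : mu (\bigcup_n B n) = 0%E.
  by apply: measure_bigcup_eq0 => // n; have [] := hB n.
have supA : sup S <= fine (m (\bigcup_n B n)).
  apply/ler_addgt0Pr => e /ltr_add_invr[n]; rewrite add0r => ne.
  rewrite -lerBlDr; have [_ _ hn] := hB n.
  have : fine (m (B n)) <= fine (m (\bigcup_n B n)).
    rewrite -lee_fin -!fm//; apply: le_measure; rewrite ?inE//.
    exact: bigcup_sup.
  by move=> Bu; rewrite (le_trans _ Bu)// (le_trans _ (ltW hn))// lerB// ltW.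
exists (\bigcup_n B n) => //; split => // D mD D0.
have mDA : measurable (D `\` \bigcup_n B n) by exact: measurableD.
have mU : measurable (D `|` \bigcup_n B n) by exact: measurableU.
have le1 : fine (m (D `|` \bigcup_n B n)) <= sup S.
  apply: sup_upper_bound => //; exists (D `|` \bigcup_n B n) => //; split => //.
  exact: null_set_setU.
have : m (D `|` \bigcup_n B n) = (m (D `\` \bigcup_n B n) + m (\bigcup_n B n))%E.
  rewrite -measureU//; last by rewrite setDKI.
  congr (m _); apply/seteqP; split => x; last by move=> [[? _]|?]; [left|right].
  move=> [Dx|Ux]; last by right.
  by have [?|?] := pselect ((\bigcup_n B n) x); [right|left].
rewrite (fm _ mU) (fm _ mDA) (fm _ mA) -EFinD => -[e1].
have : 0 <= fine (m (D `\` \bigcup_n B n)) by rewrite fine_ge0.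
by move=> ?; rewrite (fm _ mDA); congr EFin; lra.
Qed.

Section converse.
Context {R : realType} {G : topologicalGroupType}.
Hypothesis sc : @second_countable G.
Hypothesis cG : compact [set: G].
Variables mu nu : probability (borel G) R.
Hypothesis haar : normalized_haar mu.
Local Notation S := (measure_support nu).

Lemma haar_open_gt0 (U : set G) : open U -> U !=set0 -> (0 < mu U)%E.
Proof.
move=> oU [u Uu]; rewrite lt0e measure_ge0 andbT; apply/eqP => U0.
pose Ux (x : G) : set G := [set y | U (u * (x^-1 * y))%g].
have oUx x : open (Ux x).
  apply: open_comp => // y _; apply: mulg_continuous2; first by move=> ?; exact: cvg_cst.
  by apply: mulg_continuous2 => ? //; exact: cvg_cst.
have [D _ DG] : finite_subset_cover [set: G] Ux [set: G].
  move: cG; rewrite compact_cover; apply=> // x _.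
  by exists x => //; rewrite /Ux /= mulVg mulg1.
have U0x x : mu (Ux x : set (borel G)) = 0%E.
  rewrite -U0 -(haar_preimage haar (u * x^-1)%g (open_borel oU)).
  by congr (mu _); apply/seteqP; split => y; rewrite /Ux /= mulgA.
have : mu (\bigcup_(x in [set` D]) (Ux x : set (borel G))) = 0%E.
  apply/negligibleP.
    apply: fin_bigcup_measurable => // x _; exact: open_borel.
  rewrite bigcup_fset; elim/big_ind : _ => [|A B|x _].
  - exact: negligible_set0.
  - exact: negligibleU.
  - by apply/negligibleP; [exact: open_borel|exact: U0x].
rewrite (_ : \bigcup_(x in _) _ = setT); last by apply/seteqP; split.
by move/eqP; rewrite probability_setT onee_eq0.
Qed.

(** Every point outside the support has a null basic neighbourhood; there are countably many basic
    sets, so the uncountable intersection defining the support does no harm. *)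
Lemma support_subset_measure (H : set G) : closed H -> S `<=` H -> nu (~` H) = 0%E.
Proof.
move=> cH SH; have [e [oe be]] := second_countable_seq sc.
pose E n : set (borel G) := if nu (e n) == 0%E then e n else set0.
have mE n : measurable (E n) by rewrite /E; case: ifP => // _; exact: open_borel.
have E0 : nu (\bigcup_n E n) = 0%E.
  by apply: measure_bigcup_eq0 => // n; rewrite /E; case: ifP => [/eqP|_]; rewrite ?measure0.
apply/eqP; rewrite eq_le measure_ge0 andbT -E0; apply: le_measure; rewrite ?inE.
- by apply: open_borel; exact: closed_openC.
- exact: bigcup_measurable.
move=> x nHx; have : ~ S x by move=> /SH.
move=> /measure_supportP/existsNP[V /not_implyP[oV /not_implyP[Vx /negP]]].
rewrite -leNgt => V0; have [n enx enV] := be x V (open_nbhs_nbhs (conj oV Vx)).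
exists n => //; rewrite /E ifT//; apply/eqP/le_anti; rewrite measure_ge0 andbT.
by apply: le_trans V0; apply: le_measure; rewrite ?inE//; exact: open_borel.
Qed.

Section process.
Context d (Omega : measurableType d) (Pr : probability Omega R).
Variable X : nat -> {RV Pr >-> borel G}.
Hypothesis X_iid : iid X nu.

Definition has_clt (f : borel G -> R) := exists2 C : R, 0 < C &
  cvg_in_distribution Pr
    (fun N w => (\sum_(1 <= k < N.+1) f (partial_product X k w))
                  / Num.sqrt (C * N%:R)) (normal_prob 0 1).

Lemma partial_product_preimage_measurable k (A : set (borel G)) : measurable A ->
  measurable [set o | A (partial_product X k o)].
Proof.
move=> mA; rewrite -[X in measurable X]setTI.
exact: (measurable_partial_product sc).
Qed.

Lemma deterministic_no_clt (f : borel G -> R) (c : nat -> R) : bmf f ->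
  (forall k, (1 <= k)%N ->
     Pr (~` [set o | f (partial_product X k o) = c k]) = 0%E) ->
  ~ has_clt f.
Proof.
move=> bf fc [C C0]; pose E := \bigcap_(k in [set k | (1 <= k)%N]) [set o | f (partial_product X k o) = c k].
have mk k : measurable [set o | f (partial_product X k o) = c k].
  rewrite (_ : [set o | _] = [set o | (f @^-1` [set c k]) (partial_product X k o)])//.
  apply: partial_product_preimage_measurable.
  by rewrite -[X in measurable X]setTI; exact: (bmf_meas bf).
apply: (@cvg_in_distribution_normal_deterministic _ _ _ _ _
  (fun N => (\sum_(1 <= k < N.+1) c k) / Num.sqrt (C * N%:R)) E).
- by apply: bigcap_measurable; [exists 1%N|move=> k _; exact: mk].
- rewrite /E setC_bigcap bigcup_mkcond; apply: measure_bigcup_eq0 => k.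
    by case: ifP => // _; exact: measurableC.
  by case: ifPn => [|_]; [rewrite inE; exact: fc|exact: measure0].
- move=> N; apply: measurable_funM; last exact: measurable_cst.
  apply: measurable_sum => k.
  exact: (measurableT_comp (bmf_meas bf) (measurable_partial_product sc X k)).
- move=> N o Eo; congr (_ / _); apply: eq_big_nat => k /andP[k1 _].
  exact: Eo.
Qed.

End process.
End converse.

Lemma metrizable_separated (R : realType) (T : topologicalType) (x y : T) :
  metrizable R T -> x <> y ->
  exists U V : set T, [/\ open U, open V, U x, V y & U `&` V = set0].
Proof.
move=> [M [h [h' [hK _ ch _]]]] xy.
have hxy : h x != h y by apply/eqP => /(can_inj hK).
have : hausdorff_space M by exact: metric_hausdorff.
rewrite open_hausdorff => /(_ _ _ hxy)[[U V] /= [Ux Vy] [oU oV /eqP UV0]].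
exists (h @^-1` U), (h @^-1` V); split.
- by apply: open_comp => // ? _; exact: ch.
- by apply: open_comp => // ? _; exact: ch.
- by rewrite inE in Ux.
- by rewrite inE in Vy.
- by rewrite -preimage_setI UV0 preimage_set0.
Qed.

Lemma mean_indic_null d (T : measurableType d) (R : realType) (mu : probability T R)
    (A : set T) (h : T -> R) : measurable A -> mu A = 0%E -> bmf h ->
  \int[mu]_x (\1_A x * h x) = 0.
Proof.
move=> mA A0 bh; have [M M0 hM] := bmf_bound bh.
have bA := bmf_indic (R := R) mA; have bAh := bmfM bA bh.
apply/eqP; rewrite -normr_le0 (le_trans (mean_norm mu bAh))//.
apply: (@le_trans _ _ (\int[mu]_x (M * \1_A x))).
  apply: mean_le => [||x]; [exact: bmf_norm|exact: bmfZ|].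
  by rewrite normrM ger0_norm// mulrC ler_wpM2r.
by rewrite meanZ// mean_indic// A0 mulr0.
Qed.

Lemma not_ae_eq0 d (T : measurableType d) (R : realType) (mu : probability T R)
    (B : set T) (f : T -> R) : measurable B -> (0 < mu B)%E ->
  (forall x, B x -> f x <> 0) -> ~ {ae mu, forall x, f x = 0}.
Proof.
move=> mB B0 fB [N [mN N0 fN]].
have : (mu B <= mu N)%E.
  by apply: le_measure; rewrite ?inE// => x Bx; apply: fN; exact: fB.
by rewrite N0 leNgt B0.
Qed.

Lemma subgroup_closed_ops (G : groupType) (H : set G) : group_closed [in H] ->
  [/\ H 1%g, forall u, H u -> H (u^-1)%g & forall u v, H u -> H v -> H (u * v)%g].
Proof.
move=> [H1 HD].
have Hdiv u v : H u -> H v -> H (u / v)%g.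
  by move=> Hu Hv; have := HD u v; rewrite !inE; apply.
rewrite inE in H1.
have HV u : H u -> H (u^-1)%g by move=> Hu; rewrite -div1g; exact: Hdiv.
by split => // u v Hu Hv; rewrite -[v]invgK; apply: Hdiv => //; exact: HV.
Qed.

Section converse.
Context {R : realType} {G : topologicalGroupType}.
Hypothesis sc : @second_countable G.
Hypotheses (cG : compact [set: G]) (G_metrizable : metrizable R G).
Variables mu nu : probability (borel G) R.
Hypothesis haar : normalized_haar mu.
Local Notation S := (measure_support nu).
Context d (Omega : measurableType d) (Pr : probability Omega R).
Variable X : nat -> {RV Pr >-> borel G}.
Hypothesis X_iid : iid X nu.
Hypothesis all_clt : forall f : borel G -> R, bmf f ->
  \int[mu]_x f x = 0 -> ~ {ae mu, forall x, f x = 0} -> has_clt X f.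

(** Separating two points gives an open U with 0 < mu U < 1, and [g] is its centered indicator.
    Redefining [g] to be 1 on the null set A leaves its mean unchanged and makes every f(S_k) equal
    to 1 almost surely. *)
Lemma walk_in_null_set_false (A : set (borel G)) :
  measurable A -> mu A = 0%E ->
  (forall k, (1 <= k)%N -> Pr (~` [set o | A (partial_product X k o)]) = 0%E) ->
  False.
Proof.
move=> mA A0 XA.
have [a Aa] : A !=set0.
  apply/set0P/eqP => A00; have := XA 1%N isT.
  rewrite A00 (_ : ~` _ = setT); last by apply/seteqP; split => // o _ [].
  by move/eqP; rewrite probability_setT onee_eq0.
have [b ab] : exists b : G, (a : G) <> b.
  apply: contrapT => /forallNP h.
  have AT : A = setT.
    by apply/seteqP; split => // x _; have /contrapT <- := h x.
  by move/eqP: A0; rewrite AT probability_setT onee_eq0.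
have [U [V [oU oV Ua Vb UV0]]] := metrizable_separated G_metrizable ab.
have U0 : (0 < mu U)%E by apply: haar_open_gt0 => //; exists a.
have V0 : (0 < mu V)%E by apply: haar_open_gt0 => //; exists b.
have mU := open_borel oU; have mV := open_borel oV.
have mUfin : mu U \is a fin_num by rewrite fin_num_measure.
have U1 : (mu U < 1)%E.
  rewrite -(@probability_setT _ _ _ mu) -(setvU (U : set (borel G))).
  rewrite measureU//; [|exact: measurableC|exact: setICl].
  rewrite addeC lteDl// (lt_le_trans V0)//.
  apply: le_measure; rewrite ?inE//; first exact: measurableC.
  by move=> x Vx Ux; have : (U `&` V) x by []; rewrite UV0.
pose g (x : borel G) : R := \1_(U : set (borel G)) x - fine (mu U).
have bg : bmf g by apply: bmfB; [exact: bmf_indic|exact: bmf_cst].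
have g0 : \int[mu]_x g x = 0.
  by rewrite meanB; [rewrite mean_indic// mean_cst subrr|exact: bmf_indic|exact: bmf_cst].
have bg1 : bmf (fun x => 1 - g x) by apply: bmfB => //; exact: bmf_cst.
have bA := bmf_indic (R := R) mA.
pose f x := \1_A x * (1 - g x) + g x.
have bf : bmf f by apply: bmfD => //; exact: bmfM.
apply: (@deterministic_no_clt _ _ sc _ _ _ X f (fun=> 1) bf).
  move=> k k1; apply/eqP; rewrite eq_le measure_ge0 andbT -(XA k k1).
  have mS := partial_product_preimage_measurable sc X k mA.
  have mf1 : measurable [set x | f x = 1].
    rewrite (_ : [set x | _] = f @^-1` [set 1])//.
    by rewrite -[X in measurable X]setTI; exact: (bmf_meas bf).
  apply: le_measure; rewrite ?inE.
  - by apply: measurableC; exact: (partial_product_preimage_measurable sc X k mf1).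
  - exact: measurableC.
  move=> o nf Ao; apply: nf => /=; rewrite /f indicE mem_set//=.
  by rewrite mul1r subrK.
apply: all_clt => //.
  rewrite meanD//; last exact: bmfM.
  by rewrite mean_indic_null// g0 addr0.
apply: (@not_ae_eq0 _ _ _ _ ((U : set (borel G)) `\` A)).
- exact: measurableD.
- have UA : (mu (U : set (borel G)) <= mu (((U : set (borel G)) `\` A) `|` A))%E.
    apply: le_measure; rewrite ?inE//; first by apply: measurableU => //; exact: measurableD.
    by move=> x Ux; have [?|?] := pselect (A x); [right|left].
  rewrite (lt_le_trans U0)// (le_trans UA)//.
  rewrite (le_trans (measureU2 _ _ _))//; first exact: measurableD.
  by rewrite [X in (_ + X)%E]A0 adde0.
move=> x [Ux nAx]; rewrite /f /g !indicE memNset// mem_set//= mul0r add0r.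
apply/eqP; rewrite gt_eqF// subr_gt0 -lte_fin fineK//.
Qed.

(** If H is null, the walk stays in the null union of the cosets x^k H. Otherwise the centered
    indicator of H is admissible: mu H < 1, because a coset z H disjoint from H has the same
    measure. *)
Lemma walk_in_cosets_false (H : set G) (x : G) :
  proper_closed_subgroup H ->
  (forall k, Pr (~` [set o | H ((x ^+ k)^-1 * partial_product X k o)%g]) = 0%E) ->
  False.
Proof.
move=> [[cH gH] HT] XH.
have [H1 HV HM] := subgroup_closed_ops gH.
have mH := closed_borel cH.
have [z nHz] : exists z, ~ H z.
  apply: contrapT => /forallNP h; move/eqP: HT; apply.
  by apply/seteqP; split => // z _; exact: contrapT (h z).
have mHx k : measurable [set y : borel G | H ((x ^+ k)^-1 * (y : G))%g].
  rewrite -[X in measurable X]setTI.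
  exact: (@measurable_mull _ (x ^+ k)^-1%g measurableT H mH).
have [H0|H0] := eqVneq (mu H) 0%E.
  apply: (@walk_in_null_set_false (\bigcup_k [set y : borel G | H ((x ^+ k)^-1 * (y : G))%g])).
  - exact: bigcup_measurable.
  - apply: measure_bigcup_eq0 => // k.
    by rewrite -[RHS]H0; exact: (haar_preimage haar (x ^+ k)^-1%g mH).
  - move=> k _; apply/eqP; rewrite eq_le measure_ge0 andbT -(XH k).
    apply: le_measure; rewrite ?inE.
    + apply: measurableC; apply: (partial_product_preimage_measurable sc X).
      exact: bigcup_measurable.
    + by apply: measurableC; exact: (partial_product_preimage_measurable sc X k (mHx k)).
    by move=> o nU Ho; apply: nU; exists k.
have Hpos : (0 < mu H)%E by rewrite lt0e H0 measure_ge0.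
have Hfin : mu H \is a fin_num by rewrite fin_num_measure.
have mzH : measurable [set y : borel G | H (z^-1 * (y : G))%g].
  rewrite -[X in measurable X]setTI.
  exact: (@measurable_mull _ z^-1%g measurableT H mH).
have Hlt1 : (mu H < 1)%E.
  rewrite -(@probability_setT _ _ _ mu) -(setvU (H : set (borel G))).
  rewrite measureU//; [|exact: measurableC|exact: setICl].
  rewrite addeC lteDl// (lt_le_trans Hpos)//.
  rewrite -(haar_preimage haar z^-1%g mH).
  apply: le_measure; rewrite ?inE//; first exact: measurableC.
  move=> y /= Hzy Hy; apply: nHz.
  by rewrite -[z]invgK -(mulgK y z^-1%g); apply: (HV); apply: HM => //; exact: HV.
pose f (y : borel G) : R := \1_(H : set (borel G)) y - fine (mu H).
have bf : bmf f by apply: bmfB; [exact: bmf_indic|exact: bmf_cst].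
(* On the coset x^k H, membership of S_k in H is equivalent to membership of x^k, which is not
   random. *)
pose c k : R := \1_(H : set (borel G)) ((x ^+ k)%g : borel G) - fine (mu H).
apply: (@deterministic_no_clt _ _ sc _ _ _ X f c bf).
  move=> k k1; apply/eqP; rewrite eq_le measure_ge0 andbT -(XH k).
  have mf1 : measurable [set y | f y = c k].
    rewrite (_ : [set y | _] = f @^-1` [set c k])//.
    by rewrite -[X in measurable X]setTI; exact: (bmf_meas bf).
  apply: le_measure; rewrite ?inE.
  - by apply: measurableC; exact: (partial_product_preimage_measurable sc X k mf1).
  - by apply: measurableC; exact: (partial_product_preimage_measurable sc X k (mHx k)).
  move=> o nf Ho; apply: nf => /=; rewrite /f /c; congr (_ - _).
  rewrite !indicE; congr (_%:R); congr nat_of_bool.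
  apply/idP/idP; rewrite !inE => h.
    rewrite -[(x ^+ k)%g]invgK; apply: (HV).
    by rewrite -(mulgK (partial_product X k o) (x ^- k)%g); apply: HM => //; exact: HV.
  by rewrite -(mulVKg (x ^+ k)%g (partial_product X k o)); exact: HM.
apply: all_clt => //.
  by rewrite meanB; [rewrite mean_indic// mean_cst subrr|exact: bmf_indic|exact: bmf_cst].
apply: (@not_ae_eq0 _ _ _ _ (H : set (borel G))) => // y Hy.
rewrite /f indicE mem_set//=.
by apply/eqP; rewrite gt_eqF// subr_gt0 -lte_fin fineK.
Qed.

Lemma increments_in_closed (C : set G) : closed C -> S `<=` C ->
  Pr (~` \bigcap_i [set o | C (X i o)]) = 0%E.
Proof.
move=> cC SC; have mC := closed_borel cC.
have mXC i : measurable [set o | C (X i o)].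
  by rewrite -[X in measurable X]setTI; apply: measurable_funPT.
rewrite setC_bigcap; apply: measure_bigcup_eq0 => i; first exact: measurableC.
rewrite -(support_subset_measure sc cC SC) -(X_iid.2 i)//; exact: measurableC.
Qed.

Lemma clt_adapted : adapted nu.
Proof.
move=> H Hp SH; have [[cH gH] _] := Hp.
have [H1 _ HM] := subgroup_closed_ops gH.
have mH := closed_borel cH.
apply: (@walk_in_cosets_false H 1%g Hp) => k.
apply/eqP; rewrite eq_le measure_ge0 andbT -(increments_in_closed cH SH).
apply: le_measure; rewrite ?inE.
- apply: measurableC.
  have -> : [set o | H ((1 ^+ k)^-1 * partial_product X k o)%g] =
    [set o | H (partial_product X k o)].
    by apply/seteqP; split => o; rewrite /= expg1n invg1 mul1g.
  exact: (partial_product_preimage_measurable sc X k mH).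
- apply: measurableC; apply: bigcap_measurableType => i _.
  by rewrite -[X in measurable X]setTI; apply: measurable_funPT.
move=> o nH HX; apply: nH => /=; rewrite expg1n invg1 mul1g.
rewrite /partial_product; elim/big_ind : _ => // i _; exact: HX.
Qed.

(** If the support lies in x H, then so do all increments almost surely, and normality of H puts a
    product of k elements of x H in x^k H. *)
Lemma clt_strictly_aperiodic : strictly_aperiodic nu.
Proof.
move=> H Hp Hn x SH; have [[cH gH] _] := Hp.
have [H1 _ HM] := subgroup_closed_ops gH.
have cxH : closed (lcoset_set x H).
  rewrite (_ : lcoset_set x H = (fun y => x^-1 * y)%g @^-1` H).
    by apply: closed_comp => // y _; exact: mull_continuous.
  apply/seteqP; split => y /=; first by move=> [h Hh <-]; rewrite mulKg.
  by move=> Hy; exists (x^-1 * y)%g => //; rewrite mulVKg.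
have mH := closed_borel cH; have mxH := closed_borel cxH.
apply: (@walk_in_cosets_false H x Hp) => k.
have mHx : measurable [set y : borel G | H ((x ^+ k)^-1 * (y : G))%g].
  rewrite -[X in measurable X]setTI.
  exact: (@measurable_mull _ (x ^+ k)^-1%g measurableT H mH).
apply/eqP; rewrite eq_le measure_ge0 andbT -(increments_in_closed cxH SH).
apply: le_measure; rewrite ?inE.
- apply: measurableC; exact: (partial_product_preimage_measurable sc X k mHx).
- apply: measurableC; apply: bigcap_measurableType => i _.
  by rewrite -[X in measurable X]setTI; apply: measurable_funPT.
move=> o nH HX; apply: nH => /=; elim: k {mHx} => [|k IH].
  by rewrite expg0 invg1 mul1g /partial_product big_ord0.
have -> : partial_product X k.+1 o = (partial_product X k o * (X k o : G))%g.
  by rewrite /partial_product big_ord_recr.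
have [h Hh <-] := HX k Logic.I.
rewrite expgSr invgM.
have -> : ((x^-1 * (x ^+ k)^-1) * (partial_product X k o * (x * h)) =
  (((x ^+ k)^-1 * partial_product X k o) ^ x) * h)%g.
  by rewrite conjgE !mulgA.
by apply: HM => //; exact: Hn.
Qed.

Lemma partial_product_law k (A : set (borel G)) : measurable A ->
  Pr [set o | A (partial_product X k o)] = cpow sc nu k A.
Proof.
move=> mA.
have drivenE j o : driven X (@mulb G) (1%g : borel G) j o = partial_product X j o.
  elim: j => [|j IH]; first by rewrite /partial_product big_ord0.
  by rewrite /= /mulb /= IH /partial_product big_ord_recr.
have meanS j (h : borel G -> R) : bmf h ->
    \int[Pr]_o h (partial_product X j o) = iter j (opc nu) h 1%g.
  elim: j h => [|j IH] h bh.
    by apply: mean_constant => o; rewrite /partial_product big_ord0.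
  rewrite iterSr -IH; last exact: (bmf_opc sc).
  transitivity (\int[Pr]_o h (driven X (@mulb G) (1%g : borel G) j.+1 o)).
    by apply: mean_ext => o; rewrite drivenE.
  rewrite (mean_driven (1%g : borel G) X_iid (measurable_mulb sc))//.
  by apply: mean_ext => o; rewrite drivenE.
have bA := bmf_indic (R := R) mA.
have mS := partial_product_preimage_measurable sc X k mA.
rewrite -[LHS]fineK ?fin_num_measure// -[RHS]fineK ?fin_num_measure//.
congr EFin; rewrite -!mean_indic//.
transitivity (\int[Pr]_o \1_A (partial_product X k o : borel G) : R); first by [].
rewrite meanS// -(opc_cpow sc)// /opc.
by apply: mean_ext => y; rewrite mul1g.
Qed.

(** Restricting nu^k to a maximal null set and to its complement gives a Lebesgue decomposition. If
    the absolutely continuous part vanished for all k >= 1, the union of these null sets would be a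
    null set containing every S_k almost surely. *)
Lemma clt_nonsingular : exists2 k : nat, (1 <= k)%N &
  exists mabs msing : {measure set (borel G) -> \bar R},
    lebesgue_decomposition (convolution_power nu k) mu mabs msing /\
    exists2 A : set (borel G), measurable A & mabs A <> 0%E.
Proof.
apply: contrapT => sing.
have dec k : (1 <= k)%N -> exists2 A : set (borel G), measurable A &
    mu A = 0%E /\ cpow sc nu k (~` A) = 0%E.
  move=> k1; have [A mA [A0 Amax]] := maximal_null_set (cpow sc nu k) mu.
  exists A => //; split => //.
  apply: contrapT => cA; apply: sing; exists k => //.
  have mA' := measurableC mA.
  pose mabs : {measure set (borel G) -> \bar R} := mrestr (cpow sc nu k) mA'.
  pose msing : {measure set (borel G) -> \bar R} := mrestr (cpow sc nu k) mA.
  have mabsE B : mabs B = cpow sc nu k (B `&` ~` A) by [].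
  have msingE B : msing B = cpow sc nu k (B `&` A) by [].
  exists mabs, msing; split; last first.
    by exists setT => //; rewrite mabsE setTI.
  split=> [B mB||].
  - rewrite -(cpowE sc)// mabsE msingE -setDE.
    exact: measureDI.
  - move=> B nB C mC CB; rewrite mabsE -setDE; apply: Amax => //.
    exact: nB.
  - exists (~` A) => //; split; last by rewrite setCK.
    by rewrite msingE setICl measure0.
(* At k = 0 the law is the Dirac mass at 1 and nothing is claimed; the empty set fills that
   index. *)
have {}dec k : exists A : set (borel G), measurable A /\
    mu A = 0%E /\ ((1 <= k)%N -> cpow sc nu k (~` A) = 0%E).
  case: k => [|k]; first by exists set0; rewrite measure0.
  by have [//|A mA [A0 cA]] := dec k.+1; exists A.
have /choice[A hA] := dec.
have mA k : measurable (A k) by have [] := hA k.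
apply: (@walk_in_null_set_false (\bigcup_k A k)).
- exact: bigcup_measurable.
- by apply: measure_bigcup_eq0 => // k; have [_ []] := hA k.
move=> k k1; have [_ [_ /(_ k1) cA]] := hA k.
apply/eqP; rewrite eq_le measure_ge0 andbT -cA.
have mSk := partial_product_preimage_measurable sc X k (measurableC (mA k)).
rewrite -(partial_product_law k (measurableC (mA k))).
apply: le_measure; rewrite ?inE//.
  apply: measurableC; apply: (partial_product_preimage_measurable sc X).
  exact: bigcup_measurable.
by move=> o nU Ao; apply: nU; exists k.
Qed.

End converse.

Theorem theorem2 (R : realType) (G : topologicalGroupType)
    (G_compact : compact [set: G]) (G_metrizable : metrizable R G)
    (mu : probability (borel G) R) (mu_haar : normalized_haar mu)
    (nu : probability (borel G) R) (nu_central : central nu)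
    (d : measure_display) (Omega : measurableType d) (P : probability Omega R)
    (X : nat -> {RV P >-> borel G}) (X_iid : iid X nu) :
  [/\ adapted nu,
      strictly_aperiodic nu
    & exists2 k : nat, (1 <= k)%N &
      exists mabs msing : {measure set (borel G) -> \bar R},
        lebesgue_decomposition (convolution_power nu k) mu mabs msing /\
        exists2 A : set (borel G), measurable A & mabs A <> 0%E]
  <->
  (forall f : borel G -> R,
      (exists M : R, forall x, `|f x| <= M) ->
      measurable_fun [set: borel G] f ->
      (\int[mu]_x (f x)%:E = 0)%E ->
      ~ {ae mu, forall x, f x = 0} ->
    exists2 C : R, 0 < C &
      forall (d' : measure_display) (Omega' : measurableType d')
        (P' : probability Omega' R) (Y : nat -> {RV P' >-> borel G}),
        iid Y nu ->
        cvg_in_distribution P'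
          (fun N w => (\sum_(1 <= k < N.+1) f (partial_product Y k w))
                      / Num.sqrt (C * N%:R))
          (normal_prob 0 1)).
Proof.
have sc := compact_metrizable_second_countable G_compact G_metrizable.
split=> [[_ nu_aperiodic [k _ [mabs [msing [dec mabs0]]]]] f fM mf f0 fae0|clt_all].
  have [n [c [c0 D]]] :=
    doeblin sc G_compact mu_haar nu_central nu_aperiodic dec mabs0.
  have [rho01 contr] := doeblin_contraction sc c0 D.
  have bf : bmf f by split.
  by apply: (clt mu_haar nu_central rho01 contr) => //; apply: EFin_inj; rewrite bmf_EFin.
(* The converse tests the limit only along the given sequence [X]. *)
have all_clt f : bmf f -> \int[mu]_x f x = 0 ->
    ~ {ae mu, forall x, f x = 0} -> has_clt X f.
  move=> bf f0 fae0; have [mf fM] := bf.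
  have [||C C0 CY] := clt_all f fM mf; [by rewrite -bmf_EFin// f0|by []|].
  by exists C => //; exact: CY.
split.
- exact: (clt_adapted sc G_compact G_metrizable mu_haar X_iid all_clt).
- exact: (clt_strictly_aperiodic sc G_compact G_metrizable mu_haar X_iid all_clt).
- exact: (clt_nonsingular sc G_compact G_metrizable mu_haar X_iid all_clt).
Qed.
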